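(* Let $W\in\mathbb{Q}(X,Y)$ be the rational function such that $\zeta^{\triangleleft_{\mathrm{gr}}}_{\mathfrak{f}_{3,3}(\mathfrak{o})}(s)=W(q,q^{-s})$ for all primes $p$ and all finite extensions $\mathfrak{o}$ of $\mathbb{Z}_p$, with residue field cardinality $q$. The reduced graded ideal zeta function $\zeta^{\triangleleft_{\mathrm{gr}}}_{\mathfrak{f}_{3,3},\mathrm{red}}(Y):=W(1,Y)$ satisfies $$\zeta^{\triangleleft_{\mathrm{gr}}}_{\mathfrak{f}_{3,3},\mathrm{red}}(Y)=\frac{N_{\mathrm{red}}(Y)}{(1-Y)^3(1-Y^3)(1-Y^4)^2(1-Y^5)\prod_{i=8}^{14}(1-Y^i)},$$ where $N_{\mathrm{red}}(Y)\in\mathbb{Z}[Y]$ is equal to \begin{align*} &1+2Y^{3}+4Y^{4}+5Y^{5}+16Y^{6}+34Y^{7}+53Y^{8}+77Y^{9}+98Y^{10}+121Y^{11}+182Y^{12}+\\ &302Y^{13}+483Y^{14}+712Y^{15}+953Y^{16}+1187Y^{17}+1425Y^{18}+1689Y^{19}+2046Y^{20}+\\ &2579Y^{21}+3298Y^{22}+4162Y^{23}+5059Y^{24}+5826Y^{25}+6398Y^{26}+6894Y^{27}+\\ &7475Y^{28}+8270Y^{29}+9265Y^{30}+10260Y^{31}+11041Y^{32}+11529Y^{33}+11745Y^{34}+\\ &11798Y^{35}+11811Y^{36}+11811Y^{37}+11798Y^{38}+11745Y^{39}+11529Y^{40}+11041Y^{41}+\\ &10260Y^{42}+9265Y^{43}+8270Y^{44}+7475Y^{45}+6894Y^{46}+6398Y^{47}+5826Y^{48}+\\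 &5059Y^{49}+4162Y^{50}+3298Y^{51}+2579Y^{52}+2046Y^{53}+1689Y^{54}+1425Y^{55}+\\ &1187Y^{56}+953Y^{57}+712Y^{58}+483Y^{59}+302Y^{60}+182Y^{61}+121Y^{62}+98Y^{63}+\\ &77Y^{64}+53Y^{65}+34Y^{66}+16Y^{67}+5Y^{68}+4Y^{69}+2Y^{70}+Y^{73}. \end{align*}
   Context: For $c\ge 1$, $d\ge 2$, $\mathfrak{f}_{c,d}$ denotes the free nilpotent Lie ring of nilpotency class $c$ on $d$ generators, i.e. the quotient of the free $\mathbb{Z}$-Lie algebra on $d$ generators by the $(c+1)$-th term of its lower central series. For a commutative ring $R$ set $\mathfrak{f}_{c,d}(R)=\mathfrak{f}_{c,d}\otimes_{\mathbb{Z}}R$, an $R$-Lie algebra. For an $R$-Lie algebra $L$, nilpotent of class $c$ and free of finite rank over $R$, with lower central series $(\gamma_i(L))$, set $L^{(i)}=\gamma_i(L)/\gamma_{i+1}(L)$ and let $\mathrm{gr}L=\bigoplus_{i=1}^c L^{(i)}$ be the associated graded $R$-Lie algebra. An $R$-ideal $I$ of $\mathrm{gr}L$ is graded if $I=\bigoplus_{i=1}^c (I\cap L^{(i)})$. The graded ideal zeta function of $L$ is $\zeta^{\triangleleft_{\mathrm{gr}}}_L(s)=\sum_{I}|\mathrm{gr}L:I|^{-s}$, the sum over graded $R$-ideals $I$ of finite index in $\mathrm{gr}L$. A finite extension $\mathfrak{o}$ of $\mathbb{Z}_p$ means the ring of integers of a finite extension of $\mathbb{Q}_p$. A rational function $W$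 as in the claim exists (this is another theorem of the source) and is uniquely determined. *)

(* Defs.v *)
From HB Require Import structures.
From mathcomp Require Import all_boot all_order all_algebra all_field.
From mathcomp Require Import finmap complex.
From mathcomp Require Import all_classical all_reals all_analysis.
From mathcomp.analysis.showcase Require summability.
From mathcomp Require Import zify ring.

Set Implicit Arguments.
Unset Strict Implicit.
Unset Printing Implicit Defensive.
Import Order.TTheory GRing.Theory Num.Theory.
Import numFieldNormedType.Exports.
Local Open Scope classical_set_scope.
Local Open Scope ring_scope.
Local Open Scope quotient_scope.

Fact modz_dvdm (a d e : int) : (d %| e)%Z -> ((a %% e)%Z %% d)%Z = (a %% d)%Z.
Proof.
move=> /dvdzP[k ->]; rewrite [in RHS](divz_eq a (k * d)) mulrA modzMDl //.
Qed.

Section PadicInt.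
Variables (p : nat) (p_pr : prime p).

(* Z_p is the inverse limit of the rings Z/p^n: an element is a sequence of
   residues x n in {0, ..., p^n - 1} with x n = x (n + 1) modulo p^n. *)
Definition padic_coherent : {pred nat -> int} :=
  fun x => `[< forall n, x n = (x n.+1 %% (p ^ n)%N%:Z)%Z >].

Definition padic_int := let _ := p_pr in {x : nat -> int | padic_coherent x}.
HB.instance Definition _ := [isSub of padic_int for @sval _ _].
HB.instance Definition _ := [Choice of padic_int by <:].

Let pn_neq0 n : (p ^ n)%N%:Z != 0.
Proof. by rewrite eqz_nat expn_eq0 negb_and -lt0n prime_gt0. Qed.

Let padicP (x : padic_int) n : val x n = (val x n.+1 %% (p ^ n)%N%:Z)%Z.
Proof. exact: (asboolW (valP x)). Qed.

Let modz_red (a : int) n :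
  ((a %% (p ^ n.+1)%N%:Z)%Z %% (p ^ n)%N%:Z)%Z = (a %% (p ^ n)%N%:Z)%Z.
Proof. by rewrite modz_dvdm // expnS PoszM dvdz_mull. Qed.

Let padic_red (x : padic_int) n : (val x n %% (p ^ n)%N%:Z)%Z = val x n.
Proof. by rewrite padicP modz_mod. Qed.

Fact padic_coherent_mk (a : nat -> int) :
  (forall n, a n = a n.+1 %[mod (p ^ n)%N%:Z])%Z ->
  padic_coherent (fun n => a n %% (p ^ n)%N%:Z)%Z.
Proof. by move=> aP; apply/asboolP => n; rewrite modz_red. Qed.

Definition padic_mk (a : nat -> int) aP : padic_int :=
  Sub _ (@padic_coherent_mk a aP).

Fact padic_add_proof (x y : padic_int) n :
  (val x n + val y n = val x n.+1 + val y n.+1 %[mod (p ^ n)%N%:Z])%Z.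
Proof. by rewrite [in LHS]padicP [in LHS](padicP y) modzDm. Qed.
Fact padic_mul_proof (x y : padic_int) n :
  (val x n * val y n = val x n.+1 * val y n.+1 %[mod (p ^ n)%N%:Z])%Z.
Proof. by rewrite [in LHS]padicP [in LHS](padicP y) modzMm. Qed.
Fact padic_opp_proof (x : padic_int) n :
  (- val x n = - val x n.+1 %[mod (p ^ n)%N%:Z])%Z.
Proof. by rewrite [in LHS]padicP modzNm. Qed.
Fact padic_cst_proof (a : int) n : (a = a %[mod (p ^ n)%N%:Z])%Z.
Proof. by []. Qed.

Definition padic_add x y := padic_mk (padic_add_proof x y).
Definition padic_mul x y := padic_mk (padic_mul_proof x y).
Definition padic_opp x := padic_mk (padic_opp_proof x).
Definition padic_cst a := padic_mk (padic_cst_proof a).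

Let eq_padic (x y : padic_int) : (forall n, val x n = val y n) -> x = y.
Proof. by move=> xy; apply: val_inj; apply/funext. Qed.

Let padic_addA : associative padic_add.
Proof. by move=> x y z; apply: eq_padic => n /=; rewrite modzDml modzDmr addrA. Qed.
Let padic_addC : commutative padic_add.
Proof. by move=> x y; apply: eq_padic => n /=; rewrite addrC. Qed.
Let padic_add0 : left_id (padic_cst 0) padic_add.
Proof. by move=> x; apply: eq_padic => n /=; rewrite mod0z add0r padic_red. Qed.
Let padic_addN : left_inverse (padic_cst 0) padic_opp padic_add.
Proof. by move=> x; apply: eq_padic => n /=; rewrite modzDml addNr. Qed.
HB.instance Definition _ :=
  GRing.isZmodule.Build padic_int padic_addA padic_addC padic_add0 padic_addN.

Let padic_mulA : associative padic_mul.
Proof. by move=> x y z; apply: eq_padic => n /=; rewrite modzMml modzMmr mulrA. Qed.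
Let padic_mulC : commutative padic_mul.
Proof. by move=> x y; apply: eq_padic => n /=; rewrite mulrC. Qed.
Let padic_mul1 : left_id (padic_cst 1) padic_mul.
Proof. by move=> x; apply: eq_padic => n /=; rewrite modzMml mul1r padic_red. Qed.
Let padic_mulD : left_distributive padic_mul +%R.
Proof.
by move=> x y z; apply: eq_padic => n /=; rewrite modzMml modzDm mulrDl.
Qed.
Let padic_1neq0 : padic_cst 1 != 0.
Proof.
apply/eqP => /(congr1 (fun x => val x 1%N)) /=; rewrite expn1 mod0z modz_small //.
by rewrite ltz_nat prime_gt1.
Qed.
HB.instance Definition _ := GRing.Zmodule_isComNzRing.Build padic_int
  padic_mulA padic_mulC padic_mul1 padic_mulD padic_1neq0.

Definition padic_unit : {pred padic_int} := fun x => `[< exists y, y * x = 1 >].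
Definition padic_inv (x : padic_int) : padic_int :=
  if pselect (exists y, y * x = 1) is left h then projT1 (cid h) else x.

Let padic_mulV : {in padic_unit, left_inverse 1 padic_inv *%R}.
Proof.
move=> x /asboolP h; rewrite /padic_inv; case: pselect => // h'.
exact: (projT2 (cid h')).
Qed.
Let padic_unitP (x y : padic_int) : y * x = 1 -> padic_unit x.
Proof. by move=> yx; apply/asboolP; exists y. Qed.
Let padic_inv_out : {in [predC padic_unit], padic_inv =1 id}.
Proof.
move=> x; rewrite inE => /negP nu; rewrite /padic_inv; case: pselect => // h.
by case: nu; apply/asboolP.
Qed.
HB.instance Definition _ := GRing.ComNzRing_hasMulInverse.Build padic_int
  padic_mulV padic_unitP padic_inv_out.

Let padic_modm (x : padic_int) n k : (val x (n + k)%N %% (p ^ n)%N%:Z)%Z = val x n.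
Proof.
elim: k => [|k IH]; first by rewrite addn0 padic_red.
rewrite -[RHS]IH [val x (n + k)%N]padicP modz_dvdm ?addnS //.
by rewrite expnD PoszM dvdz_mulr.
Qed.

Let padic_neq0P (x : padic_int) : x != 0 -> exists n, val x n != 0.
Proof.
move=> x0; apply: contrapT => h; case/eqP: x0; apply: eq_padic => n /=.
by rewrite mod0z; apply/eqP/negPn/negP => xn; apply: h; exists n.
Qed.

Let padic_idomain : GRing.integral_domain_axiom padic_int.
Proof.
move=> x y xy0; apply/orP; have [|/padic_neq0P[m xm]] := eqVneq x 0; first by left.
right; apply/negPn/negP => /padic_neq0P[n yn].
have xm' : ~~ (((p ^ m)%N%:Z) %| val x (m + n)%N)%Z.
  apply: contra xm; rewrite -(padic_modm x m n) => /dvdz_mod0P->.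
  by rewrite eqxx.
have yn' : ~~ (((p ^ n)%N%:Z) %| val y (m + n)%N)%Z.
  apply: contra yn; rewrite -(padic_modm y n m) (addnC n m) => /dvdz_mod0P->.
  by rewrite eqxx.
have := congr1 (fun x => val x (m + n)%N) xy0; rewrite /= mod0z.
move/dvdz_mod0P; move: xm' yn'; rewrite !dvdzE !abszM /=.
move: (absz (val x _)) (absz (val y _)) => a b am bn; apply/negP.
case: (posnP a) am => [->|a0]; first by rewrite dvdn0.
case: (posnP b) bn => [->|b0]; first by rewrite dvdn0.
rewrite !pfactor_dvdn ?muln_gt0 ?a0 // lognM // -!ltnNge.
lia.
Qed.
HB.instance Definition _ :=
  GRing.ComUnitRing_isIntegral.Build padic_int padic_idomain.
End PadicInt.

Definition padic (p : nat) (p_pr : prime p) := {fraction (padic_int p_pr)}.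
HB.instance Definition _ p p_pr := GRing.Field.on (@padic p p_pr).

Section IntegerRing.
Variables (p : nat) (p_pr : prime p) (K : fieldExtType (padic p_pr)).

Definition padic_int_emb (a : padic_int p_pr) : K := in_alg K (tofrac a).
HB.instance Definition _ :=
  GRing.RMorphism.copy padic_int_emb (in_alg K \o @tofrac _).

Definition integral_closure : {pred K} :=
  fun x => `[< integralOver padic_int_emb x >].
Fact integral_closure_subring : subring_closed integral_closure.
Proof.
split=> [|x y /asboolP xi /asboolP yi|x y /asboolP xi /asboolP yi];
  apply/asboolP; [exact: integral1|exact: integral_sub|exact: integral_mul].
Qed.
HB.instance Definition _ :=
  GRing.isSubringClosed.Build K integral_closure integral_closure_subring.

Definition integer_ring := {x : K | x \in integral_closure}.
HB.instance Definition _ := [isSub of integer_ring for @sval _ _].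
HB.instance Definition _ := [Choice of integer_ring by <:].
HB.instance Definition _ :=
  [SubChoice_isSubComNzRing of integer_ring by <:].
End IntegerRing.

Section Submodule.
Variables (R : pzRingType) (M : lmodType R).

Definition is_submodule (N : set M) :=
  N 0 /\ forall a x y, N x -> N y -> N (a *: x + y).

(* The index |M : N| is the number of cosets x + N. *)
Definition cosets (N : set M) : set (set M) :=
  [set [set y | N (y - x)] | x in [set: M]].
Definition finite_index (N : set M) := finite_set (cosets N).
Definition submod_index (N : set M) : nat := #|` fset_set (cosets N)|.

Lemma smallest_submodule (A : set M) : is_submodule (smallest is_submodule A).
Proof.
split=> [N [[N0 _] _]//|a x y Ax Ay N NP].
by case: (NP) => -[_ NZ] _; apply: NZ; [apply: Ax|apply: Ay].
Qed.

Section Bundled.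
Variables (N : set M) (N_sub : is_submodule N).

Definition submod_pred : {pred M} := let _ := N_sub in fun x => `[< N x >].
Fact submod_pred_closed : submod_closed submod_pred.
Proof.
case: N_sub => N0 NZ; split=> [|a x y /asboolP Nx /asboolP Ny]; apply/asboolP => //.
exact: NZ.
Qed.
HB.instance Definition _ := GRing.isSubmodClosed.Build R M submod_pred
  (GRing.submod_closed_semi submod_pred_closed).
Lemma submod_predE x : (x \in submod_pred) = `[< N x >]. Proof. by []. Qed.

Definition submod_type := {x : M | x \in submod_pred}.
HB.instance Definition _ := [isSub of submod_type for @sval _ _].
HB.instance Definition _ := [Choice of submod_type by <:].
HB.instance Definition _ := [SubChoice_isSubLmodule of submod_type by <:].

Definition submod_val (u : submod_type) : M := val u.
(* The dummy value 0 outside of N. *)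
Definition submod_elt (x : M) : submod_type := insubd 0 x.
Lemma submod_valP u : N (submod_val u).
Proof. exact: (asboolW (valP u)). Qed.
Lemma submod_val_inj : injective submod_val. Proof. exact: val_inj. Qed.
Lemma submod_valK u : submod_elt (submod_val u) = u. Proof. exact: valKd. Qed.
Lemma submod_eltK x : N x -> submod_val (submod_elt x) = x.
Proof. by move=> Nx; apply: insubdK; apply/asboolP. Qed.
Lemma submod_val0 : submod_val 0 = 0. Proof. exact: raddf0. Qed.
Lemma submod_valD u v : submod_val (u + v) = submod_val u + submod_val v.
Proof. exact: raddfD. Qed.
Lemma submod_valB u v : submod_val (u - v) = submod_val u - submod_val v.
Proof. exact: raddfB. Qed.
Lemma submod_valZ a u : submod_val (a *: u) = a *: submod_val u.
Proof. exact: linearZ. Qed.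

Definition quot_mod := Quotient.quot submod_pred.
HB.instance Definition _ := GRing.Zmodule.on quot_mod.
HB.instance Definition _ := EqQuotient.on quot_mod.

Definition quot_proj (x : M) : quot_mod := \pi_quot_mod x.
Definition quot_repr (u : quot_mod) : M := repr u.
Lemma quot_reprK u : quot_proj (quot_repr u) = u. Proof. exact: reprK. Qed.
Lemma quot_projP x y : quot_proj x = quot_proj y <-> N (x - y).
Proof.
rewrite /quot_proj; split=> [/eqP|Nxy].
  by rewrite -(Quotient.idealrBE submod_pred) => /asboolP.
by apply/eqP; rewrite -(Quotient.idealrBE submod_pred); apply/asboolP.
Qed.
Lemma quot_projD x y : quot_proj (x + y) = quot_proj x + quot_proj y.
Proof. by rewrite /quot_proj (Quotient.pi_add submod_pred). Qed.
Lemma quot_proj0 x : quot_proj x = 0 <-> N x.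
Proof.
have -> : (0 : quot_mod) = quot_proj 0.
  by apply: (addrI (quot_proj 0)); rewrite addr0 -quot_projD addr0.
by rewrite quot_projP subr0.
Qed.

Definition quot_scale a (u : quot_mod) := quot_proj (a *: quot_repr u).
Lemma quot_projZ a x : quot_proj (a *: x) = quot_scale a (quot_proj x).
Proof.
apply/quot_projP; rewrite -scalerBr -[_ *: _]addr0; case: (N_sub) => N0 NZ.
by apply: NZ N0; apply/quot_projP; rewrite quot_reprK.
Qed.
Fact quot_scaleA a b u : quot_scale a (quot_scale b u) = quot_scale (a * b) u.
Proof. by rewrite -(quot_reprK u) -!quot_projZ scalerA. Qed.
Fact quot_scale1 : left_id 1 quot_scale.
Proof. by move=> u; rewrite -(quot_reprK u) -!quot_projZ scale1r. Qed.
Fact quot_scaleDr : right_distributive quot_scale +%R.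
Proof.
move=> a u v; rewrite -(quot_reprK u) -(quot_reprK v) -quot_projD -!quot_projZ.
by rewrite scalerDr quot_projD.
Qed.
Fact quot_scaleDl u : {morph quot_scale^~ u : a b / a + b}.
Proof.
by move=> a b; rewrite -(quot_reprK u) -!quot_projZ scalerDl quot_projD.
Qed.
HB.instance Definition _ := GRing.Zmodule_isLmodule.Build R quot_mod
  quot_scaleA quot_scale1 quot_scaleDr quot_scaleDl.
End Bundled.
End Submodule.

(* The direct sum of a finite family of modules. *)
Section DirectSum.
Variables (R : pzRingType) (I : finType) (M : I -> lmodType R).

Definition dsum := forall i, M i.
HB.instance Definition _ := Choice.on dsum.

Definition dsum_add (x y : dsum) : dsum := fun i => x i + y i.
Fact dsum_addA : associative dsum_add.
Proof. by move=> x y z; apply/functional_extensionality_dep => i; apply: addrA. Qed.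
Fact dsum_addC : commutative dsum_add.
Proof. by move=> x y; apply/functional_extensionality_dep => i; apply: addrC. Qed.
Fact dsum_add0 : left_id (fun i => 0) dsum_add.
Proof. by move=> x; apply/functional_extensionality_dep => i; apply: add0r. Qed.
Fact dsum_addN : left_inverse (fun i => 0) (fun x i => - x i) dsum_add.
Proof. by move=> x; apply/functional_extensionality_dep => i; apply: addNr. Qed.
HB.instance Definition _ :=
  GRing.isZmodule.Build dsum dsum_addA dsum_addC dsum_add0 dsum_addN.

Definition dsum_scale a (x : dsum) : dsum := fun i => a *: x i.
Fact dsum_scaleA a b x : dsum_scale a (dsum_scale b x) = dsum_scale (a * b) x.
Proof. by apply/functional_extensionality_dep => i; apply: scalerA. Qed.
Fact dsum_scale1 : left_id 1 dsum_scale.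
Proof. by move=> x; apply/functional_extensionality_dep => i; apply: scale1r. Qed.
Fact dsum_scaleDr : right_distributive dsum_scale +%R.
Proof. by move=> a x y; apply/functional_extensionality_dep => i; apply: scalerDr. Qed.
Fact dsum_scaleDl x : {morph dsum_scale^~ x : a b / a + b}.
Proof. by move=> a b; apply/functional_extensionality_dep => i; apply: scalerDl. Qed.
HB.instance Definition _ := GRing.Zmodule_isLmodule.Build R dsum
  dsum_scaleA dsum_scale1 dsum_scaleDr dsum_scaleDl.

Lemma dsumDE (x y : dsum) i : (x + y) i = x i + y i. Proof. by []. Qed.
Lemma dsumZE a (x : dsum) i : (a *: x) i = a *: x i. Proof. by []. Qed.
Lemma dsum0E i : (0 : dsum) i = 0. Proof. by []. Qed.
End DirectSum.

HB.mixin Record isLieAlgebra (R : comNzRingType) L of GRing.Lmodule R L := {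
  lie_br : L -> L -> L;
  lie_brDl : left_distributive lie_br +%R;
  lie_brDr : right_distributive lie_br +%R;
  lie_brZl : forall a x y, lie_br (a *: x) y = a *: lie_br x y;
  lie_brZr : forall a x y, lie_br x (a *: y) = a *: lie_br x y;
  lie_brxx : forall x, lie_br x x = 0;
  lie_jacobi : forall x y z,
    lie_br x (lie_br y z) + lie_br y (lie_br z x) + lie_br z (lie_br x y) = 0
}.
#[short(type="lieAlgType")]
HB.structure Definition LieAlgebra (R : comNzRingType) :=
  {L of GRing.Lmodule R L & isLieAlgebra R L}.

Section LieTheory.
Variables (R : comNzRingType) (L : lieAlgType R).
Implicit Types (x y z : L) (I : set L).

Lemma lie_br0l y : lie_br 0 y = 0 :> L.
Proof. by have := lie_brZl 0 0 y; rewrite !scale0r. Qed.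
Lemma lie_br0r x : lie_br x 0 = 0 :> L.
Proof. by have := lie_brZr 0 x 0; rewrite !scale0r. Qed.
Lemma lie_brNl x y : lie_br (- x) y = - lie_br x y.
Proof. by rewrite -scaleN1r lie_brZl scaleN1r. Qed.
Lemma lie_brNr x y : lie_br x (- y) = - lie_br x y.
Proof. by rewrite -scaleN1r lie_brZr scaleN1r. Qed.
Lemma lie_brC x y : lie_br x y = - lie_br y x.
Proof.
apply/eqP; rewrite -addr_eq0; apply/eqP.
have := lie_brxx (x + y); rewrite lie_brDl !lie_brDr !lie_brxx.
by rewrite add0r addr0.
Qed.
Lemma lie_br_suml (J : finType) (P : pred J) (f : J -> L) y :
  lie_br (\sum_(j | P j) f j) y = \sum_(j | P j) lie_br (f j) y.
Proof. by apply: (big_morph (lie_br^~ y)) => [u v|]; rewrite ?lie_brDl ?lie_br0l. Qed.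
Lemma lie_br_sumr (J : finType) (P : pred J) (f : J -> L) x :
  lie_br x (\sum_(j | P j) f j) = \sum_(j | P j) lie_br x (f j).
Proof. by apply: (big_morph (lie_br x)) => [u v|]; rewrite ?lie_brDr ?lie_br0r. Qed.

Definition is_lie_ideal I := is_submodule I /\ forall x y, I x -> I (lie_br x y).

Definition lie_comm (A B : set L) : set L :=
  smallest (@is_submodule R L) [set lie_br x y | x in A & y in B].

(* lcs i is gamma_i(L), so that lcs 1 = L; also lcs 0 = L. *)
Definition lcs (i : nat) : set L := iter i.-1 (fun N => lie_comm N setT) setT.

Lemma lcs_submodule i : is_submodule (lcs i).
Proof.
by rewrite /lcs; case: i.-1 => [|j] /=; [split|apply: smallest_submodule].
Qed.

Lemma lcs_br1 i x y : lcs i.+1 x -> lcs i.+2 (lie_br x y).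
Proof. by move=> xi; apply: sub_gen_smallest; exists x => //; exists y. Qed.
End LieTheory.
Arguments lcs {R} L i.

Section LieQuotient.
Variables (R : comNzRingType) (L : lieAlgType R).

Section ByIdeal.
Variables (I : set L) (I_ideal : is_lie_ideal I).

Definition quot_lie := quot_mod I_ideal.1.
HB.instance Definition _ := GRing.Lmodule.on quot_lie.
Local Notation proj := (quot_proj I_ideal.1).

Definition quot_br (u v : quot_lie) : quot_lie :=
  proj (lie_br (quot_repr u) (quot_repr v)).

Lemma quot_projBr x y : proj (lie_br x y) = quot_br (proj x) (proj y).
Proof.
have IK z : I (z - quot_repr (proj z)).
  by apply/(quot_projP I_ideal.1); rewrite quot_reprK.
have [[I0 IZ] IB] := I_ideal; apply/quot_projP.
set x' := quot_repr _; set y' := quot_repr _.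
have -> : lie_br x y - lie_br x' y' = 1 *: lie_br (x - x') y + - 1 *: lie_br (y - y') x'.
  rewrite scale1r scaleN1r !lie_brDl !lie_brNl (lie_brC y x') (lie_brC y' x').
  by rewrite !opprD !opprK addrA subrK.
by apply: (IZ); [|rewrite -[_ *: _]addr0; apply: IZ => //]; apply: IB; apply: IK.
Qed.

Let projW (P : quot_lie -> Prop) : (forall x, P (proj x)) -> forall u, P u.
Proof. by move=> Pp u; rewrite -(quot_reprK u). Qed.
Let projD x y : proj x + proj y = proj (x + y) :> quot_lie.
Proof. by rewrite quot_projD. Qed.
Let projZ a x : a *: (proj x : quot_lie) = proj (a *: x).
Proof. by rewrite quot_projZ. Qed.

Fact quot_brDl : left_distributive quot_br +%R.
Proof.
by elim/projW=> x; elim/projW=> y; elim/projW=> z; rewrite projD -!quot_projBr projD lie_brDl.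
Qed.
Fact quot_brDr : right_distributive quot_br +%R.
Proof.
by elim/projW=> x; elim/projW=> y; elim/projW=> z; rewrite projD -!quot_projBr projD lie_brDr.
Qed.
Fact quot_brZl a x y : quot_br (a *: x) y = a *: quot_br x y.
Proof.
by elim/projW: x => x; elim/projW: y => y; rewrite projZ -!quot_projBr projZ lie_brZl.
Qed.
Fact quot_brZr a x y : quot_br x (a *: y) = a *: quot_br x y.
Proof.
by elim/projW: x => x; elim/projW: y => y; rewrite projZ -!quot_projBr projZ lie_brZr.
Qed.
Fact quot_brxx x : quot_br x x = 0.
Proof.
elim/projW: x => x; rewrite -quot_projBr lie_brxx; apply/quot_proj0.
by have [[]] := I_ideal.
Qed.
Fact quot_jacobi x y z :
  quot_br x (quot_br y z) + quot_br y (quot_br z x) + quot_br z (quot_br x y) = 0.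
Proof.
elim/projW: x => x; elim/projW: y => y; elim/projW: z => z.
rewrite -!quot_projBr !projD lie_jacobi; apply/quot_proj0.
by have [[]] := I_ideal.
Qed.
HB.instance Definition _ := isLieAlgebra.Build R quot_lie
  quot_brDl quot_brDr quot_brZl quot_brZr quot_brxx quot_jacobi.
End ByIdeal.

Lemma lcsS i : lcs L i.+1 `<=` lcs L i.
Proof.
case: i => [|i]; first by [].
elim: i => [|i IH] //.
apply: (sub_smallest2r (smallest_submodule _)) => _ [y yi [z _ <-]].
by exists y; [exact: IH|exists z].
Qed.

Lemma lcs_ideal i : is_lie_ideal (lcs L i).
Proof.
split; first exact: lcs_submodule.
by case: i => // i x y xi; apply: lcsS; apply: lcs_br1.
Qed.

Lemma lcs_br i j (x y : L) :
  lcs L i.+1 x -> lcs L j.+1 y -> lcs L (i + j).+2 (lie_br x y).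
Proof.
elim: j i x y => [|j IH] i x y xi yj; first by rewrite addn0; exact: lcs_br1.
have [N0 NZ] := lcs_submodule L (i + j.+1).+2.
apply: (yj [set y | lcs L (i + j.+1).+2 (lie_br x y)]); split.
  split=> [|a u v xu xv] /=; first by rewrite lie_br0r.
  by rewrite lie_brDr lie_brZr; apply: NZ.
move=> _ [u uj [v _ <-]] /=.
have -> : lie_br x (lie_br u v) =
    1 *: lie_br (lie_br v x) u + 1 *: lie_br (lie_br x u) v.
  rewrite !scale1r (lie_brC (lie_br v x)) (lie_brC (lie_br x u)).
  by apply/eqP; rewrite -subr_eq0 opprD !opprK addrA lie_jacobi.
apply: (NZ); last rewrite -[_ *: _]addr0; last apply: (NZ) => //.
  rewrite addnS -addSn; apply: IH => //.
  rewrite lie_brC -scaleN1r -[_ *: _]addr0.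
  have [M0 MZ] := lcs_submodule L i.+2.
  by apply: MZ => //; apply: lcs_br1.
by rewrite addnS; apply: lcs_br1; apply: IH.
Qed.
End LieQuotient.

(* The free Lie algebra over R on the set X: terms in the Lie algebra
   operations, modulo the smallest congruence that satisfies the axioms. *)
Section FreeLie.
Variables (R : comNzRingType) (X : Type).

Inductive lie_term :=
| LGen of X
| LZero
| LAdd of lie_term & lie_term
| LScale of R & lie_term
| LBr of lie_term & lie_term.

Inductive lie_eq : lie_term -> lie_term -> Prop :=
| lie_eq_refl s : lie_eq s s
| lie_eq_sym s t : lie_eq s t -> lie_eq t s
| lie_eq_trans s t u : lie_eq s t -> lie_eq t u -> lie_eq s u
| lie_eq_add s s' t t' :
    lie_eq s s' -> lie_eq t t' -> lie_eq (LAdd s t) (LAdd s' t')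
| lie_eq_scale a s s' : lie_eq s s' -> lie_eq (LScale a s) (LScale a s')
| lie_eq_br s s' t t' :
    lie_eq s s' -> lie_eq t t' -> lie_eq (LBr s t) (LBr s' t')
| lie_eq_addA s t u : lie_eq (LAdd s (LAdd t u)) (LAdd (LAdd s t) u)
| lie_eq_addC s t : lie_eq (LAdd s t) (LAdd t s)
| lie_eq_add0 s : lie_eq (LAdd LZero s) s
| lie_eq_addN s : lie_eq (LAdd (LScale (- 1) s) s) LZero
| lie_eq_scaleA a b s : lie_eq (LScale a (LScale b s)) (LScale (a * b) s)
| lie_eq_scale1 s : lie_eq (LScale 1 s) s
| lie_eq_scaleDr a s t :
    lie_eq (LScale a (LAdd s t)) (LAdd (LScale a s) (LScale a t))
| lie_eq_scaleDl a b s :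
    lie_eq (LScale (a + b) s) (LAdd (LScale a s) (LScale b s))
| lie_eq_brDl s t u : lie_eq (LBr (LAdd s t) u) (LAdd (LBr s u) (LBr t u))
| lie_eq_brDr s t u : lie_eq (LBr s (LAdd t u)) (LAdd (LBr s t) (LBr s u))
| lie_eq_brZl a s t : lie_eq (LBr (LScale a s) t) (LScale a (LBr s t))
| lie_eq_brZr a s t : lie_eq (LBr s (LScale a t)) (LScale a (LBr s t))
| lie_eq_brxx s : lie_eq (LBr s s) LZero
| lie_eq_jacobi s t u :
    lie_eq (LAdd (LAdd (LBr s (LBr t u)) (LBr t (LBr u s))) (LBr u (LBr s t)))
           LZero.

HB.instance Definition _ := gen_eqMixin lie_term.
HB.instance Definition _ := gen_choiceMixin lie_term.

Definition lie_eqb s t := `[< lie_eq s t >].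
Fact lie_eqb_equiv : equiv_class_of lie_eqb.
Proof.
split=> [s|s t|t s u].
- exact/asboolP/lie_eq_refl.
- by apply/asboolP/asboolP; apply: lie_eq_sym.
- by move=> /asboolP st /asboolP tu; apply/asboolP; apply: lie_eq_trans st tu.
Qed.
Canonical lie_eqb_equiv_rel := EquivRelPack lie_eqb_equiv.
Canonical lie_eqb_encModRel := defaultEncModRel lie_eqb.

Definition free_lie := {eq_quot lie_eqb}.
HB.instance Definition _ := Choice.on free_lie.
Local Notation cls := (\pi_free_lie).

Lemma free_lieP s t : cls s = cls t <-> lie_eq s t.
Proof. by split=> [/eqmodP/asboolP|st]; last exact/eqmodP/asboolP. Qed.
Let reprP s : lie_eq (repr (cls s)) s.
Proof. by apply/free_lieP; rewrite reprK. Qed.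
Let clsW (P : free_lie -> Prop) : (forall s, P (cls s)) -> forall u, P u.
Proof. by move=> Ps u; rewrite -(reprK u). Qed.

Definition free_add (u v : free_lie) : free_lie := cls (LAdd (repr u) (repr v)).
Definition free_scale a (u : free_lie) : free_lie := cls (LScale a (repr u)).
Definition free_br (u v : free_lie) : free_lie := cls (LBr (repr u) (repr v)).
Definition free_gen (x : X) : free_lie := cls (LGen x).

Lemma free_addE s t : free_add (cls s) (cls t) = cls (LAdd s t).
Proof. by apply/free_lieP/lie_eq_add; apply: reprP. Qed.
Lemma free_scaleE a s : free_scale a (cls s) = cls (LScale a s).
Proof. by apply/free_lieP/lie_eq_scale; apply: reprP. Qed.
Lemma free_brE s t : free_br (cls s) (cls t) = cls (LBr s t).
Proof. by apply/free_lieP/lie_eq_br; apply: reprP. Qed.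

Local Ltac free_law law :=
  move=> *; repeat match goal with u : free_lie |- _ => elim/clsW: u => u end;
  rewrite ?(free_addE, free_scaleE, free_brE); apply/free_lieP; exact: law.

Fact free_addA : associative free_add. Proof. free_law lie_eq_addA. Qed.
Fact free_addC : commutative free_add. Proof. free_law lie_eq_addC. Qed.
Fact free_add0 : left_id (cls LZero) free_add. Proof. free_law lie_eq_add0. Qed.
Fact free_addN : left_inverse (cls LZero) (free_scale (- 1)) free_add.
Proof. free_law lie_eq_addN. Qed.
HB.instance Definition _ :=
  GRing.isZmodule.Build free_lie free_addA free_addC free_add0 free_addN.

Fact free_scaleA a b u : free_scale a (free_scale b u) = free_scale (a * b) u.
Proof. free_law lie_eq_scaleA. Qed.
Fact free_scale1 : left_id 1 free_scale. Proof. free_law lie_eq_scale1. Qed.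
Fact free_scaleDr : right_distributive free_scale free_add.
Proof. free_law lie_eq_scaleDr. Qed.
Fact free_scaleDl u : {morph free_scale^~ u : a b / a + b >-> free_add a b}.
Proof. free_law lie_eq_scaleDl. Qed.
HB.instance Definition _ := GRing.Zmodule_isLmodule.Build R free_lie
  free_scaleA free_scale1 free_scaleDr free_scaleDl.

Fact free_brDl : left_distributive free_br free_add.
Proof. free_law lie_eq_brDl. Qed.
Fact free_brDr : right_distributive free_br free_add.
Proof. free_law lie_eq_brDr. Qed.
Fact free_brZl a u v : free_br (free_scale a u) v = free_scale a (free_br u v).
Proof. free_law lie_eq_brZl. Qed.
Fact free_brZr a u v : free_br u (free_scale a v) = free_scale a (free_br u v).
Proof. free_law lie_eq_brZr. Qed.
Fact free_brxx u : free_br u u = cls LZero. Proof. free_law lie_eq_brxx. Qed.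
Fact free_jacobi u v w :
  free_add (free_add (free_br u (free_br v w)) (free_br v (free_br w u)))
    (free_br w (free_br u v)) = cls LZero.
Proof. free_law lie_eq_jacobi. Qed.
HB.instance Definition _ := isLieAlgebra.Build R free_lie
  free_brDl free_brDr free_brZl free_brZr free_brxx free_jacobi.
End FreeLie.

Definition free_nilpotent_lie_ring (c d : nat) : lieAlgType int :=
  quot_lie (lcs_ideal (free_lie int 'I_d) c.+1).

(* The tensor product M (x)_Z R of an abelian group with a ring: sums of pure
   tensors, modulo the smallest congruence that gives an abelian group in which
   the pure tensors are biadditive. *)
Section Tensor.
Variables (M : zmodType) (R : comNzRingType).

Inductive tens_term :=
| TPure of M & R
| TZero
| TAdd of tens_term & tens_term
| TOpp of tens_term.

Inductive tens_eq : tens_term -> tens_term -> Prop :=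
| tens_eq_refl s : tens_eq s s
| tens_eq_sym s t : tens_eq s t -> tens_eq t s
| tens_eq_trans s t u : tens_eq s t -> tens_eq t u -> tens_eq s u
| tens_eq_add s s' t t' :
    tens_eq s s' -> tens_eq t t' -> tens_eq (TAdd s t) (TAdd s' t')
| tens_eq_opp s s' : tens_eq s s' -> tens_eq (TOpp s) (TOpp s')
| tens_eq_addA s t u : tens_eq (TAdd s (TAdd t u)) (TAdd (TAdd s t) u)
| tens_eq_addC s t : tens_eq (TAdd s t) (TAdd t s)
| tens_eq_add0 s : tens_eq (TAdd TZero s) s
| tens_eq_addN s : tens_eq (TAdd (TOpp s) s) TZero
| tens_eq_pureDl m m' r :
    tens_eq (TPure (m + m') r) (TAdd (TPure m r) (TPure m' r))
| tens_eq_pureDr m r r' :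
    tens_eq (TPure m (r + r')) (TAdd (TPure m r) (TPure m r')).

HB.instance Definition _ := gen_eqMixin tens_term.
HB.instance Definition _ := gen_choiceMixin tens_term.

Definition tens_eqb s t := `[< tens_eq s t >].
Fact tens_eqb_equiv : equiv_class_of tens_eqb.
Proof.
split=> [s|s t|t s u].
- exact/asboolP/tens_eq_refl.
- by apply/asboolP/asboolP; apply: tens_eq_sym.
- by move=> /asboolP st /asboolP tu; apply/asboolP; apply: tens_eq_trans st tu.
Qed.
Canonical tens_eqb_equiv_rel := EquivRelPack tens_eqb_equiv.
Canonical tens_eqb_encModRel := defaultEncModRel tens_eqb.

Definition tensor := {eq_quot tens_eqb}.
HB.instance Definition _ := Choice.on tensor.
Local Notation cls := (\pi_tensor).

Lemma tensorP s t : cls s = cls t <-> tens_eq s t.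
Proof. by split=> [/eqmodP/asboolP|st]; last exact/eqmodP/asboolP. Qed.
Let reprP s : tens_eq (repr (cls s)) s.
Proof. by apply/tensorP; rewrite reprK. Qed.
Let clsW (P : tensor -> Prop) : (forall s, P (cls s)) -> forall u, P u.
Proof. by move=> Ps u; rewrite -(reprK u). Qed.

Definition tens_add (u v : tensor) : tensor := cls (TAdd (repr u) (repr v)).
Definition tens_opp (u : tensor) : tensor := cls (TOpp (repr u)).
Definition pure_tensor (m : M) (r : R) : tensor := cls (TPure m r).

Lemma tens_addE s t : tens_add (cls s) (cls t) = cls (TAdd s t).
Proof. by apply/tensorP/tens_eq_add; apply: reprP. Qed.
Lemma tens_oppE s : tens_opp (cls s) = cls (TOpp s).
Proof. by apply/tensorP/tens_eq_opp; apply: reprP. Qed.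

Local Ltac tens_law law :=
  move=> *; repeat match goal with u : tensor |- _ => elim/clsW: u => u end;
  rewrite ?(tens_addE, tens_oppE); apply/tensorP; exact: law.

Fact tens_addA : associative tens_add. Proof. tens_law tens_eq_addA. Qed.
Fact tens_addC : commutative tens_add. Proof. tens_law tens_eq_addC. Qed.
Fact tens_add0 : left_id (cls TZero) tens_add. Proof. tens_law tens_eq_add0. Qed.
Fact tens_addN : left_inverse (cls TZero) tens_opp tens_add.
Proof. tens_law tens_eq_addN. Qed.
HB.instance Definition _ :=
  GRing.isZmodule.Build tensor tens_addA tens_addC tens_add0 tens_addN.

Lemma pureDl m m' r : pure_tensor (m + m') r = pure_tensor m r + pure_tensor m' r.
Proof. by rewrite [RHS]tens_addE; apply/tensorP/tens_eq_pureDl. Qed.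
Lemma pureDr m r r' : pure_tensor m (r + r') = pure_tensor m r + pure_tensor m r'.
Proof. by rewrite [RHS]tens_addE; apply/tensorP/tens_eq_pureDr. Qed.
Lemma pure0l r : pure_tensor 0 r = 0.
Proof. by apply: (addrI (pure_tensor 0 r)); rewrite -pureDl !addr0. Qed.
Lemma pureNl m r : pure_tensor (- m) r = - pure_tensor m r.
Proof. by apply: (addrI (pure_tensor m r)); rewrite -pureDl !subrr pure0l. Qed.

Lemma tensor_ind (P : tensor -> Prop) :
  (forall m r, P (pure_tensor m r)) -> (forall u v, P u -> P v -> P (u + v)) ->
  forall u, P u.
Proof.
move=> Pp PD.
suff H s : P (cls s) /\ P (- (cls s : tensor)) by move=> u; rewrite -(reprK u); case: (H (repr u)).
elim: s => [m r||s [Ps PNs] t [Pt PNt]|s [Ps PNs]].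
- by split; rewrite -?pureNl; apply: Pp.
- have -> : cls TZero = 0 :> tensor by [].
  by rewrite oppr0 -(pure0l 0).
- rewrite -tens_addE; split; first exact: PD.
  by rewrite [- _]opprD; apply: PD.
- by rewrite -tens_oppE [- _]opprK.
Qed.

(* The map on the tensor product that a biadditive map f induces. *)
Section Lift.
Variables (V : zmodType) (f : M -> R -> V).

Fixpoint tens_eval (s : tens_term) : V :=
  match s with
  | TPure m r => f m r
  | TZero => 0
  | TAdd s t => tens_eval s + tens_eval t
  | TOpp s => - tens_eval s
  end.
Definition tens_lift (u : tensor) : V := tens_eval (repr u).

Hypothesis fDl : forall m m' r, f (m + m') r = f m r + f m' r.
Hypothesis fDr : forall m r r', f m (r + r') = f m r + f m r'.

Let tens_eval_eq s t : tens_eq s t -> tens_eval s = tens_eval t.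
Proof.
elim=> //=; do ?by [move=> *; congruence].
- by move=> *; rewrite addrA.
- by move=> *; rewrite addrC.
- by move=> *; rewrite add0r.
- by move=> *; rewrite addNr.
Qed.
Let tens_evalE s : tens_lift (cls s) = tens_eval s.
Proof. exact: tens_eval_eq. Qed.
Lemma tens_lift_pure m r : tens_lift (pure_tensor m r) = f m r.
Proof. exact: tens_evalE. Qed.
Lemma tens_liftD : {morph tens_lift : u v / u + v}.
Proof. by elim/clsW=> s; elim/clsW=> t; rewrite [_ + _]tens_addE !tens_evalE. Qed.
End Lift.

Definition tens_scale (a : R) : tensor -> tensor :=
  tens_lift (fun m r => pure_tensor m (a * r)).
Lemma tens_scale_pure a m r : tens_scale a (pure_tensor m r) = pure_tensor m (a * r).
Proof.
by apply: tens_lift_pure => *; rewrite ?pureDl ?mulrDr ?pureDr.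
Qed.
Fact tens_scaleDr : right_distributive tens_scale +%R.
Proof.
by move=> a; apply: tens_liftD => *; rewrite ?pureDl ?mulrDr ?pureDr.
Qed.
Fact tens_scaleA a b u : tens_scale a (tens_scale b u) = tens_scale (a * b) u.
Proof.
elim/tensor_ind: u => [m r|u v IHu IHv]; first by rewrite !tens_scale_pure mulrA.
by rewrite !tens_scaleDr IHu IHv.
Qed.
Fact tens_scale1 : left_id 1 tens_scale.
Proof.
elim/tensor_ind=> [m r|u v IHu IHv]; first by rewrite !tens_scale_pure mul1r.
by rewrite !tens_scaleDr IHu IHv.
Qed.
Fact tens_scaleDl u : {morph tens_scale^~ u : a b / a + b}.
Proof.
move=> a b; elim/tensor_ind: u => [m r|u v IHu IHv].
  by rewrite !tens_scale_pure mulrDl pureDr.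
by rewrite !tens_scaleDr IHu IHv addrACA.
Qed.
HB.instance Definition _ := GRing.Zmodule_isLmodule.Build R tensor
  tens_scaleA tens_scale1 tens_scaleDr tens_scaleDl.
Lemma scale_pure a m r : a *: pure_tensor m r = pure_tensor m (a * r).
Proof. exact: tens_scale_pure. Qed.
End Tensor.

(* The bracket on L (x)_Z R is given by [m (x) r, m' (x) r'] = [m, m'] (x) r r'. *)
Section BaseChange.
Variables (L : lieAlgType int) (R : comNzRingType).
Local Notation T := (tensor L R).

Definition base_change := T.
HB.instance Definition _ := GRing.Lmodule.on base_change.

Definition pure_br (m : L) (r : R) : T -> T :=
  tens_lift (fun m' r' => pure_tensor (lie_br m m') (r * r')).
Definition tens_br (u : T) : T -> T := tens_lift pure_br u.

Let pure_br_pure m r m' r' :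
  pure_br m r (pure_tensor m' r') = pure_tensor (lie_br m m') (r * r').
Proof. by apply: tens_lift_pure => *; rewrite ?lie_brDr ?pureDl ?mulrDr ?pureDr. Qed.
Let pure_brDr m r : {morph pure_br m r : u v / u + v}.
Proof. by apply: tens_liftD => *; rewrite ?lie_brDr ?pureDl ?mulrDr ?pureDr. Qed.
Let pure_brDl m m' r : pure_br (m + m') r = pure_br m r + pure_br m' r.
Proof.
apply/funext => u /=; elim/tensor_ind: u => [n s|u v IHu IHv].
  by rewrite [RHS]/GRing.add /= !pure_br_pure lie_brDl pureDl.
by rewrite pure_brDr IHu IHv /GRing.add /= !pure_brDr addrACA.
Qed.
Let pure_brDm m r r' : pure_br m (r + r') = pure_br m r + pure_br m r'.
Proof.
apply/funext => u /=; elim/tensor_ind: u => [n s|u v IHu IHv].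
  by rewrite [RHS]/GRing.add /= !pure_br_pure mulrDl pureDr.
by rewrite pure_brDr IHu IHv /GRing.add /= !pure_brDr addrACA.
Qed.
Let tens_br_purel m r u : tens_br (pure_tensor m r) u = pure_br m r u.
Proof. by rewrite /tens_br tens_lift_pure. Qed.

Lemma tens_br_pure m r m' r' :
  tens_br (pure_tensor m r) (pure_tensor m' r') = pure_tensor (lie_br m m') (r * r').
Proof. by rewrite tens_br_purel pure_br_pure. Qed.
Fact tens_brDl : left_distributive tens_br +%R.
Proof. by move=> u v w; rewrite /tens_br tens_liftD. Qed.
Fact tens_brDr : right_distributive tens_br +%R.
Proof.
elim/tensor_ind=> [m r|u v IHu IHv] w t; first by rewrite !tens_br_purel pure_brDr.
by rewrite !tens_brDl IHu IHv addrACA.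
Qed.
Fact tens_brZl a (u v : T) : tens_br (a *: u) v = a *: tens_br u v.
Proof.
elim/tensor_ind: u => [m r|u w IHu IHw]; last first.
  by rewrite scalerDr !tens_brDl IHu IHw scalerDr.
elim/tensor_ind: v => [n s|v w IHv IHw]; last first.
  by rewrite !tens_brDr IHv IHw scalerDr.
by rewrite scale_pure !tens_br_pure scale_pure mulrA.
Qed.
Fact tens_brZr a (u v : T) : tens_br u (a *: v) = a *: tens_br u v.
Proof.
elim/tensor_ind: u => [m r|u w IHu IHw]; last first.
  by rewrite !tens_brDl IHu IHw scalerDr.
elim/tensor_ind: v => [n s|v w IHv IHw]; last first.
  by rewrite scalerDr !tens_brDr IHv IHw scalerDr.
by rewrite scale_pure !tens_br_pure scale_pure mulrCA.
Qed.
Let tens_brC u v : tens_br u v + tens_br v u = 0.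
Proof.
elim/tensor_ind: u => [m r|u w IHu IHw]; last first.
  by rewrite tens_brDl tens_brDr addrACA IHu IHw addr0.
elim/tensor_ind: v => [n s|v w IHv IHw]; last first.
  by rewrite tens_brDl tens_brDr addrACA IHv IHw addr0.
by rewrite !tens_br_pure mulrC -pureDl (lie_brC m) addNr pure0l.
Qed.
Fact tens_brxx u : tens_br u u = 0.
Proof.
elim/tensor_ind: u => [m r|u v IHu IHv]; first by rewrite tens_br_pure lie_brxx pure0l.
by rewrite tens_brDl !tens_brDr IHu IHv add0r addr0 tens_brC.
Qed.
Fact tens_jacobi u v w :
  tens_br u (tens_br v w) + tens_br v (tens_br w u) + tens_br w (tens_br u v) = 0.
Proof.
have ADD (a b c a' b' c' : T) :
    (a + a') + (b + b') + (c + c') = (a + b + c) + (a' + b' + c').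
  by rewrite (addrACA a) (addrACA (a + b)).
elim/tensor_ind: u => [m r|u u' IHu IHu']; last first.
  by rewrite !(tens_brDl, tens_brDr) ADD IHu IHu' addr0.
elim/tensor_ind: v => [n s|v v' IHv IHv']; last first.
  by rewrite !(tens_brDl, tens_brDr) ADD IHv IHv' addr0.
elim/tensor_ind: w => [k t|w w' IHw IHw']; last first.
  by rewrite !(tens_brDl, tens_brDr) ADD IHw IHw' addr0.
rewrite !tens_br_pure (_ : s * (t * r) = r * (s * t)); last by ring.
by rewrite (_ : t * (r * s) = r * (s * t)) -?pureDl ?lie_jacobi ?pure0l //; ring.
Qed.
HB.instance Definition _ := isLieAlgebra.Build R base_change
  tens_brDl tens_brDr tens_brZl tens_brZr tens_brxx tens_jacobi.
End BaseChange.

Section AssociatedGraded.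
Variables (R : comNzRingType) (L : lieAlgType R).

Definition lcs_next i : set (submod_type (lcs_submodule L i)) :=
  [set u | lcs L i.+1 (submod_val u)].
Lemma lcs_next_submodule i : is_submodule (@lcs_next i).
Proof.
have [N0 NZ] := lcs_submodule L i.+1; rewrite /lcs_next /mkset.
by split=> [|a x y Nx Ny]; rewrite ?submod_val0 ?submod_valD ?submod_valZ //; exact: NZ.
Qed.

(* L^(i) = gamma_i / gamma_(i + 1). *)
Definition lcs_factor i := quot_mod (lcs_next_submodule i).
HB.instance Definition _ i := GRing.Lmodule.on (lcs_factor i).

(* The class in L^(i) of an element of gamma_i, and a representative in gamma_i
   of an element of L^(i). *)
Definition factor_class i (x : L) : lcs_factor i :=
  quot_proj (lcs_next_submodule i) (submod_elt (lcs_submodule L i) x).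
Definition factor_repr i (u : lcs_factor i) : L := submod_val (quot_repr u).

Lemma factor_repr_in i (u : lcs_factor i) : lcs L i (factor_repr u).
Proof. exact: submod_valP. Qed.
Lemma factor_reprK i (u : lcs_factor i) : factor_class i (factor_repr u) = u.
Proof. by rewrite /factor_class /factor_repr submod_valK quot_reprK. Qed.

Let lcsD n x y : lcs L n x -> lcs L n y -> lcs L n (x + y).
Proof. by case: (lcs_submodule L n) => _ NZ xn; rewrite -[x]scale1r; apply: NZ. Qed.
Let lcsZ n a x : lcs L n x -> lcs L n (a *: x).
Proof.
by case: (lcs_submodule L n) => N0 NZ xn; rewrite -[_ *: _]addr0; apply: NZ.
Qed.

Lemma factor_classP i x y : lcs L i x -> lcs L i y ->
  factor_class i x = factor_class i y <-> lcs L i.+1 (x - y).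
Proof.
move=> xi yi; rewrite quot_projP /lcs_next /mkset.
by rewrite submod_valB !submod_eltK.
Qed.
Lemma factor_classD i x y : lcs L i x -> lcs L i y ->
  factor_class i (x + y) = factor_class i x + factor_class i y.
Proof.
move=> xi yi; rewrite [RHS]/GRing.add /= -[RHS]quot_projD; congr quot_proj.
by apply: submod_val_inj; rewrite submod_valD !submod_eltK //; apply: lcsD.
Qed.
Lemma factor_classZ i a x : lcs L i x ->
  factor_class i (a *: x) = a *: factor_class i x.
Proof.
move=> xi; rewrite -[RHS]quot_projZ; congr quot_proj.
by apply: submod_val_inj; rewrite submod_valZ !submod_eltK //; apply: lcsZ.
Qed.

(* The bracket L^(i) x L^(j) -> L^(k), which is meant for k = i + j. *)
Definition factor_br k i j (u : lcs_factor i) (v : lcs_factor j) : lcs_factor k :=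
  factor_class k (lie_br (factor_repr u) (factor_repr v)).

Section FactorBr.
Variables i j : nat.
Local Notation k := (i + j).+2.
Implicit Types (u : lcs_factor i.+1) (v : lcs_factor j.+1).

Lemma factor_brE x y : lcs L i.+1 x -> lcs L j.+1 y ->
  factor_br k (factor_class i.+1 x) (factor_class j.+1 y) =
  factor_class k (lie_br x y).
Proof.
move=> xi yj; set u := factor_class _ x; set v := factor_class _ y.
have [ui vj] := (factor_repr_in u, factor_repr_in v).
apply/factor_classP; do ?exact: lcs_br.
have -> : lie_br (factor_repr u) (factor_repr v) - lie_br x y =
   1 *: lie_br (factor_repr u - x) (factor_repr v) + lie_br x (factor_repr v - y).
  by rewrite scale1r lie_brDl lie_brDr lie_brNl lie_brNr addrA subrK.
have [N0 NZ] := lcs_submodule L k.+1; apply: NZ.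
  rewrite -addSn; apply: lcs_br => //; apply/factor_classP => //.
  by rewrite factor_reprK.
rewrite -addnS; apply: lcs_br => //; apply/factor_classP => //.
by rewrite factor_reprK.
Qed.

Let classW n (P : lcs_factor n -> Prop) :
  (forall x, lcs L n x -> P (factor_class n x)) ->
  forall w : lcs_factor n, P w.
Proof. by move=> Px w; rewrite -(factor_reprK w); apply/Px/factor_repr_in. Qed.
Lemma factor_brDl u u' v : factor_br k (u + u') v = factor_br k u v + factor_br k u' v.
Proof.
elim/classW: u => x xi; elim/classW: u' => x' xi'; elim/classW: v => y yj.
by rewrite -factor_classD // !factor_brE ?lie_brDl ?factor_classD //;
  do ?[exact: lcs_br|exact: lcsD].
Qed.
Lemma factor_brDr u v v' : factor_br k u (v + v') = factor_br k u v + factor_br k u v'.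
Proof.
elim/classW: u => x xi; elim/classW: v' => x' xi'; elim/classW: v => y yj.
by rewrite -factor_classD // !factor_brE ?lie_brDr ?factor_classD //;
  do ?[exact: lcs_br|exact: lcsD].
Qed.
Lemma factor_brZl a u v : factor_br k (a *: u) v = a *: factor_br k u v.
Proof.
elim/classW: u => x xi; elim/classW: v => y yj.
by rewrite -factor_classZ // !factor_brE ?lie_brZl ?factor_classZ //;
  do ?[exact: lcs_br|exact: lcsZ].
Qed.
Lemma factor_brZr a u v : factor_br k u (a *: v) = a *: factor_br k u v.
Proof.
elim/classW: u => x xi; elim/classW: v => y yj.
by rewrite -factor_classZ // !factor_brE ?lie_brZr ?factor_classZ //;
  do ?[exact: lcs_br|exact: lcsZ].
Qed.
End FactorBr.

Lemma factor_class0 i : factor_class i 0 = 0.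
Proof.
have [N0 _] := lcs_submodule L i.
by have := factor_classZ 0 N0; rewrite !scale0r.
Qed.
Lemma factor_brC k i j (u : lcs_factor i.+1) (v : lcs_factor j.+1) :
  (i + j).+1 = k -> factor_br k.+1 u v = - factor_br k.+1 v u.
Proof.
move=> <-; rewrite /factor_br lie_brC -scaleN1r factor_classZ ?scaleN1r //.
by rewrite addnC; apply: lcs_br; apply: factor_repr_in.
Qed.

Lemma factor_br_class k i j (u : lcs_factor i.+1) y :
  (i + j).+1 = k -> lcs L j.+1 y ->
  factor_br k.+1 u (factor_class j.+1 y) =
  factor_class k.+1 (lie_br (factor_repr u) y).
Proof.
move=> <- yj; rewrite -{1}(factor_reprK u) factor_brE //.
exact: factor_repr_in.
Qed.

(* gr L, the direct sum of L^(1), ..., L^(c), for an algebra L of nilpotency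
   class at most c; the summand of index i : 'I_c is L^(i + 1). *)
Section Class.
Variable c : nat.

Definition gr := dsum (fun i : 'I_c => lcs_factor i.+1).
HB.instance Definition _ := GRing.Lmodule.on gr.

Definition gr_br (x y : gr) : gr := fun k =>
  \sum_(i < c) \sum_(j < c | (i.+1 + j.+1 == k.+1)%N) factor_br k.+1 (x i) (y j).

Let gr_ext (x y : gr) : (forall i, x i = y i) -> x = y.
Proof. exact: functional_extensionality_dep. Qed.
Let degE (i j k : nat) : (i.+1 + j.+1 == k.+1)%N -> k = (i + j).+1.
Proof. by rewrite addSn addnS => /eqP[]. Qed.

Fact gr_brDl : left_distributive gr_br +%R.
Proof.
move=> x y z; apply: gr_ext => k; rewrite dsumDE /gr_br -big_split.
apply: eq_bigr => i _; rewrite -big_split; apply: eq_bigr => j /degE ->.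
exact: factor_brDl.
Qed.
Fact gr_brDr : right_distributive gr_br +%R.
Proof.
move=> x y z; apply: gr_ext => k; rewrite dsumDE /gr_br -big_split.
apply: eq_bigr => i _; rewrite -big_split; apply: eq_bigr => j /degE ->.
exact: factor_brDr.
Qed.
Fact gr_brZl a x y : gr_br (a *: x) y = a *: gr_br x y.
Proof.
apply: gr_ext => k; rewrite dsumZE /gr_br scaler_sumr.
apply: eq_bigr => i _; rewrite scaler_sumr; apply: eq_bigr => j /degE ->.
exact: factor_brZl.
Qed.
Fact gr_brZr a x y : gr_br x (a *: y) = a *: gr_br x y.
Proof.
apply: gr_ext => k; rewrite dsumZE /gr_br scaler_sumr.
apply: eq_bigr => i _; rewrite scaler_sumr; apply: eq_bigr => j /degE ->.
exact: factor_brZr.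
Qed.

Let alt_sum (V : zmodType) (f : 'I_c -> 'I_c -> V) :
  (forall i, f i i = 0) -> (forall i j, f i j = - f j i) ->
  \sum_i \sum_j f i j = 0.
Proof.
move=> f0 fN; pose g (i j : 'I_c) : V := if (i < j)%N then f i j else 0.
have fg (i j : 'I_c) : f i j = g i j - g j i.
  rewrite /g; case: ltngtP => [_|_|/val_inj->]; rewrite ?subr0 ?sub0r -?fN //.
rewrite (eq_bigr (fun i => \sum_j g i j - \sum_j g j i)); last first.
  by move=> i _; rewrite -sumrB; apply: eq_bigr.
by rewrite sumrB [X in _ - X]exchange_big subrr.
Qed.

Fact gr_brxx x : gr_br x x = 0.
Proof.
apply: gr_ext => k; rewrite dsum0E /gr_br.
under eq_bigr do rewrite big_mkcond.
apply: alt_sum => [i|i j].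
  by rewrite /factor_br lie_brxx factor_class0 if_same.
rewrite (addnC j.+1); case: eqP => [ijk|]; last by rewrite oppr0.
by apply: factor_brC; move/eqP/degE: ijk => ->.
Qed.

Let class3 (x y z : gr) (k i a b : 'I_c) : lcs_factor k.+1 :=
  if ((i + a + b).+2 == k)%N then
    factor_class k.+1 (lie_br (factor_repr (x i))
                         (lie_br (factor_repr (y a)) (factor_repr (z b))))
  else 0.

Let factor_br_sumr (k i j : nat) (J : finType) (P : pred J)
    (u : lcs_factor i.+1) (f : J -> lcs_factor j.+1) : (i.+1 + j.+1 == k.+1)%N ->
  factor_br k.+1 u (\sum_(a | P a) f a) = \sum_(a | P a) factor_br k.+1 u (f a).
Proof.
move/degE->; apply: (big_morph (factor_br _ u)) => [v w|]; first exact: factor_brDr.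
by have := factor_brZr 0 u (0 : lcs_factor j.+1); rewrite !scale0r.
Qed.

Let gr_br3 x y z k :
  gr_br x (gr_br y z) k = \sum_(i < c) \sum_(a < c) \sum_(b < c) class3 x y z k i a b.
Proof.
rewrite {1}/gr_br; apply: eq_bigr => i _.
transitivity (\sum_(j < c | (i.+1 + j.+1 == k.+1)%N) \sum_(a < c)
   \sum_(b < c | (a.+1 + b.+1 == j.+1)%N) class3 x y z k i a b).
  apply: eq_bigr => j ij; rewrite factor_br_sumr //; apply: eq_bigr => a _.
  rewrite factor_br_sumr //; apply: eq_bigr => b /degE jE.
  have kE := degE ij.
  have -> : class3 x y z k i a b = factor_class k.+1 (lie_br (factor_repr (x i))
      (lie_br (factor_repr (y a)) (factor_repr (z b)))).
    by rewrite /class3 ifT //; apply/eqP; lia.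
  apply: factor_br_class => //.
  by rewrite jE; apply: lcs_br; apply: factor_repr_in.
rewrite exchange_big; apply: eq_bigr => a _.
rewrite (exchange_big_dep predT) //=; apply: eq_bigr => b _.
rewrite /class3; case: ifP => [/eqP kE|_]; last by rewrite big1.
have jc : ((a + b).+1 < c)%N by apply: leq_trans (ltn_ord k); lia.
rewrite (big_pred1 (Ordinal jc)) // => j; rewrite /= -val_eqE /=; lia.
Qed.

Fact gr_jacobi x y z :
  gr_br x (gr_br y z) + gr_br y (gr_br z x) + gr_br z (gr_br x y) = 0.
Proof.
apply: gr_ext => k; rewrite !dsumDE !gr_br3 dsum0E.
have -> : \sum_(i < c) \sum_(a < c) \sum_(b < c) class3 y z x k i a b =
          \sum_(i < c) \sum_(a < c) \sum_(b < c) class3 y z x k a b i.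
  by rewrite [RHS]exchange_big; apply: eq_bigr => i _; rewrite exchange_big.
have -> : \sum_(i < c) \sum_(a < c) \sum_(b < c) class3 z x y k i a b =
          \sum_(i < c) \sum_(a < c) \sum_(b < c) class3 z x y k b i a.
  by rewrite exchange_big; apply: eq_bigr => i _; rewrite exchange_big.
rewrite -!big_split big1 // => i _; rewrite -!big_split big1 // => a _.
rewrite -!big_split big1 // => b _; rewrite /= /class3.
rewrite (_ : (a + b + i = i + a + b)%N); last by lia.
rewrite (_ : (b + i + a = i + a + b)%N); last by lia.
case: eqP => [kE|_]; last by rewrite !addr0.
have B3 (p q r : nat) (u v w : L) : (p + q + r).+2 = k ->
    lcs L p.+1 u -> lcs L q.+1 v -> lcs L r.+1 w ->
    lcs L k.+1 (lie_br u (lie_br v w)).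
  move=> <- up vq wr; rewrite -addnA -addnS; apply: lcs_br => //.
  exact: lcs_br.
have [xi ya zb] := And3 (factor_repr_in (x i)) (factor_repr_in (y a))
  (factor_repr_in (z b)).
have kE2 : (a + b + i).+2 = k by lia.
have kE3 : (b + i + a).+2 = k by lia.
have [b1 b2 b3] := And3 (B3 _ _ _ _ _ _ kE xi ya zb)
  (B3 a b i _ _ _ kE2 ya zb xi)
  (B3 b i a _ _ _ kE3 zb xi ya).
by rewrite -!factor_classD ?lie_jacobi ?factor_class0 //; apply: lcsD.
Qed.
HB.instance Definition _ := isLieAlgebra.Build R gr
  gr_brDl gr_brDr gr_brZl gr_brZr gr_brxx gr_jacobi.

Definition gr_component (i : 'I_c) : set gr :=
  [set x | forall j, j != i -> x j = 0].

(* I is the sum of the I `&` L^(i); the sum is always direct. *)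
Definition is_graded (I : set gr) :=
  I = [set \sum_i y i | y in
        [set y : 'I_c -> gr | forall i, (I `&` gr_component i) (y i)]].

Definition graded_ideal := {I : set gr |
  `[< [/\ is_lie_ideal I, is_graded I & finite_index I] >]}.
End Class.
End AssociatedGraded.
Arguments gr {R} L c.
Arguments graded_ideal {R} L c.

Section Zeta.
Variable R : realType.

Definition cexp (z : R[i]) : R[i] :=
  (expR (complex.Re z))%:C%C * (cos (complex.Im z) +i* sin (complex.Im z))%C.
(* n ^ s for n >= 1. *)
Definition cpow (n : nat) (s : R[i]) : R[i] := cexp (s * (ln (n%:R : R))%:C%C).

Variables (A : comNzRingType) (L : lieAlgType A) (c : nat).

Definition gr_zeta_term (s : R[i]) (I : graded_ideal L c) : R[i]^o :=
  cpow (submod_index (val I)) (- s).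
(* The sum over the graded ideals is unconditional: it is the limit of the
   partial sums along the directed set of all the finite sets of ideals. *)
Definition gr_zeta_converges (s : R[i]) : Prop :=
  cvg (summability.partial_sum (gr_zeta_term s) @ summability.totally).
Definition gr_zeta (s : R[i]) : R[i] := summability.sum (gr_zeta_term s).
End Zeta.
Arguments cpow {R} n s.
Arguments gr_zeta_converges {R A} L c s.
Arguments gr_zeta {R A} L c s.

Definition maximal_ideal (A : comNzRingType) (m : set A) :=
  [/\ is_submodule (m : set A^o), m != setT &
    forall J : set A, is_submodule (J : set A^o) -> m `<=` J ->
      J = m \/ J = setT].

Definition residue_card (A : comNzRingType) (q : nat) :=
  exists m : set A, [/\ maximal_ideal m, finite_index (m : set A^o) &
    submod_index (m : set A^o) = q].

(* Q(X, Y); in {poly {poly rat}} the outer variable is X and the inner one Y. *)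
Definition ratfun2 := {fraction {poly {poly rat}}}.

Definition eval2 (F : fieldType) (P : {poly {poly rat}}) (x y : F) : F :=
  (map_poly (map_poly ratr) P).[x, y].

(* W is defined at (x, y), and W(x, y) = v. *)
Definition ratfun_value (F : fieldType) (W : ratfun2) (x y v : F) :=
  exists N D : {poly {poly rat}},
    [/\ W = tofrac N / tofrac D, eval2 D x y != 0 &
        v = eval2 N x y / eval2 D x y].

Definition N_red : {poly int} := Poly [::
  1; 0; 0; 2; 4; 5; 16; 34; 53; 77; 98; 121; 182; 302; 483; 712; 953; 1187;
  1425; 1689; 2046; 2579; 3298; 4162; 5059; 5826; 6398; 6894; 7475; 8270; 9265;
  10260; 11041; 11529; 11745; 11798; 11811; 11811; 11798; 11745; 11529; 11041;
  10260; 9265; 8270; 7475; 6894; 6398; 5826; 5059; 4162; 3298; 2579; 2046; 1689;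
  1425; 1187; 953; 712; 483; 302; 182; 121; 98; 77; 53; 34; 16; 5; 4; 2; 0; 0; 1].

(* Main.v *)
From HB Require Import structures.
From Stdlib Require BinInt.
Require Import Defs.
From mathcomp Require Import all_boot all_order all_algebra all_field.
From mathcomp Require Import all_fingroup all_solvable.
From mathcomp Require Import zify ring lra ssrZ.

Set Implicit Arguments.
Unset Strict Implicit.
Unset Printing Implicit Defensive.
Import Order.TTheory GRing.Theory Num.Theory.
Local Open Scope ring_scope.

(** Write [gr L] for the graded Lie ring of [f_(3,3)(Z_p)], let [a_n(p)] be the number of
    its graded ideals of index [p^n], and write [W = N / D] with [N], [D] in [Z[X, Y]] that
    do not both vanish at [X = 1].  The hypothesis on [W] gives
    [D(p, Y) * \sum_n a_n(p) Y^n = N(p, Y)] for all small positive reals [Y], hence as an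
    identity of power series ([gr_zeta_coef]).

    The specialization [X = 1] is reached [l]-adically.  If a prime [l] divides [p - 1], then
    [N(p, Y)], [D(p, Y)] agree with [N(1, Y)], [D(1, Y)] modulo [l].  Suppose that [a_n(p)] is
    congruent modulo [l] to a number [f_n] that depends neither on [p] nor on [l], for
    infinitely many [l], with a suitable [p] for each of them.  Then
    [D(1, Y) * \sum_n f_n Y^n = N(1, Y)] holds modulo infinitely many primes, hence over [Z]
    ([congruence_limit]); so [D(1, Y)] is not zero and [W(1, Y) = \sum_n f_n Y^n].

    The congruence [a_n(p) = f_n mod l] is a fixed point count.  In degrees 1, 2, 3 the ring
    [gr L] is [V = R^3], [V] again (the exterior square of [V], with the cross product as
    bracket), and the 3 x 3 matrices modulo the scalar ones (with [[w, y] = w y^T]), for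
    [R = Z_p] ([free_nilpotent_frame]).  Graded ideals of index [p^n] are therefore triples of
    subgroups [(A1, A2, A3)] of the corresponding modules over [Z/p^m], for any [m >= n], with
    [A1 x V] in [A2], [A2 V^T] in [A3] and the identity matrix in [A3]
    ([count_graded_ideals]).  Let [l] be a prime, [l >= 9], and [p] a prime divisor of
    [2^l - 1], so that [l] divides [p - 1].  Then [Z/p^m] contains [u] with [u^l = 1] such that
    the [u^k - 1], [0 < k < l], are units ([torus_generator]), and the matrix
    [diag(1, u, u^-1)], of determinant 1, acts on the set of triples with orbits of size 1
    or [l].  As its eigenvalues on [V] are separated by units, a fixed [A1] or [A2] is a sum of
    coordinate lines [p^(e_i) R].  Over such a pair, the subgroups [A3] are, after a shear that
    moves the identity matrix to a coordinate vector, all the subgroups of [(Z/p^m)^9] that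
    contain a given sum of coordinate lines; a second torus with nine distinct weights reduces
    them modulo [l] to the sums of coordinate lines.  So [a_n(p)] is congruent to the number
    [f_n] of triples of exponent vectors ([count_ideal_triples], [exp_triple]).

    Finally [\sum_n f_n Y^n] is a sum over the exponents [v] in [N^3] of [A2]: the exponents of
    [A1] and [A3] contribute geometric series and truncated geometric series.  The summand is
    symmetric in [v], so the sum runs over the six chambers of [S_3], on each of which it is a
    combination of geometric series over a cone ([exp_poly_geom]).  Clearing denominators
    leaves a polynomial identity that is checked by computation ([red_cone_identity]). *)

(** * Fixed points modulo a prime *)

Lemma card_fixed_mod (T : finType) (l : nat) (f : T -> T) (P : {set T}) :
  prime l -> iter l f =1 id -> (forall x, x \in P -> f x \in P) ->
  #|P| = #|[set x in P | f x == x]| %[mod l].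
Proof.
move=> l_pr fl fP.
have f_inj : injective f.
  move=> x y fxy; rewrite -(fl x) -(fl y).
  by case: l l_pr {fl} => // n _; rewrite !iterSr fxy.
pose s := perm f_inj.
have sX n x : (s ^+ n)%g x = iter n f x by rewrite permX; apply: eq_iter => y; rewrite permE.
have sl : (s ^+ l)%g = 1%g by apply/permP => x; rewrite sX fl perm1.
have lG : (l.-group <[s]>)%g.
  rewrite /pgroup -orderE; have /(dvdn_pfactor _ 1 l_pr)[k _ ->]: (#[s]%g %| l ^ 1)%N.
    by rewrite expn1 order_dvdn sl.
  by rewrite pnatX pnat_id.
have aG : [acts <[s]>%g, on P | 'P].
  apply/subsetP => g /cycleP[n ->]; rewrite !inE; apply/subsetP => x xP.
  by rewrite inE /= apermE sX; elim: n => //= n; apply: fP.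
rewrite (pgroup_fix_mod lG aG); congr (_ %% l)%N; apply: eq_card => x.
rewrite afix_cycle !inE sub1set inE /= apermE permE.
by [].
Qed.

(** * Subgroups of (Z/p^m)^T and diagonal actions *)

HB.instance Definition _ (I : finType) (V : finZmodType) :=
  GRing.Zmodule.on {ffun I -> V}.

Section Cyclic.
Variables (p m : nat).
Hypotheses (p_pr : prime p) (m_gt0 : (0 < m)%N).
Local Notation q := (p ^ m)%N.
Local Notation Zq := 'Z_(p ^ m).

Let q_gt1 : (1 < q)%N.
Proof. by rewrite -(exp1n m) ltn_exp2r // prime_gt1. Qed.

Lemma Zp_nat_valK (c : Zq) : c = (c : nat)%:R.
Proof. by rewrite natr_Zp. Qed.

Lemma dvdn_pow_natZ e a : (e <= m)%N -> (p ^ e %| ((a%:R : Zq) : nat))%N = (p ^ e %| a)%N.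
Proof. by move=> em; rewrite val_Zp_nat // /dvdn modn_dvdm // dvdn_exp2l. Qed.

Lemma unit_natZ a : (a%:R : Zq) \is a GRing.unit = ~~ (p %| a)%N.
Proof.
rewrite unitZpE // coprime_pexpl // coprime_sym coprime_sym prime_coprime //.
Qed.

Definition additive_set (V : finZmodType) (A : {set V}) : bool :=
  (0 \in A) && [forall x in A, forall y in A, x - y \in A].

Lemma additive_setP (V : finZmodType) (A : {set V}) :
  reflect (0 \in A /\ forall x y, x \in A -> y \in A -> x - y \in A) (additive_set A).
Proof.
apply: (iffP andP) => -[A0 AB]; split=> //.
  by move=> x y xA yA; have /forall_inP/(_ x xA)/forall_inP/(_ y yA) := AB.
by apply/forall_inP => x xA; apply/forall_inP => y yA; apply: AB.
Qed.

Lemma additive_setN (V : finZmodType) (A : {set V}) x : additive_set A -> x \in A -> - x \in A.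
Proof. by move=> /additive_setP[A0 AB] xA; rewrite -sub0r; apply: AB. Qed.
Lemma additive_setD (V : finZmodType) (A : {set V}) x y :
  additive_set A -> x \in A -> y \in A -> x + y \in A.
Proof.
move=> As xA yA; rewrite -[y]opprK; case/additive_setP: (As) => _; apply=> //.
exact: additive_setN.
Qed.
Lemma additive_setMn (V : finZmodType) (A : {set V}) x n : additive_set A -> x \in A -> x *+ n \in A.
Proof.
move=> As xA; elim: n => [|n IH]; first by case/additive_setP: As.
by rewrite mulrS; apply: additive_setD.
Qed.
Lemma additive_set_sum (V : finZmodType) (A : {set V}) (I : finType) (P : pred I) (F : I -> V) :
  additive_set A -> (forall i, P i -> F i \in A) -> \sum_(i | P i) F i \in A.
Proof.
move=> As FA; apply: (big_ind (fun x => x \in A)) => //.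
  by case/additive_setP: As.
by move=> *; apply: additive_setD.
Qed.

(** The ideal [p^e Z/p^m], for [e <= m]. *)
Definition pmult e : {set Zq} := [set c : Zq | (p ^ e %| (c : nat))%N].

Lemma pmultP e (c : Zq) : (e <= m)%N ->
  reflect (exists d : Zq, c = (p ^ e)%:R * d) (c \in pmult e).
Proof.
move=> em; rewrite inE; apply: (iffP idP) => [/dvdnP[k ck]|[d ->]].
  by exists k%:R; rewrite [LHS]Zp_nat_valK ck mulnC natrM.
by rewrite (Zp_nat_valK d) -natrM dvdn_pow_natZ // dvdn_mulr.
Qed.

Lemma additive_pmult e : (e <= m)%N -> additive_set (pmult e).
Proof.
move=> em; apply/additive_setP; split; first by rewrite inE dvdn0.
move=> x y /pmultP-/(_ em)[c ->] /pmultP-/(_ em)[d ->].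
by apply/pmultP => //; exists (c - d); rewrite mulrBr.
Qed.

Lemma card_pmult e : (e <= m)%N -> #|pmult e| = (p ^ (m - e))%N.
Proof.
move=> em; pose k := (p ^ (m - e))%N.
have qE : q = (p ^ e * k)%N by rewrite -expnD subnKC.
pose f (i : 'I_k) : Zq := (p ^ e * i)%:R.
have fE i : (f i : nat) = (p ^ e * i)%N.
  by rewrite val_Zp_nat // modn_small // qE ltn_pmul2l ?expn_gt0 ?prime_gt0.
have f_inj : injective f.
  move=> i j /(congr1 (@nat_of_ord _)); rewrite !fE => /eqP.
  by rewrite eqn_pmul2l ?expn_gt0 ?prime_gt0 // => /eqP/val_inj.
rewrite -/k -[RHS]card_ord -(card_imset predT f_inj); apply: eq_card => c.
rewrite inE; apply/idP/imsetP => [/dvdnP[j cj]|[i _ ->]]; last by rewrite fE dvdn_mulr.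
have jk : (j < k)%N.
  have : ((c : nat) < q)%N by rewrite -[X in (_ < X)%N](Zp_cast q_gt1) ltn_ord.
  by rewrite cj qE mulnC ltn_pmul2l // expn_gt0 prime_gt0.
by exists (Ordinal jk) => //; rewrite /f /= mulnC -cj -Zp_nat_valK.
Qed.

(** Every element of [Z/p^m] is a unit times a power of [p], so a subgroup is generated by its
    element of least valuation; the zero element has valuation [m]. *)
Lemma additive_set_Zp (B : {set Zq}) : additive_set B -> exists2 e, (e <= m)%N & B = pmult e.
Proof.
move=> Bs; have Bex : exists n, [exists c in B, (0 < c)%N && (logn p c == n)] || (n == m).
  by exists m; rewrite eqxx orbT.
case: (ex_minnP Bex) => e eP emin; have em : (e <= m)%N by apply: emin; rewrite eqxx orbT.
exists e => //; apply/setP => x; apply/idP/idP => [xB|].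
  rewrite inE; case: (posnP x) => [->|x0]; first exact: dvdn0.
  by rewrite pfactor_dvdn //; apply: emin; apply/orP; left; apply/existsP; exists x;
    rewrite xB x0 eqxx.
move=> /pmultP-/(_ em)[d ->]; case/orP: eP => [/existsP[c /and3P[cB c0 /eqP ce]]|/eqP->].
  have /dvdnP[k ck] : (p ^ e %| (c : nat))%N by rewrite pfactor_dvdn // ce.
  have k_unit : (k%:R : Zq) \is a GRing.unit.
    rewrite unit_natZ; apply/negP => pk; have := pfactor_dvdn e.+1 p_pr c0.
    rewrite ce ltnn ck expnS dvdn_mul //.
  have -> : (p ^ e)%:R * d = c * ((k%:R)^-1 * d).
    by rewrite [c in RHS]Zp_nat_valK ck natrM [X in X * (_ * _)]mulrC mulrA mulrK.
  by rewrite [_ * d]Zp_nat_valK mulr_natr; apply: additive_setMn.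
by rewrite pchar_Zp // mul0r; case/additive_setP: Bs.
Qed.

Section Coordinate.
Variable T : finType.
Local Notation vec := {ffun T -> Zq}.

Definition unitv (i : T) (c : Zq) : vec := [ffun k => if k == i then c else 0].
(** A box is a sum of coordinate lines: these are the subgroups fixed by a diagonal matrix
    whose entries differ by units. *)
Definition box (e : T -> nat) : {set vec} := [set x : vec | [forall i, x i \in pmult (e i)]].

Lemma unitvB i c d : unitv i c - unitv i d = unitv i (c - d).
Proof. by apply/ffunP => k; rewrite !ffunE; case: ifP; rewrite ?subrr. Qed.
Lemma unitv0 i : unitv i 0 = 0.
Proof. by apply/ffunP => k; rewrite !ffunE if_same. Qed.
Lemma sum_unitv (x : vec) : x = \sum_i unitv i (x i).
Proof.
apply/ffunP => k; rewrite sum_ffunE (bigD1 k) //= ffunE eqxx big1 ?addr0 // => i ik.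
by rewrite ffunE eq_sym (negPf ik).
Qed.

Lemma unitvM i (c d : Zq) : unitv i (c * d) = unitv i c *+ (d : nat).
Proof.
apply/ffunP => k; rewrite ffunMnE !ffunE; case: ifP => _; last by rewrite mul0rn.
by rewrite {1}(Zp_nat_valK d) mulr_natr.
Qed.

Lemma card_box e : (forall i, e i <= m)%N -> #|box e| = (\prod_i p ^ (m - e i))%N.
Proof.
move=> em; transitivity #|family (fun i => mem (pmult (e i)))|.
  by apply: eq_card => x; rewrite inE; apply/forallP/familyP.
by rewrite card_family foldrE big_map big_enum; apply: eq_bigr => i _; rewrite card_pmult.
Qed.

Lemma additive_box e : (forall i, e i <= m)%N -> additive_set (box e).
Proof.
move=> em; apply/additive_setP; split=> [|x y].
  by rewrite inE; apply/forallP => i; rewrite ffunE inE dvdn0.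
rewrite !inE => /forallP xe /forallP ye; apply/forallP => i; rewrite !ffunE.
by case/additive_setP: (additive_pmult (em i)) => _; apply.
Qed.

Lemma unitv_box e i c : (forall j, e j <= m)%N -> (unitv i c \in box e) = (c \in pmult (e i)).
Proof.
move=> em; rewrite inE; apply/forallP/idP => [/(_ i)|ce k]; rewrite ffunE ?eqxx //.
by case: eqP => [->//|_]; rewrite inE dvdn0.
Qed.

Lemma box_subP e A : (forall j, e j <= m)%N -> additive_set A ->
  reflect (forall i, unitv i (p ^ e i)%:R \in A) (box e \subset A).
Proof.
move=> em As; apply: (iffP subsetP) => [eA i|eA x].
  by apply: eA; rewrite unitv_box // inE dvdn_pow_natZ.
rewrite inE => /forallP xe; rewrite (sum_unitv x); apply: additive_set_sum => // i _.
have /pmultP-/(_ (em i))[d ->] := xe i.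
by rewrite unitvM; apply: additive_setMn.
Qed.

Lemma box_subset e f : (forall j, e j <= m)%N -> (forall j, f j <= m)%N ->
  (box e \subset box f) = [forall i, f i <= e i]%N.
Proof.
move=> em fm; apply/(box_subP em (additive_box fm))/forallP => H i; have := H i.
  rewrite unitv_box // inE dvdn_pow_natZ //.
  by rewrite dvdn_Pexp2l // prime_gt1.
by rewrite unitv_box // inE dvdn_pow_natZ // => fe; apply: dvdn_exp2l.
Qed.

Local Notation boxf e := (box (fun i => nat_of_ord (e i))).

Lemma box_inj (e f : {ffun T -> 'I_m.+1}) : boxf e = boxf f -> e = f.
Proof.
move=> ef; have em (g : {ffun T -> 'I_m.+1}) i : (g i <= m)%N by rewrite -ltnS.
have := subxx (boxf f); rewrite -{1}ef box_subset // => /forallP fe.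
have := subxx (boxf e); rewrite {1}ef box_subset // => /forallP fe'.
by apply/ffunP => i; apply/val_inj/eqP; rewrite eqn_leq fe fe'.
Qed.

Definition tact (t : T -> Zq) (x : vec) : vec := [ffun i => t i * x i].

(** The Lagrange interpolation polynomials of the entries [t i], evaluated at the diagonal
    matrix, are unit multiples of the coordinate projections: a stable subgroup contains the
    coordinate components of its elements. *)
Lemma tact_stable_box t (A : {set vec}) : additive_set A ->
  (forall i j, i != j -> t i - t j \is a GRing.unit) ->
  (forall x, x \in A -> tact t x \in A) ->
  exists e : {ffun T -> 'I_m.+1}, A = boxf e.
Proof.
move=> As tU tA.
(* apply the product of the (t - t j), j in s, to x *)
have prodA (s : seq T) x : x \in A -> [ffun k => (\prod_(j <- s) (t k - t j)) * x k] \in A.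
  move=> xA; elim: s => [|j s IH].
    by rewrite (_ : [ffun k => _] = x) //; apply/ffunP => k; rewrite ffunE big_nil mul1r.
  set y := [ffun k => _] in IH; have [_ AB] := additive_setP _ As.
  have -> : [ffun k => \prod_(j0 <- j :: s) (t k - t j0) * x k] = tact t y - y *+ (t j : nat).
    apply/ffunP => k; rewrite !ffunE ffunMnE !ffunE big_cons.
    by rewrite -[_ *+ (t j)]mulr_natr -Zp_nat_valK; ring.
  by apply: AB; [exact: tA|exact: additive_setMn].
have unitA x i : x \in A -> unitv i (x i) \in A.
  move=> xA; have := prodA (enum [pred j | j != i]) x xA; set c := \prod_(j | j != i) (t i - t j).
  have cU : c \is a GRing.unit.
    by apply: rpred_prod => j ji; apply: tU; rewrite eq_sym.
  have -> : [ffun k => (\prod_(j <- enum [pred j | j != i]) (t k - t j)) * x k] = unitv i (c * x i).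
    apply/ffunP => k; rewrite !ffunE big_enum /=; case: eqP => [->//|/eqP ki].
    by rewrite (bigD1 k) //= subrr !mul0r.
  move/(additive_setMn (c^-1 : Zq) As).
  rewrite (_ : _ *+ _ = unitv i (x i)) //; apply/ffunP => k; rewrite ffunMnE !ffunE.
  by case: ifP => _; rewrite ?mul0rn // -mulr_natr -Zp_nat_valK mulrAC mulrV ?mul1r.
have Bi i : exists e : 'I_m.+1, [set c | unitv i c \in A] == pmult e.
  have Bs : additive_set [set c | unitv i c \in A].
    have [A0 AB] := additive_setP _ As.
    apply/additive_setP; split=> [|c d]; rewrite !inE ?unitv0 // => cA dA.
    by rewrite -unitvB; apply: AB.
  have [e em eB] := additive_set_Zp Bs.
  by exists (Ordinal (em : (e < m.+1)%N)); apply/eqP.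
pose e : {ffun T -> 'I_m.+1} := [ffun i => xchoose (Bi i)].
have eB i : [set c | unitv i c \in A] = pmult (e i).
  by rewrite ffunE; apply/eqP; exact: (xchooseP (Bi i)).
exists e; apply/setP => x; apply/idP/idP => [xA|].
  by rewrite inE; apply/forallP => i; rewrite -eB inE; apply: unitA.
rewrite inE => /forallP xe; rewrite (sum_unitv x); apply: additive_set_sum => // i _.
by have := xe i; rewrite -eB inE.
Qed.

Lemma additive_tact (t : T -> Zq) A : additive_set A -> additive_set (tact t @: A).
Proof.
move=> /additive_setP[A0 AB]; apply/additive_setP; split.
  by apply/imsetP; exists 0 => //; apply/ffunP => i; rewrite !ffunE mulr0.
move=> _ _ /imsetP[x xA ->] /imsetP[y yA ->]; apply/imsetP; exists (x - y); first exact: AB.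
by apply/ffunP => i; rewrite !ffunE mulrBr.
Qed.

Lemma tact_inj (t : T -> Zq) : (forall i, t i \is a GRing.unit) -> injective (tact t).
Proof.
move=> tU x y /ffunP xy; apply/ffunP => i; have := xy i; rewrite !ffunE.
exact: mulrI.
Qed.

Lemma tact_box (t : T -> Zq) (e : T -> nat) : (forall i, t i \is a GRing.unit) ->
  (forall i, e i <= m)%N -> tact t @: box e = box e.
Proof.
move=> tU em; apply/eqP; rewrite eqEcard card_imset ?leqnn ?andbT; last exact: tact_inj.
apply/subsetP => _ /imsetP[x xe ->]; move: xe; rewrite !inE => /forallP xe.
apply/forallP => i; rewrite ffunE; have /pmultP-/(_ (em i))[d ->] := xe i.
by apply/pmultP => //; exists (t i * d); rewrite mulrCA.
Qed.

Lemma iter_tact_imset (t : T -> Zq) l A : (forall i, t i ^+ l = 1) ->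
  iter l (fun A : {set vec} => tact t @: A) A = A.
Proof.
move=> tl; have -> : iter l (fun A : {set vec} => tact t @: A) A = iter l (tact t) @: A.
  elim: l {tl} => [|l IH] /=; first by rewrite imset_id.
  by rewrite IH -imset_comp.
rewrite -[RHS]imset_id; apply: eq_imset => x; apply/ffunP => i /=.
have -> : iter l (tact t) x i = t i ^+ l * x i.
  elim: l {tl} => [|l IH]; first by rewrite mul1r.
  by rewrite iterS ffunE IH exprS mulrA.
by rewrite tl mul1r.
Qed.

End Coordinate.
End Cyclic.

Arguments pmult {p m} e.
Arguments box {p m T} e.
Arguments unitv {p m T} i c.
Arguments tact {p m T} t x.

Lemma card_pairs (X Y : finType) (P : X -> Y -> bool) :
  #|[set xy : X * Y | P xy.1 xy.2]| = (\sum_x #|[set y | P x y]|)%N.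
Proof.
rewrite -sum1dep_card -(pair_big_dep predT (fun x y => P x y) (fun _ _ => 1%N)) /=.
by apply: eq_bigr => x _; rewrite sum1dep_card.
Qed.

(** * Counting subgroups above a box modulo l *)

Section Torus.
Variables (p m : nat).
Hypotheses (p_pr : prime p) (m_gt0 : (0 < m)%N).
Local Notation q := (p ^ m)%N.
Local Notation Zq := 'Z_(p ^ m).
Local Notation boxf e := (box (fun i => nat_of_ord (e i))).

Variables (l : nat) (u : Zq).
Hypotheses (l_pr : prime l) (ul : u ^+ l = 1).
Hypothesis u_gen : forall k, (0 < k < l)%N -> u ^+ k - 1 \is a GRing.unit.

Lemma generator_unit : u \is a GRing.unit.
Proof. by apply/unitrPr; exists (u ^+ l.-1); rewrite -exprS prednK ?ul // prime_gt0. Qed.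

(** As [u^a - u^b = u^a (1 - u^(b - a))] with [0 < b - a < l]. *)
Lemma generator_diff a b : (a < l)%N -> (b < l)%N -> a != b -> u ^+ a - u ^+ b \is a GRing.unit.
Proof.
wlog ab : a b / (a < b)%N => [H al bl ne|al bl _].
  case: (ltngtP a b) ne => // ab _; first by apply: H => //; lia.
  by rewrite -unitrN opprB; apply: H => //; lia.
rewrite -(subnKC (ltnW ab)) exprD -[X in X - _]mulr1 -mulrBr unitrM unitrX ?generator_unit //=.
by rewrite -unitrN opprB; apply: u_gen; lia.
Qed.

Lemma card_boxf (T : finType) (e : {ffun T -> 'I_m.+1}) :
  (#|(boxf e : {set {ffun T -> Zq}})| * p ^ (\sum_i e i) = q ^ #|T|)%N.
Proof.
have em i : (e i <= m)%N by rewrite -ltnS.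
rewrite card_box // expn_sum -big_split /=.
rewrite (eq_bigr (fun _ => q)) ?prod_nat_const // => i _.
by rewrite -expnD subnK.
Qed.

Lemma card_boxf_eq (T : finType) (e : {ffun T -> 'I_m.+1}) n :
  (#|(boxf e : {set {ffun T -> Zq}})| * p ^ n == q ^ #|T|)%N = (\sum_i e i == n)%N.
Proof.
rewrite -(card_boxf e) eqn_pmul2l.
  by rewrite eqn_exp2l ?prime_gt1 // eq_sym.
have := card_boxf e; rewrite lt0n; case: eqP => // -> /esym/eqP.
by rewrite mul0n -expnM expn_eq0; case: p p_pr => [|[]].
Qed.

(** The diagonal matrix with entries [u^0, u^1, ...] permutes the subgroups above a box with
    orbits of size 1 or [l].  For [#|T| <= l] its entries are separated by units, so the fixed
    subgroups are boxes; the index of a box is [p] to the sum of its exponents. *)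
Lemma count_above_box (T : finType) (mu : T -> nat) n :
  (#|T| <= l)%N -> (forall i, mu i <= m)%N ->
  #|[set A : {set {ffun T -> Zq}} |
      [&& additive_set A, box mu \subset A & #|A| * p ^ n == q ^ #|T|]%N]| =
  #|[set e : {ffun T -> 'I_m.+1} | [forall i, e i <= mu i]%N && (\sum_i e i == n)%N]|
   %[mod l].
Proof.
move=> Tl mum; pose t (i : T) := u ^+ (enum_rank i).
have tU i : t i \is a GRing.unit by rewrite unitrX // generator_unit.
have rl (i : T) : (enum_rank i < l)%N by apply: leq_trans Tl.
have tl i : t i ^+ l = 1 by rewrite exprAC ul expr1n.
rewrite (card_fixed_mod (f := fun A : {set {ffun T -> Zq}} => tact t @: A) l_pr); first last.
- move=> A; rewrite !inE => /and3P[As muA cA].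
  rewrite additive_tact // card_imset ?cA ?andbT /=; last exact: tact_inj.
  by rewrite -(tact_box p_pr m_gt0 tU mum) imsetS.
- by move=> A; apply: iter_tact_imset.
congr (_ %% l)%N; rewrite -(card_imset _ (@box_inj p m p_pr m_gt0 T)); apply: eq_card => A.
have em (e : {ffun T -> 'I_m.+1}) i : (e i <= m)%N by rewrite -ltnS.
rewrite inE inE; apply/idP/imsetP => [/andP[/and3P[As muA cA] /eqP tA]|[e]].
  have [|x xA|e eA] := tact_stable_box p_pr m_gt0 As (t := t).
  - move=> i j ij; apply: generator_diff => //.
    by apply: contra ij => /eqP/ord_inj/enum_rank_inj->.
  - by rewrite -tA; apply: imset_f.
  exists e => //; rewrite inE; move: muA cA; rewrite eA box_subset // => -> /=.
  by rewrite card_boxf_eq.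
rewrite inE => /andP[emu en] ->; rewrite additive_box // box_subset // emu card_boxf_eq // en /=.
by rewrite tact_box.
Qed.

End Torus.

(** * Ideal triples over Z/p^m *)

Section Model.
Variable R : comNzRingType.
(** Indices are added modulo 3. *)
Definition cross (x y : {ffun 'I_3 -> R}) : {ffun 'I_3 -> R} :=
  [ffun i : 'I_3 => x (i + 1) * y (i + 2%:R) - x (i + 2%:R) * y (i + 1)].
Definition outer (w y : {ffun 'I_3 -> R}) : {ffun 'I_3 * 'I_3 -> R} :=
  [ffun ij => w ij.1 * y ij.2].
Definition idmx : {ffun 'I_3 * 'I_3 -> R} := [ffun ij => (ij.1 == ij.2)%:R].
End Model.
Arguments idmx {R}.

Lemma ord3P (P : 'I_3 -> Prop) : P 0 -> P 1 -> P 2%:R -> forall i, P i.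
Proof.
move=> P0 P1 P2 [[|[|[|//]]] lt3].
- by rewrite (_ : Ordinal lt3 = 0) //; apply: val_inj.
- by rewrite (_ : Ordinal lt3 = 1) //; apply: val_inj.
- by rewrite (_ : Ordinal lt3 = 2%:R) //; apply: val_inj.
Qed.

Lemma ord3D : (1 + 1 = 2%:R :> 'I_3) * (1 + 2%:R = 0 :> 'I_3) *
  (2%:R + 1 = 0 :> 'I_3) * (2%:R + 2%:R = 1 :> 'I_3).
Proof. by do !split; apply: val_inj. Qed.

Lemma diag_out (T : eqType) (k h i : T) : k != h -> (k == i) && (h == i) = false.
Proof. by move=> kh; apply: contraNF kh => /andP[/eqP-> /eqP->]. Qed.

Lemma sum3 (V : nmodType) (F : 'I_3 -> V) : \sum_i F i = F 0 + F 1 + F 2%:R.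
Proof.
rewrite !big_ord_recl big_ord0 addr0 addrA; congr (F _ + F _ + F _); exact: val_inj.
Qed.

Section Ideals.
Variables (p m : nat).
Hypotheses (p_pr : prime p) (m_gt0 : (0 < m)%N).
Local Notation q := (p ^ m)%N.
Local Notation Zq := 'Z_(p ^ m).
Local Notation boxf e := (box (fun i => nat_of_ord (e i))).
Local Notation V := {ffun 'I_3 -> Zq}.
Local Notation M := {ffun 'I_3 * 'I_3 -> Zq}.
Local Notation exps T := {ffun T -> 'I_m.+1}.

(** The degree components of a graded ideal of [V + V + M / R], reduced modulo [p^m]; here
    [M / R] is the module of matrices modulo scalar ones, whence the condition on [idmx].  The
    bracket of [x] in degree 1 with [y] in degree 2 is [- outer y x]. *)
Definition ideal_triple (A : {set V} * {set V} * {set M}) : bool :=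
  [&& additive_set A.1.1, additive_set A.1.2, additive_set A.2, idmx \in A.2,
    [forall x in A.1.1, forall y, (cross x y \in A.1.2) && (outer y x \in A.2)] &
    [forall w in A.1.2, forall y, outer w y \in A.2]].

Lemma ideal_tripleP A1 A2 A3 :
  reflect [/\ [/\ additive_set A1, additive_set A2 & additive_set A3], idmx \in A3,
    forall x y, x \in A1 -> cross x y \in A2,
    forall x y, x \in A1 -> outer y x \in A3 &
    forall w y, w \in A2 -> outer w y \in A3] (ideal_triple (A1, A2, A3)).
Proof.
apply: (iffP and5P) => [[s1 s2 s3 i3 /andP[/forall_inP c13 /forall_inP c23]]|].
  split=> // [x y x1|x y x1|w y w2].
  - by have /forallP/(_ y)/andP[] := c13 x x1.
  - by have /forallP/(_ y)/andP[] := c13 x x1.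
  - by have /forallP/(_ y) := c23 w w2.
case=> -[s1 s2 s3] i3 c12 c13 c23; split=> //; apply/andP; split; apply/forall_inP => x xA.
  by apply/forallP => y; rewrite c12 //= c13.
by apply/forallP => y; apply: c23.
Qed.

(** The ambient module has [q^(3 + 3 + 9)] elements. *)
Definition triple_index n (A : {set V} * {set V} * {set M}) : bool :=
  (#|A.1.1| * #|A.1.2| * #|A.2| * p ^ n == q ^ 15)%N.

Definition argmax3 (v : exps 'I_3) : 'I_3 := [arg max_(i > 0%R) v i]%N.
(** The largest exponents allowed for [A3], which contains the [p^(v i) e_ij] and the identity
    matrix.  The latter replaces the basis vector [e_ii] for an [i] with [v i] maximal. *)
Definition top_exp (v : exps 'I_3) (ij : 'I_3 * 'I_3) : nat :=
  if (ij.1 == argmax3 v) && (ij.2 == argmax3 v) then 0%N else v ij.1.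

Lemma argmax3_le (v : exps 'I_3) i : (v i <= v (argmax3 v))%N.
Proof. by rewrite /argmax3; case: arg_maxnP => // j _; apply. Qed.

(** A triple [(a, v, e)] of exponent vectors.  The bracket of [e_i] and [e_k] is [+- e_j] for
    [i, j, k] distinct, so [A1 x V] is in [A2] when [v j <= a i] for all [j <> i]. *)
Definition exp_triple n (x : exps 'I_3 * exps 'I_3 * exps ('I_3 * 'I_3)%type) : bool :=
  [&& [forall i, forall j, (i != j) ==> (x.1.2 j <= x.1.1 i)],
    [forall ij, x.2 ij <= top_exp x.1.2 ij] &
    \sum_i x.1.1 i + \sum_i x.1.2 i + \sum_ij x.2 ij == n]%N.

Section Fiber.
Variables (a v : exps 'I_3).
Hypothesis av : forall i j, i != j -> (v j <= a i)%N.
Local Notation i0 := (argmax3 v).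

Lemma pmult_mulr e (c d : Zq) : (e <= m)%N -> c \in pmult e -> c * d \in pmult e.
Proof.
move=> em /pmultP-/(_ p_pr m_gt0 em)[b ->]; apply/pmultP => //.
by exists (b * d); rewrite mulrA.
Qed.
Lemma pmult_le e f (c : Zq) : (f <= e)%N -> c \in pmult e -> c \in pmult f.
Proof. by move=> fe; rewrite !inE; apply: dvdn_trans; apply: dvdn_exp2l. Qed.

Lemma ord_le (T : finType) (e : exps T) i : (e i <= m)%N.
Proof. by rewrite -ltnS. Qed.

Lemma outerE c d i j : outer (unitv i c : V) (unitv j d) = unitv (i, j) (c * d).
Proof.
apply/ffunP => -[k h]; rewrite !ffunE /= xpair_eqE.
by case: (k == i); case: (h == j); rewrite ?mul0r ?mulr0.
Qed.

(** Brackets of [A1] with degree 2 impose nothing new on [A3]: [p^(a j) e_ij] is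
    in [A3] for [i <> j] because [v i <= a j], and [p^(a j) e_jj] differs from a multiple of
    the identity matrix by the [p^(a j) e_kk], [k <> j]. *)
Lemma ideal_triple_box (A : {set M}) :
  ideal_triple (boxf a, boxf v, A) =
  [&& additive_set A, idmx \in A & [forall ij, unitv ij ((p ^ v ij.1)%:R) \in A]].
Proof.
apply/ideal_tripleP/and3P => [[[_ _ s3] i3 _ _ c23]|[s3 i3 /forallP vA]].
  split=> //; apply/forallP => -[i j] /=.
  rewrite -[_%:R]mulr1 -outerE; apply: c23.
  by rewrite unitv_box ?inE ?dvdn_pow_natZ ?ord_le // => k; apply: ord_le.
have vA' i j c : c \in pmult (v i) -> unitv (i, j) c \in A.
  move=> /pmultP-/(_ p_pr m_gt0 (ord_le _ _))[d ->].
  by rewrite unitvM; apply: additive_setMn => //; apply: (vA (i, j)).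
split=> //.
- by split=> //; apply: additive_box => // i; apply: ord_le.
- move=> x y; rewrite !inE => /forallP xa; apply/forallP => i; rewrite ffunE.
  have /additive_setP[_ ->] // := additive_pmult p_pr m_gt0 (ord_le v i).
  + apply: pmult_mulr; first exact: ord_le.
    by apply: (pmult_le _ (xa _)); apply: av; elim/ord3P: i.
  + apply: pmult_mulr; first exact: ord_le.
    by apply: (pmult_le _ (xa _)); apply: av; elim/ord3P: i.
- move=> x y; rewrite inE => /forallP xa.
  rewrite (sum_unitv (outer y x)); apply: additive_set_sum => // -[i j] _; rewrite ffunE /=.
  have xa' d k : k != j -> d * x j \in pmult (v k).
    move=> kj; rewrite mulrC; apply: pmult_mulr; first exact: ord_le.
    by apply: (pmult_le _ (xa _)); apply: av; rewrite eq_sym.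
  have [->|ij] := eqVneq i j; last by apply: vA'; apply: xa'.
  set c := y j * x j.
  have -> : unitv (j, j) c = idmx *+ (c : nat) -
      \sum_(k | k != j) unitv (k, k) c.
    apply/eqP; rewrite -subr_eq0 opprB addrA; apply/eqP/ffunP => -[k h].
    rewrite !ffunE /= sum_ffunE ffunMnE !ffunE /= -[_ *+ (c : nat)]mulr_natr -(Zp_nat_valK c).
    rewrite xpair_eqE; have [<-|kh] := eqVneq k h.
      rewrite andbb mul1r; have [->|kj] := eqVneq k j.
        rewrite big1 ?addr0 ?subrr // => i' ij'; rewrite ffunE xpair_eqE andbb.
        by rewrite eq_sym (negPf ij').
      rewrite (bigD1 k) //= ffunE eqxx big1 ?addr0 ?add0r ?subrr // => i' /andP[_ ik'].
      by rewrite ffunE xpair_eqE andbb eq_sym (negPf ik').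
    rewrite mul0r subr0 big1 ?addr0 => [|i' _]; last first.
      by rewrite ffunE xpair_eqE diag_out.
    by rewrite diag_out.
  have /additive_setP[_ ->] // := s3; first exact: additive_setMn.
  by apply: additive_set_sum => // k kj; apply: vA'; apply: xa'.
- move=> w y; rewrite inE => /forallP wv.
  rewrite (sum_unitv (outer w y)); apply: additive_set_sum => // -[i j] _; rewrite ffunE /=.
  by apply: vA'; apply: pmult_mulr => //; apply: ord_le.
Qed.

(** The change of basis that replaces the vector of index [(i0, i0)] by the identity matrix. *)
Definition shear (z : M) : M :=
  [ffun ij => z ij - ((ij.1 == ij.2) && (ij.1 != i0))%:R * z (i0, i0)].
Definition unshear (z : M) : M :=
  [ffun ij => z ij + ((ij.1 == ij.2) && (ij.1 != i0))%:R * z (i0, i0)].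
Lemma shearK : cancel shear unshear.
Proof. by move=> z; apply/ffunP => ij; rewrite !ffunE /= !eqxx /= mul0r subr0 subrK. Qed.
Lemma unshearK : cancel unshear shear.
Proof. by move=> z; apply/ffunP => ij; rewrite !ffunE /= !eqxx /= mul0r addr0 addrK. Qed.
Lemma shearB x y : shear (x - y) = shear x - shear y.
Proof. by apply/ffunP => ij; rewrite !ffunE; ring. Qed.
Lemma unshearB x y : unshear (x - y) = unshear x - unshear y.
Proof. by apply/ffunP => ij; rewrite !ffunE; ring. Qed.

Lemma additive_imset (f : M -> M) A : f 0 = 0 -> (forall x y, f (x - y) = f x - f y) ->
  additive_set A -> additive_set (f @: A).
Proof.
move=> f0 fB /additive_setP[A0 AB]; apply/additive_setP; split; first by apply/imsetP; exists 0.
by move=> _ _ /imsetP[x xA ->] /imsetP[y yA ->]; rewrite -fB; apply: imset_f; apply: AB.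
Qed.

Lemma shear0 : shear 0 = 0. Proof. by rewrite -(subrr 0) shearB !subrr. Qed.
Lemma unshear0 : unshear 0 = 0. Proof. by rewrite -(subrr 0) unshearB !subrr. Qed.

Lemma top_exp_le ij : (top_exp v ij <= m)%N.
Proof. by rewrite /top_exp; case: ifP => // _; apply: ord_le. Qed.

(** The shear maps [idmx] to a coordinate vector and fixes all other coordinate vectors but
    [e_(i0, i0)]; the image of [p^(v i0) e_(i0, i0)] is a combination of that of [idmx] and
    of the [p^(v k) e_kk], because [v i0] is the largest exponent. *)
Lemma shear_box (A : {set M}) : additive_set A ->
  (idmx \in A) && [forall ij, unitv ij ((p ^ v ij.1)%:R) \in A] =
  (box (top_exp v) \subset shear @: A).
Proof.
move=> As; have sA : additive_set (shear @: A) by apply: additive_imset => //; [exact: shear0|exact: shearB].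
have memA z : (z \in A) = (shear z \in shear @: A) by rewrite mem_imset //; apply: can_inj shearK.
have sI : shear idmx = unitv (i0, i0) 1.
  apply/ffunP => -[i j]; rewrite !ffunE /= eqxx mulr1 xpair_eqE.
  have [<-|ij] := eqVneq i j; first by rewrite /= andbb; case: (i == i0); rewrite ?subr0 ?subrr.
  by rewrite /= subr0 diag_out.
have sU ij c : ij != (i0, i0) -> shear (unitv ij c) = unitv ij c.
  move=> ne; apply/ffunP => kh; rewrite !ffunE (eq_sym (i0, i0)) (negPf ne).
  by rewrite mulr0 subr0.
have sU0 c : shear (unitv (i0, i0) c) = unitv (i0, i0) c - \sum_(k | k != i0) unitv (k, k) c.
  apply/ffunP => -[k h]; rewrite !ffunE /= eqxx sum_ffunE; congr (_ - _).
  have [<-|kh] /= := eqVneq k h; last first.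
    rewrite mul0r big1 // => i' _.
    by rewrite ffunE xpair_eqE diag_out.
  have [->|kj] /= := eqVneq k i0.
    rewrite mul0r big1 // => i' ij'; rewrite ffunE xpair_eqE andbb.
    by rewrite eq_sym (negPf ij').
  rewrite (bigD1 k) //= ffunE eqxx big1 ?addr0 ?mul1r // => i' /andP[_ ik'].
  by rewrite ffunE xpair_eqE andbb eq_sym (negPf ik').
apply/andP/(box_subP p_pr m_gt0 top_exp_le sA) => [[i3 /forallP vA] [i j]|tA].
  have [[-> ->]|ne] := eqVneq (i, j) (i0, i0).
    by rewrite /top_exp !eqxx /= expn0 -sI -memA.
  have := vA (i, j); rewrite memA sU // /top_exp /=.
  by move: ne; rewrite xpair_eqE => /negPf->.
have ne0 ij : ij != (i0, i0) -> unitv ij (p ^ v ij.1)%:R \in shear @: A.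
  move=> ne; have := tA ij; rewrite /top_exp; case: ij ne => i j; rewrite xpair_eqE /=.
  by move=> /negPf->.
split; first by have := tA (i0, i0); rewrite /top_exp !eqxx /= expn0 memA sI.
have mulA ij c (d : Zq) : unitv ij c \in shear @: A -> unitv ij (c * d) \in shear @: A.
  by move=> cA; rewrite unitvM; apply: additive_setMn.
apply/forallP => ij; rewrite memA; have [->|ne] := eqVneq ij (i0, i0); last first.
  by rewrite sU //; apply: ne0.
rewrite sU0 /=; have /additive_setP[_ ->] // := sA.
  rewrite -[_%:R]mul1r; apply: mulA.
  by have := tA (i0, i0); rewrite /top_exp !eqxx /= expn0.
apply: additive_set_sum => // k ki.
have -> : (p ^ v i0)%:R = (p ^ v k)%:R * (p ^ (v i0 - v k))%:R :> Zq.
  by rewrite -natrM -expnD subnKC // argmax3_le.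
apply: mulA; apply: (ne0 (k, k)).
by rewrite xpair_eqE andbb.
Qed.

Variables (l : nat) (u : Zq).
Hypotheses (l_pr : prime l) (ul : u ^+ l = 1) (l_ge9 : (9 <= l)%N).
Hypothesis u_gen : forall k, (0 < k < l)%N -> u ^+ k - 1 \is a GRing.unit.

(** Over a pair of boxes, the third components correspond through the shear to the subgroups
    of index [p^(n - s)] above a box of [(Z/p^m)^9]; this is where [9 <= l] is used. *)
Lemma count_fiber n :
  #|[set A : {set M} | ideal_triple (boxf a, boxf v, A) && triple_index n (boxf a, boxf v, A)]| =
  #|[set e : exps ('I_3 * 'I_3)%type | exp_triple n (a, v, e)]| %[mod l].
Proof.
have pgt0 k : (0 < p ^ k)%N by rewrite expn_gt0 prime_gt0.
have ca := card_boxf p_pr m_gt0 a; have cv := card_boxf p_pr m_gt0 v.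
rewrite card_ord in ca cv.
set s := (\sum_i a i + \sum_i v i)%N.
have avT : [forall i, forall j, (i != j) ==> (v j <= a i)%N].
  by apply/forallP => i; apply/forallP => j; apply/implyP; apply: av.
have cT : #|{: 'I_3 * 'I_3}| = 9 by rewrite card_prod !card_ord.
have idxE (A : {set M}) : triple_index n (boxf a, boxf v, A) = (#|A| * p ^ n == q ^ 9 * p ^ s)%N.
  rewrite /triple_index /= -(eqn_pmul2r (pgt0 s)).
  set ba := #|_| in ca *; set bv := #|_| in cv *.
  have -> : (ba * bv * #|A| * p ^ n * p ^ s = q ^ 6 * (#|A| * p ^ n))%N.
    rewrite /s expnD (_ : q ^ 6 = q ^ 3 * q ^ 3)%N; last by rewrite -expnD.
    by rewrite -{1}ca -cv; ring.
  rewrite (_ : q ^ 15 = q ^ 6 * q ^ 9)%N; last by rewrite -expnD.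
  by rewrite -mulnA eqn_pmul2l // expn_gt0 pgt0.
have [sn|ns] := leqP s n; last first.
  rewrite !eq_card0 // => [e|A]; rewrite !inE.
    by apply/negP => /and3P[_ _ /eqP]; rewrite /= -/s; lia.
  apply/negP => /andP[_]; rewrite idxE => /eqP cA.
  have : (#|A| <= q ^ 9)%N.
    apply: leq_trans (max_card _) _; rewrite card_ffun cT card_ord Zp_cast //.
    by rewrite -(exp1n m) ltn_exp2r // prime_gt1.
  have : (q ^ 9 * p ^ n < q ^ 9 * p ^ s)%N.
    by rewrite ltn_pmul2l ?ltn_exp2l ?prime_gt1 // expn_gt0 pgt0.
  by rewrite -cA ltn_pmul2r // ltnNge => /negP.
transitivity (#|[set A : {set M} | [&& additive_set A, box (top_exp v) \subset A
    & #|A| * p ^ (n - s) == q ^ #|{: 'I_3 * 'I_3}|]%N]| %% l)%N.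
  congr (_ %% l)%N; rewrite -(card_imset _ (imset_inj (can_inj shearK))).
  have idxE' (A : {set M}) : triple_index n (boxf a, boxf v, A) =
      (#|A| * p ^ (n - s) == q ^ #|{: 'I_3 * 'I_3}|)%N.
    by rewrite idxE cT -[in RHS](eqn_pmul2r (pgt0 s)) -[in RHS]mulnA -expnD subnK.
  apply: eq_card => B; rewrite inE; apply/imsetP/idP => [[A]|].
    rewrite inE ideal_triple_box idxE' => /andP[/and3P[As i3 vA] cA] ->.
    rewrite -shear_box // i3 vA card_imset ?cA ?andbT; last exact: can_inj shearK.
    by apply: additive_imset => //; [exact: shear0|exact: shearB].
  move=> /and3P[Bs tB cB]; exists (unshear @: B); last first.
    by rewrite -imset_comp (eq_imset (g := id)) ?imset_id // => z /=; rewrite unshearK.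
  have us : additive_set (unshear @: B) by apply: additive_imset => //; [exact: unshear0|exact: unshearB].
  rewrite inE ideal_triple_box idxE' us shear_box // card_imset ?cB ?andbT //=.
    by rewrite -imset_comp (eq_imset (g := id)) ?imset_id // => z /=; rewrite unshearK.
  exact: can_inj unshearK.
rewrite (count_above_box p_pr m_gt0 l_pr ul u_gen) //; last exact: top_exp_le; last by rewrite cT.
congr (_ %% l)%N; apply: eq_card => e; rewrite !inE /exp_triple /= avT /=.
by rewrite -/s -(eqn_add2l s) subnKC.
Qed.

End Fiber.

Section Total.
Variables (l : nat) (u : Zq).
Hypotheses (l_pr : prime l) (ul : u ^+ l = 1) (l_ge9 : (9 <= l)%N).
Hypothesis u_gen : forall k, (0 < k < l)%N -> u ^+ k - 1 \is a GRing.unit.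

(** The action of [diag(1, u, u^-1)] in degrees 1, 2 and 3; as the determinant is 1, the cross
    product carries the inverse weights, and the identity matrix is fixed. *)
Definition wt1 (i : 'I_3) : Zq := u ^+ nth 0%N [:: 0; 1; l.-1]%N i.
Definition wt2 (i : 'I_3) : Zq := u ^+ nth 0%N [:: 0; l.-1; 1]%N i.
Definition wt3 (ij : 'I_3 * 'I_3) : Zq := wt2 ij.1 * wt1 ij.2.

Let uu : u * u ^+ l.-1 = 1.
Proof. by rewrite -exprS prednK ?ul // prime_gt0. Qed.

Lemma cross_tact x y : cross (tact wt1 x) (tact wt1 y) = tact wt2 (cross x y).
Proof.
apply/ffunP; elim/ord3P; rewrite !ffunE /wt1 /wt2 /= expr0 ?expr1.
- by rewrite !mul1r -[RHS]mul1r -uu; ring.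
- by rewrite !mul1r; ring.
- by rewrite !mul1r; ring.
Qed.

Lemma outer_tact w y : outer (tact wt2 w) (tact wt1 y) = tact wt3 (outer w y).
Proof. by apply/ffunP => ij; rewrite !ffunE /wt3; ring. Qed.

Lemma idmx_tact : tact wt3 idmx = idmx.
Proof.
apply/ffunP => -[i j]; rewrite !ffunE /wt3 /=; have [<-|_] := eqVneq i j; last by rewrite mulr0.
elim/ord3P: i; rewrite /wt1 /wt2 /= ?expr0 ?mulr1 ?expr1 //.
by rewrite mulrC.
Qed.

Lemma wt_unit : (forall i, wt1 i \is a GRing.unit) /\ (forall i, wt2 i \is a GRing.unit).
Proof. by split=> i; rewrite unitrX // (generator_unit l_pr ul). Qed.
Lemma wt_pow : (forall i, wt1 i ^+ l = 1) /\ (forall i, wt2 i ^+ l = 1).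
Proof. by split=> i; rewrite exprAC ul expr1n. Qed.
Lemma wt_diff : (forall i j, i != j -> wt1 i - wt1 j \is a GRing.unit) /\
  (forall i j, i != j -> wt2 i - wt2 j \is a GRing.unit).
Proof.
have lt (s : seq nat) (i : 'I_3) : all (fun k => k < l)%N s -> (nth 0%N s i < l)%N.
  move=> /all_nthP H; case: (ltnP i (size s)) => [/H//|/(nth_default 0%N)->].
  by rewrite prime_gt0.
by split=> i j ij; rewrite /wt1 /wt2; (apply: (generator_diff p_pr m_gt0 l_pr ul u_gen); first (by apply: lt => /=; lia);
  first (by apply: lt => /=; lia));
  elim/ord3P: i ij; elim/ord3P: j => //= _; apply/eqP => /=; lia.
Qed.

Definition torus (A : {set V} * {set V} * {set M}) :=
  (tact wt1 @: A.1.1, tact wt2 @: A.1.2, tact wt3 @: A.2).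

Lemma iter_torus A : iter l torus A = A.
Proof.
have -> : iter l torus A =
  (iter l (fun A : {set V} => tact wt1 @: A) A.1.1,
   iter l (fun A : {set V} => tact wt2 @: A) A.1.2,
   iter l (fun A : {set M} => tact wt3 @: A) A.2).
  by elim: l => [|k IH]; [case: A => -[]|rewrite !iterS IH].
have [w1 w2] := wt_pow; have w3 ij : wt3 ij ^+ l = 1.
  by rewrite /wt3 exprMn w1 w2 mulr1.
by rewrite !iter_tact_imset //; case: A => -[].
Qed.

Lemma torus_ideal n A : ideal_triple A && triple_index n A ->
  ideal_triple (torus A) && triple_index n (torus A).
Proof.
have [w1 w2] := wt_unit; have w3 ij : wt3 ij \is a GRing.unit by rewrite unitrM w1 w2.
case: A => -[A1 A2] A3 /andP[/ideal_tripleP[[s1 s2 s3] i3 c12 c13 c23] iA].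
have surj (T : finType) (t : T -> Zq) (x : {ffun T -> Zq}) : (forall i, t i \is a GRing.unit) ->
    x = tact t (tact (fun i => (t i)^-1) x).
  by move=> tU; apply/ffunP => i; rewrite !ffunE mulrA mulrV ?mul1r.
apply/andP; split; last first.
  by move: iA; rewrite /triple_index !card_imset //; apply: tact_inj.
apply/ideal_tripleP; split.
- by split; apply: additive_tact.
- by rewrite -idmx_tact; apply: imset_f.
- move=> _ y /imsetP[x xA ->]; rewrite (surj _ wt1 y) // cross_tact.
  by apply: imset_f; apply: c12.
- move=> _ y /imsetP[x xA ->]; rewrite (surj _ wt2 y) // outer_tact.
  by apply: imset_f; apply: c13.
- move=> _ y /imsetP[x xA ->]; rewrite (surj _ wt1 y) // outer_tact.
  by apply: imset_f; apply: c23.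
Qed.

(** The torus acts freely on the triples whose first two components are not both fixed.  The
    third component is left free here, since its weights are not distinct: the fibres over the
    pairs of boxes are counted by [count_fiber]. *)
Lemma count_ideal_triples n :
  #|[set A | ideal_triple A && triple_index n A]| = #|[set x | exp_triple n x]| %[mod l].
Proof.
set S := [set A | _]; pose S' := [set A in S | (torus A).1 == A.1].
have torusS A : A \in S -> torus A \in S by rewrite !inE; apply: torus_ideal.
have S'sub : S' \subset S by apply/subsetP => A; rewrite inE => /andP[].
have -> : #|S| = #|S'| %[mod l].
  rewrite -(cardsID S' S) (setIidPr S'sub) -modnDmr.
  rewrite (card_fixed_mod (f := torus) l_pr); first last.
  - have [w1 w2] := wt_unit => A; rewrite inE => /andP[nf AS].
    rewrite inE torusS // andbT; apply: contra nf; rewrite inE => /andP[_ /eqP[]].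
    move=> e1 e2.
    have inj1 := imset_inj (@tact_inj p m _ _ w1); have inj2 := imset_inj (@tact_inj p m _ _ w2).
    rewrite inE AS; apply/eqP; case: A e1 e2 {AS} => -[A1 A2] A3 /= e1 e2.
    by congr pair; [apply: inj1|apply: inj2].
  - exact: iter_torus.
  rewrite [X in (_ + X %% l)%N](_ : _ = 0%N) ?mod0n ?addn0 //; apply: eq_card0 => A.
  rewrite inE; apply/negP => /andP[/setDP[AS /negP nf] /eqP tA].
  by apply: nf; rewrite inE AS tA eqxx.
pose B (x : exps 'I_3 * exps 'I_3) : {set V} * {set V} := (boxf x.1, boxf x.2).
have -> : #|S'| = (\sum_x #|[set A : {set M} | ideal_triple (B x, A) && triple_index n (B x, A)]|)%N.
  rewrite -card_pairs -(card_imset _ (f := fun xA => (B xA.1, xA.2))); last first.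
    move=> [[a v] A] [[b w] C] /= [e1 e2 ->].
    by rewrite (box_inj p_pr m_gt0 e1) (box_inj p_pr m_gt0 e2).
  apply: eq_card => -[[A1 A2] A3]; apply/idP/imsetP; last first.
    move=> [[[a v] A] /=]; rewrite inE /= => iA [-> -> ->]; rewrite !inE iA /=.
    have [w1 w2] := wt_unit; apply/eqP; congr pair; apply: tact_box => // i; exact: ord_le.
  rewrite !inE => /andP[iA /eqP[e1 e2]].
  have /andP[/ideal_tripleP[[s1 s2 _] _ _ _ _] _] := iA.
  have [d1 d2] := wt_diff.
  have [|a aE] := tact_stable_box p_pr m_gt0 s1 d1.
    by move=> x xA; rewrite -e1; apply: imset_f.
  have [|v vE] := tact_stable_box p_pr m_gt0 s2 d2.
    by move=> x xA; rewrite -e2; apply: imset_f.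
  by exists (a, v, A3); rewrite ?inE /B /= -?aE -?vE.
rewrite (_ : #|[set x | exp_triple n x]| = \sum_x #|[set e | exp_triple n (x, e)]|)%N; last first.
  by rewrite -card_pairs; apply: eq_card => -[x e]; rewrite !inE.
rewrite -modn_summ -[RHS]modn_summ; congr (_ %% l)%N; apply: eq_bigr => -[a v] _.
have [av|nav] := boolP [forall i, forall j, (i != j) ==> (v j <= a i)%N].
  apply: (count_fiber _ l_pr ul) => // i j ij.
  by have /forallP/(_ i)/forallP/(_ j)/implyP/(_ ij) := av.
rewrite !eq_card0 // => [e|A]; rewrite !inE.
  by rewrite /exp_triple /= (negPf nav).
rewrite /B /=; apply/negP => /andP[/ideal_tripleP[[s1 s2 s3] _ c12 _ _] _]; case/negP: nav.
have em (e : exps 'I_3) i : (e i <= m)%N by apply: ord_le.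
have H (i j : 'I_3) : (exists y, cross (unitv i ((p ^ a i)%:R : Zq)) y j = (p ^ a i)%:R \/
     cross (unitv i ((p ^ a i)%:R : Zq)) y j = - (p ^ a i)%:R) -> (v j <= a i)%N.
  case=> y yE; have : cross (unitv i (p ^ a i)%:R) y \in boxf v.
    by apply: c12; rewrite unitv_box // inE dvdn_pow_natZ.
  rewrite inE => /forallP/(_ j) => cj; have : ((p ^ a i)%:R : Zq) \in pmult (v j).
    case: yE => yE; rewrite yE in cj => //.
    by rewrite -[X in X \in _]opprK; apply: additive_setN => //; apply: additive_pmult.
  by rewrite inE dvdn_pow_natZ // dvdn_Pexp2l // prime_gt1.
apply/forallP => i; apply/forallP => j; apply/implyP => ij; apply: H.
(* the bracket with e_k, k the third index, moves e_i to e_j up to sign *)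
exists [ffun k => ((k != i) && (k != j))%:R].
by elim/ord3P: i ij; elim/ord3P: j => // _; rewrite !ffunE /=;
  rewrite ?(mulr1, mulr0, mul0r, subr0, sub0r); auto.
Qed.
End Total.

End Ideals.

(** * Roots of unity modulo p^m *)

Lemma pow2_neq1_mod p l k : prime p -> (p %| (2 ^ l).-1)%N -> (0 < k)%N -> coprime k l ->
  (2 ^ k != 1 %[mod p])%N.
Proof.
move=> p_pr pl k0 cop; apply/eqP => k1.
have l1 : (2 ^ l = 1 %[mod p])%N.
  have /prednK <- : (0 < 2 ^ l)%N by rewrite expn_gt0.
  by rewrite -addn1 -modnDml; move: pl; rewrite /dvdn => /eqP->.
have /eqP g1 := cop; have [a b e _] := egcdnP l k0.
have e1 : (2 ^ (a * k) = 1 %[mod p])%N by rewrite mulnC expnM -modnXm k1 modnXm exp1n.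
have e2 : (2 ^ (b * l) = 1 %[mod p])%N by rewrite mulnC expnM -modnXm l1 modnXm exp1n.
move: e1; rewrite e g1 expnD -modnMml e2 modnMml mul1n expn1 => /eqP.
by rewrite eqn_mod_dvd // subn1 /= dvdn1 => /eqP p1; move: p_pr; rewrite p1.
Qed.

(** The order of 2 modulo [p] is [l], and it divides [p - 1]. *)
Lemma dvdn_pred_order2 p l : prime p -> prime l -> (p %| (2 ^ l).-1)%N -> (l %| p.-1)%N.
Proof.
move=> p_pr l_pr pl; apply: contraT; rewrite -prime_coprime // coprime_sym => cop.
have p0 : (0 < p.-1)%N by case: p p_pr {pl cop} => [|[]].
have p2 : coprime p 2.
  rewrite prime_coprime //; apply: contraL pl => p2; have /dvdn_leq := p2 => /(_ isT) le2.
  have -> : p = 2%N by apply/eqP; rewrite eqn_leq le2 prime_gt1.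
  rewrite dvdn2 negbK -[odd _]negbK -oddS prednK ?expn_gt0 // oddX /= orbF.
  by rewrite eqn0Ngt prime_gt0.
have /negP[] := pow2_neq1_mod p_pr pl p0 cop.
have e : (2 * 2 ^ p.-1 == 2 * 1 %[mod p])%N.
  by rewrite -expnS prednK ?prime_gt0 // muln1; apply/eqP/fermat_little.
by move: e; rewrite !eqn_mod_dvd ?leq_mul ?expn_gt0 // -mulnBr Gauss_dvdr.
Qed.

(** The element is [2^(p^(m-1))]: it has order [l] because [x = 1 mod p] implies
    [x^(p^j) = 1 mod p^(j+1)], and it is congruent to 2 modulo [p], where 2 has order [l]. *)
Lemma torus_generator p m l : prime p -> (0 < m)%N -> prime l -> (p %| (2 ^ l).-1)%N ->
  exists u : 'Z_(p ^ m), u ^+ l = 1 /\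
    forall k, (0 < k < l)%N -> u ^+ k - 1 \is a GRing.unit.
Proof.
move=> p_pr m_gt0 l_pr pl.
have ord2 k : (0 < k < l)%N -> (2 ^ k != 1 %[mod p])%N.
  move=> /andP[k0 kl]; apply: (pow2_neq1_mod p_pr pl k0).
  by rewrite coprime_sym prime_coprime // gtnNdvd.
pose P := (p ^ m.-1)%N; exists (2%:R ^+ P); split.
  have Pm j x : (0 < x)%N -> (p %| x.-1)%N -> (p ^ j.+1 %| (x ^ (p ^ j)).-1)%N.
    move=> x0 px; elim: j => [|j IH]; first by rewrite expn0 !expn1.
    rewrite [(p ^ j.+1)%N in X in (_ %| X)%N]expnSr expnM predn_exp expnSr dvdn_mul //.
    set y := (x ^ _)%N in IH *.
    have y1 : (y = 1 %[mod p])%N.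
      have /prednK <- : (0 < y)%N by rewrite expn_gt0 x0.
      have /eqP py : (p %| y.-1)%N by apply: dvdn_trans IH; rewrite expnS dvdn_mulr.
      by rewrite -add1n -modnDmr py addn0.
    rewrite /dvdn -modn_summ (eq_bigr (fun _ => 1 %% p)%N) => [|i _].
      by rewrite modn_summ sum1_card card_ord modnn.
    by rewrite -modnXm y1 modnXm exp1n.
  have := Pm m.-1 _ _ pl; rewrite expn_gt0 prednK // => /(_ isT) dvd.
  rewrite exprAC -natrX -natrX -/P.
  have /prednK <- : (0 < (2 ^ l) ^ P)%N by rewrite !expn_gt0.
  rewrite -[_.+1]addn1 natrD -[X in _ = X]add0r; congr (_ + _).
  have q_gt1 : (1 < p ^ m)%N by rewrite -(exp1n m) ltn_exp2r // prime_gt1.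
  by apply/val_inj; rewrite /= val_Zp_nat //; apply/eqP.
move=> k kl; have X0 n : (0 < 2 ^ n)%N by rewrite expn_gt0.
rewrite -natrX -natrX -expnM -(prednK (X0 _)) -[_.+1]addn1 natrD addrK unit_natZ //.
apply: contra (ord2 k kl) => dvd; apply/eqP.
have -> : (2 ^ k = 2 ^ (P * k) %[mod p])%N.
  rewrite /P; elim: m.-1 => [|j IH]; first by rewrite mul1n.
  have -> : (p ^ j.+1 * k = p ^ j * k * p)%N by rewrite expnSr mulnAC.
  by rewrite IH (expnM 2 (p ^ j * k)) fermat_little.
rewrite -(prednK (X0 (P * k)%N)) -[X in (X = _ %[mod _])%N]addn1 -modnDml.
by move/eqP: dvd => ->.
Qed.

(** * Truncated geometric series and sums over cones *)

Section Trunc.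
Variable m : nat.
(** Equality modulo [X^(m+1)]: polynomials modulo [X^(m+1)] for all [m] stand for power
    series. *)
Definition eqm (P Q : {poly int}) := forall n, (n <= m)%N -> P`_n = Q`_n.

Lemma eqm_sym P Q : eqm P Q -> eqm Q P. Proof. by move=> h n /h. Qed.
Lemma eqm_trans P Q T : eqm P Q -> eqm Q T -> eqm P T.
Proof. by move=> h1 h2 n nm; rewrite h1 ?h2. Qed.
Lemma eqmD P P' Q Q' : eqm P P' -> eqm Q Q' -> eqm (P + Q) (P' + Q').
Proof. by move=> h1 h2 n nm; rewrite !coefD h1 ?h2. Qed.
Lemma eqmM P P' Q Q' : eqm P P' -> eqm Q Q' -> eqm (P * Q) (P' * Q').
Proof.
move=> h1 h2 n nm; rewrite !coefM; apply: eq_bigr => i _.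
by rewrite h1 ?h2 //; [apply: leq_trans (leq_subr _ _) nm|rewrite (leq_trans _ nm) // -ltnS].
Qed.
Lemma eqmMl P Q Q' : eqm Q Q' -> eqm (P * Q) (P * Q').
Proof. exact: eqmM. Qed.
Lemma eqmMr P P' Q : eqm P P' -> eqm (P * Q) (P' * Q).
Proof. by move=> h; apply: eqmM. Qed.
Lemma eqm_sum (I : finType) (C : pred I) (P Q : I -> {poly int}) :
  (forall i, C i -> eqm (P i) (Q i)) -> eqm (\sum_(i | C i) P i) (\sum_(i | C i) Q i).
Proof. by move=> h n nm; rewrite !coef_sum; apply: eq_bigr => i ci; apply: h. Qed.
Lemma eqm_prod (I : finType) (C : pred I) (P Q : I -> {poly int}) :
  (forall i, C i -> eqm (P i) (Q i)) -> eqm (\prod_(i | C i) P i) (\prod_(i | C i) Q i).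
Proof.
move=> h; apply: (big_ind2 (fun A B => eqm A B)) => //.
by move=> *; apply: eqmM.
Qed.
Lemma eqm_Xn k P : (m < k)%N -> eqm ('X^k * P) 0.
Proof. by move=> mk n nm; rewrite coefXnM coef0 ifT // (leq_ltn_trans nm). Qed.

Definition geom k : {poly int} := \sum_(t < m.+1) 'X^(k * t).

Lemma geomE k : (0 < k)%N -> eqm ((1 - 'X^k) * geom k) 1.
Proof.
move=> k0; rewrite /geom (eq_bigr (fun t : 'I_m.+1 => 1 ^+ (m.+1.-1 - t) * ('X^k) ^+ t)).
  rewrite -subrXX expr1n -exprM => n nm; rewrite coefB coef1 coefXn.
  suff /negPf-> : n != (k * m.+1)%N by rewrite subr0.
  by rewrite neq_ltn (leq_trans (_ : n < m.+1)%N) // leq_pmull.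
by move=> t _; rewrite expr1n mul1r exprM.
Qed.

Lemma tail_geom k t : (0 < k)%N ->
  eqm (\sum_(a < m.+1 | (t <= a)%N) 'X^(k * a)) ('X^(k * t) * geom k).
Proof.
move=> k0; have ge a : (a <= k * a)%N by rewrite leq_pmull.
have [mt|tm] := ltnP m t.
  rewrite big_pred0 => [|a]; last by apply/negbTE; rewrite -ltnNge (leq_trans (ltn_ord a)).
  by apply/eqm_sym/eqm_Xn; apply: leq_trans (ge t).
have -> : 'X^(k * t) * geom k = \sum_(0 + t <= a < t + m.+1) 'X^(k * a).
  rewrite big_addn addKn big_mkord mulr_sumr.
  by apply: eq_bigr => i _; rewrite -exprD -mulnDr addnC.
rewrite add0n (big_cat_nat (n := m.+1)) ?leq_addl //=; last exact: leqW.
have -> : \sum_(a < m.+1 | (t <= a)%N) 'X^(k * a) = \sum_(t <= a < m.+1) 'X^(k * a) :> {poly int}.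
  by rewrite big_geq_mkord.
move=> n nm; rewrite coefD [X in _ = _ + X](_ : _ = 0) ?addr0 // coef_sum big_nat big1 // => a /andP[ma _].
by rewrite coefXn; case: eqP => // na; have := ge a; lia.
Qed.
End Trunc.

Lemma eqm_eq (P Q : {poly int}) : (forall m, eqm m P Q) -> P = Q.
Proof. by move=> h; apply/polyP => n; apply: (h n). Qed.

Section ChamberSum.
Variable m : nat.
Local Notation I := 'I_m.+1.

Lemma sum_ffun3 (V : nmodType) (G : I -> I -> I -> V) :
  \sum_(v : {ffun 'I_3 -> I}) G (v 0) (v 1) (v 2%:R) = \sum_x \sum_y \sum_z G x y z.
Proof.
rewrite pair_big pair_big /=.
pose h (xyz : I * I * I) : {ffun 'I_3 -> I} :=
  [ffun i : 'I_3 => if i == 0 then xyz.1.1 else if i == 1 then xyz.1.2 else xyz.2].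
rewrite (reindex h); last first.
  exists (fun v : {ffun 'I_3 -> I} => (v 0, v 1, v 2%:R)) => [[[x y] z] _|v _]; first by rewrite !ffunE.
  by apply/ffunP; elim/ord3P; rewrite ffunE.
by apply: eq_bigr => -[[x y] z] _; rewrite !ffunE.
Qed.

(** The six orderings of [(x, y, z)] are transported to the chamber [c <= b <= a].  To count
    the points on the walls once, the inequalities are strict at some walls: of the six
    orderings, one has none strict, two have the first, two the second and one has both. *)
Lemma sum_chambers (G : nat -> nat -> nat -> {poly int}) (s : nat -> nat -> nat -> {poly int}) :
  (forall x y z, (y <= x)%N -> (z <= y)%N ->
    [/\ G x y z = s x y z, G x z y = s x y z, G y x z = s x y z &
     [/\ G y z x = s x y z, G z x y = s x y z & G z y x = s x y z]]) ->
  \sum_(x : I) \sum_(y : I) \sum_(z : I) G x y z =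
  \sum_(c : I) \sum_(b : I) \sum_(a : I)
    (((c <= b) && (b <= a))%N%:R + ((c < b) && (b <= a))%N%:R *+ 2 +
     ((c <= b) && (b < a))%N%:R *+ 2 + ((c < b) && (b < a))%N%:R) * s a b c.
Proof.
move=> Gs.
transitivity (\sum_(x : I) \sum_(y : I) \sum_(z : I) (
   ((z <= y) && (y <= x))%N%:R * s x y z + ((y < z) && (z <= x))%N%:R * s x z y +
   (((z <= x) && (x < y))%N%:R * s y x z + ((x < z) && (z <= y))%N%:R * s y z x) +
   (((y <= x) && (x < z))%N%:R * s z x y + ((x < y) && (y < z))%N%:R * s z y x))).
  apply: eq_bigr => x _; apply: eq_bigr => y _; apply: eq_bigr => z _.
  case e1: ((z <= y) && (y <= x))%N; case e2: ((y < z) && (z <= x))%N;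
  case e3: ((z <= x) && (x < y))%N; case e4: ((x < z) && (z <= y))%N;
  case e5: ((y <= x) && (x < z))%N; case e6: ((x < y) && (y < z))%N;
  try (exfalso; clear Gs; lia); rewrite ?mul1r ?mul0r ?add0r ?addr0.
  - by case/andP: e1 => h1 h2; case: (Gs x y z h2 h1).
  - by case/andP: e2 => h1 h2; case: (Gs x z y h2 (ltnW h1)).
  - by case/andP: e3 => h1 h2; case: (Gs y x z (ltnW h2) h1).
  - by case/andP: e4 => h1 h2; case: (Gs y z x h2 (ltnW h1)) => _ _ _ [].
  - by case/andP: e5 => h1 h2; case: (Gs z x y (ltnW h2) h1) => _ _ _ [].
  - by case/andP: e6 => h1 h2; case: (Gs z y x (ltnW h2) (ltnW h1)) => _ _ _ [].
pose T (H : I -> I -> I -> {poly int}) := \sum_x \sum_y \sum_z H x y z.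
have sw12 H : T H = T (fun x y z => H y x z) by exact: exchange_big.
have sw23 H : T H = T (fun x y z => H x z y) by apply: eq_bigr => x _; apply: exchange_big.
have sw13 H : T H = T (fun x y z => H z y x) by rewrite sw12 sw23 sw12.
pose b1 c b a : {poly int} := ((c <= b) && (b <= a))%N%:R * s a b c.
pose b2 c b a : {poly int} := ((c < b) && (b <= a))%N%:R * s a b c.
pose b3 c b a : {poly int} := ((c <= b) && (b < a))%N%:R * s a b c.
pose b4 c b a : {poly int} := ((c < b) && (b < a))%N%:R * s a b c.
transitivity (T (fun x y z => b1 z y x) + T (fun x y z => b2 y z x) +
  (T (fun x y z => b3 z x y) + T (fun x y z => b2 x z y)) +
  (T (fun x y z => b3 y x z) + T (fun x y z => b4 x y z))).
  rewrite /T -!big_split; apply: eq_bigr => x _; rewrite -!big_split; apply: eq_bigr => y _.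
  by rewrite -!big_split; apply: eq_bigr => z _; rewrite /b1 /b2 /b3 /b4 /=.
have e1 : T (fun x y z => b1 z y x) = T (fun x y z => b1 x y z) by exact: sw13.
have e2 : T (fun x y z => b2 y z x) = T (fun x y z => b2 x y z).
  by apply: etrans (sw12 _) _; exact: (sw23 (fun x y z => b2 x z y)).
have e3 : T (fun x y z => b3 z x y) = T (fun x y z => b3 x y z).
  by apply: etrans (sw23 _) _; exact: (sw12 (fun x y z => b3 y x z)).
have e4 : T (fun x y z => b2 x z y) = T (fun x y z => b2 x y z) by exact: sw23.
have e5 : T (fun x y z => b3 y x z) = T (fun x y z => b3 x y z) by exact: sw12.
rewrite e1 e2 e3 e4 e5 /T -!big_split; apply: eq_bigr => x _; rewrite -!big_split.
apply: eq_bigr => y _; rewrite -!big_split; apply: eq_bigr => z _.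
by rewrite /b1 /b2 /b3 /b4 /=; ring.
Qed.

(** The cone [c <= b <= a] is generated by [(1,0,0)], [(1,1,0)], [(1,1,1)]; with [d = 1]
    or [e = 1] the corresponding inequality is strict. *)
Lemma cone_sum (al be ga d e : nat) : (0 < al)%N -> (0 < ga)%N ->
  eqm m (\sum_(c : I) \sum_(b : I) \sum_(a : I)
     ((c + e <= b) && (b + d <= a))%N%:R * 'X^(al * a + be * b + ga * c))
    ('X^(al * d + (al + be) * e) * geom m al * geom m (al + be) * geom m (al + be + ga)).
Proof.
move=> al0 ga0.
have step1 (c : I) : eqm m (\sum_(b : I) \sum_(a : I)
    ((c + e <= b) && (b + d <= a))%N%:R * 'X^(al * a + be * b + ga * c))
   (\sum_(b : I | (c + e <= b)%N) 'X^((al + be) * b) * ('X^(ga * c + al * d) * geom m al)).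
  rewrite [X in eqm _ _ X]big_mkcond; apply: eqm_sum => b _; case: ifP => [cb|_]; last first.
    by rewrite big1 // => a _; rewrite mul0r.
  apply: eqm_trans (_ : eqm _ _ ('X^(be * b + ga * c) * ('X^(al * (b + d)) * geom m al))) _.
    have -> : \sum_(a : I) (true && (b + d <= a))%N%:R * 'X^(al * a + be * b + ga * c) =
       'X^(be * b + ga * c) * \sum_(a < m.+1 | (b + d <= a)%N) 'X^(al * a) :> {poly int}.
      rewrite mulr_sumr [RHS]big_mkcond; apply: eq_bigr => a _ /=.
      by case: ifP => _; rewrite ?mul0r // mul1r -exprD; congr 'X^_; lia.
    exact/eqmMl/tail_geom.
  rewrite !mulrA -!exprD (_ : be * b + ga * c + al * (b + d) = (al + be) * b + (ga * c + al * d))%N //.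
  by lia.
apply: eqm_trans (eqm_sum (fun c _ => step1 c)) _.
apply: eqm_trans (_ : eqm _ _ (\sum_(c : I) 'X^((al + be) * (c + e)) * geom m (al + be) *
   ('X^(ga * c + al * d) * geom m al))) _.
  apply: eqm_sum => c _; rewrite -mulr_suml; apply/eqmMr/tail_geom.
  by rewrite addn_gt0 al0.
suff -> : \sum_(c : I) 'X^((al + be) * (c + e)) * geom m (al + be) * ('X^(ga * c + al * d) * geom m al)
  = 'X^(al * d + (al + be) * e) * geom m al * geom m (al + be) * geom m (al + be + ga) by [].
rewrite [X in _ * X]/geom mulr_sumr; apply: eq_bigr => c _.
rewrite (_ : (al + be) * (c + e) = (al + be) * c + (al + be) * e)%N; last by lia.
rewrite (_ : (al + be + ga) * c = (al + be) * c + ga * c)%N; last by lia.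
rewrite !exprD; ring.
Qed.
End ChamberSum.

(** * The generating polynomial of exponent triples *)

Lemma prod3 (R : comNzRingType) (F : 'I_3 -> R) : \prod_i F i = F 0 * F 1 * F 2%:R.
Proof.
rewrite !big_ord_recl big_ord0 mulr1 mulrA; congr (F _ * F _ * F _); exact: val_inj.
Qed.

Definition coef2 (i : nat) : int := nth 0 [:: 1; -2; 1] i.
Definition coef3 (i : nat) : int := nth 0 [:: 1; -3; 3; -1] i.

Lemma expand2 (y : {poly int}) : (1 - y) ^+ 2 = \sum_(i < 3) (coef2 i)%:P * y ^+ i.
Proof.
rewrite !big_ord_recl big_ord0 /coef2 /= /bump /= !(polyCN, polyCMn, polyC1) -?polyC_natr; ring.
Qed.
Lemma expand3 (y : {poly int}) : (1 - y) ^+ 3 = \sum_(i < 4) (coef3 i)%:P * y ^+ i.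
Proof.
rewrite !big_ord_recl big_ord0 /coef3 /= /bump /= !(polyCN, polyCMn, polyC1); ring.
Qed.

Lemma other3 (i j : 'I_3) : i != j -> (j == i + 1) || (j == i + 2%:R).
Proof. by elim/ord3P: i; elim/ord3P: j. Qed.

Section GeneratingPolynomial.
Variable m : nat.
Local Notation I := 'I_m.+1.
Local Notation exps T := {ffun T -> I}.
Local Notation eqm := (eqm m).
Local Notation geom := (geom m).

Definition exp_poly : {poly int} :=
  \sum_(x : exps 'I_3 * exps 'I_3 * exps ('I_3 * 'I_3)%type |
     [forall i, forall j, (i != j) ==> (x.1.2 j <= x.1.1 i)%N] &&
     [forall ij, x.2 ij <= top_exp x.1.2 ij]%N)
  'X^(\sum_i x.1.1 i + \sum_i x.1.2 i + \sum_ij x.2 ij)%N.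

Lemma coef_exp_poly n : exp_poly`_n = #|[set x : exps 'I_3 * exps 'I_3 * _ | exp_triple n x]|%:R.
Proof.
rewrite /exp_poly coef_sum -sum1dep_card natr_sum big_mkcond [RHS]big_mkcond.
apply: eq_bigr => x _; rewrite coefXn /exp_triple andbA eq_sym.
by case: (_ && _) => //=; case: eqP.
Qed.

Lemma le_I (i : I) : (i <= m)%N. Proof. by rewrite -ltnS. Qed.

Definition lowest (v : exps 'I_3) (i : 'I_3) : nat := maxn (v (i + 1)) (v (i + 2%:R)).

(** For a given [v] the coordinates of [a] and of [e] vary independently. *)
Lemma exp_poly_sum : exp_poly = \sum_(v : exps 'I_3) 'X^(\sum_i v i)%N *
  (\prod_i \sum_(a : I | (lowest v i <= a)%N) 'X^a) *
  (\prod_ij \sum_(e : I | (e <= top_exp v ij)%N) 'X^e).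
Proof.
have prodX (T : finType) (e : exps T) : \prod_i 'X^(e i) = 'X^(\sum_i e i)%N :> {poly int}.
  by rewrite (big_morph (fun k => 'X^k) (@exprD _ 'X) (expr0 _)).
transitivity (\sum_(v : exps 'I_3) \sum_(a : exps 'I_3 | [forall i, lowest v i <= a i]%N)
   \sum_(e : exps ('I_3 * 'I_3)%type | [forall ij, e ij <= top_exp v ij]%N)
    ('X^(\sum_i v i)%N * 'X^(\sum_i a i)%N * 'X^(\sum_ij e ij)%N) : {poly int}).
  rewrite pair_big_dep pair_big_dep /=.
  rewrite [RHS](reindex (fun x : exps 'I_3 * exps 'I_3 * exps ('I_3 * 'I_3)%type =>
     (x.1.2, x.1.1, x.2))); last first.
    by exists (fun x => (x.1.2, x.1.1, x.2)) => -[[a v] e] _.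
  apply: eq_big => [[[a v] e]|[[a v] e] _] /=; last by rewrite -!exprD (addnC (\sum_i v i)%N).
  congr (_ && _); apply: eq_forallb => i; rewrite /lowest geq_max.
  apply/forallP/andP => [av|[av1 av2] j].
    by split; [move/implyP: (av (i + 1))|move/implyP: (av (i + 2%:R))]; apply; elim/ord3P: (i).
  by apply/implyP => /other3/orP[] /eqP->.
apply: eq_bigr => v _.
have -> : \prod_i \sum_(a : I | (lowest v i <= a)%N) 'X^a =
    \sum_(a : exps 'I_3 | [forall i, lowest v i <= a i]%N) 'X^(\sum_i a i)%N :> {poly int}.
  by rewrite bigA_distr_big_dep; apply: eq_big => [a|a _]; rewrite ?prodX.
have -> : \prod_ij \sum_(e : I | (e <= top_exp v ij)%N) 'X^e =
    \sum_(e : exps ('I_3 * 'I_3)%type | [forall ij, e ij <= top_exp v ij]%N) 'X^(\sum_ij e ij)%N :> {poly int}.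
  by rewrite bigA_distr_big_dep; apply: eq_big => [a|a _]; rewrite ?prodX.
rewrite -mulrA mulr_suml mulr_sumr; apply: eq_bigr => a _.
by rewrite !mulr_sumr; apply: eq_bigr => e _; rewrite mulrA.
Qed.

(** The summand of a vector with entries [a >= b >= c], up to the factor [(1 - X)^-11]: by
    [top_exp] the truncations are at [a] twice, at [b] and at [c] three times, and the lower
    bounds for the exponents of [A1] are [b], [a], [a]. *)
Definition sorted_term a b c : {poly int} :=
  'X^(3 * a + 2 * b + c) * (1 - 'X^(a.+1)) ^+ 2 * (1 - 'X^(b.+1)) ^+ 3 * (1 - 'X^(c.+1)) ^+ 3.
Definition sym_term x y z : {poly int} :=
  let a := maxn x (maxn y z) in let c := minn x (minn y z) in
  sorted_term a (x + y + z - a - c) c.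

Lemma interval_geom k : (k <= m)%N ->
  (1 - 'X) * (\sum_(e : I | (e <= k)%N) 'X^e) = 1 - 'X^(k.+1) :> {poly int}.
Proof.
move=> km; rewrite -{2}(expr1n _ k.+1) subrXX -(@big_ord_widen _ _ _ k.+1 m.+1 (fun e => 'X^e)) //=.
by congr (_ * _); apply: eq_bigr => i _; rewrite expr1n mul1r.
Qed.

(** The nine intervals [0, top_exp v ij] contribute [(1 - X^(k+1)) / (1 - X)]; one of the nine
    is reduced to 0, and its factor [1 - X] cancels. *)
Lemma top_prod (v : exps 'I_3) (a b c : nat) :
  a = maxn (v 0%R) (maxn (v 1%R) (v 2%:R%R)) -> c = minn (v 0%R) (minn (v 1%R) (v 2%:R%R)) ->
  b = (v 0%R + v 1%R + v 2%:R%R - a - c)%N ->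
  (1 - 'X) ^+ 8 * (\prod_ij \sum_(e : I | (e <= top_exp v ij)%N) 'X^e) =
  (1 - 'X^(a.+1)) ^+ 2 * (1 - 'X^(b.+1)) ^+ 3 * (1 - 'X^(c.+1)) ^+ 3 :> {poly int}.
Proof.
set x := nat_of_ord (v 0); set y := nat_of_ord (v 1); set z := nat_of_ord (v 2%:R) => aE cE bE.
have X1 : 1 - 'X != 0 :> {poly int}.
  by rewrite -[_ - _]opprB oppr_eq0 -size_poly_eq0 size_XsubC.
apply: (mulfI X1); rewrite mulrA -exprS.
have -> : (1 - 'X) ^+ 9 * (\prod_ij \sum_(e : I | (e <= top_exp v ij)%N) 'X^e) =
    \prod_ij (1 - 'X^((top_exp v ij).+1)) :> {poly int}.
  have <- : \prod_(ij : 'I_3 * 'I_3) (1 - 'X) = (1 - 'X) ^+ 9 :> {poly int}.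
    by rewrite prodr_const card_prod !card_ord.
  rewrite -big_split; apply: eq_bigr => ij _; apply: interval_geom.
  by rewrite /top_exp; case: ifP => // _; apply: le_I.
rewrite -(pair_bigA _ (fun i j => 1 - 'X^((top_exp v (i, j)).+1))) /= prod3 !prod3 /top_exp /=.
have := argmax3_le v 0; have := argmax3_le v 1; have := argmax3_le v 2%:R.
elim/ord3P: (argmax3 v) => /=; rewrite expr1 -/x -/y -/z => h2 h1 h0.
- have -> : a = x by lia.
  have [yz|zy] := leqP y z.
    by rewrite (_ : b = z) 1?(_ : c = y); [ring|lia|lia].
  by rewrite (_ : b = y) 1?(_ : c = z); [ring|lia|lia].
- have -> : a = y by lia.
  have [yz|zy] := leqP x z.
    by rewrite (_ : b = z) 1?(_ : c = x); [ring|lia|lia].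
  by rewrite (_ : b = x) 1?(_ : c = z); [ring|lia|lia].
- have -> : a = z by lia.
  have [yz|zy] := leqP x y.
    by rewrite (_ : b = y) 1?(_ : c = x); [ring|lia|lia].
  by rewrite (_ : b = x) 1?(_ : c = y); [ring|lia|lia].
Qed.

Lemma low_prod (v : exps 'I_3) :
  eqm ((1 - 'X) ^+ 3 * (\prod_i \sum_(a : I | (lowest v i <= a)%N) 'X^a))
      'X^(\sum_i lowest v i)%N.
Proof.
apply: eqm_trans (_ : eqm _ ((1 - 'X) ^+ 3 * \prod_i ('X^(1 * lowest v i) * geom 1))) _.
  apply/eqmMl/eqm_prod => i _.
  rewrite (eq_bigr (fun a : I => 'X^(1 * a))) => [|a _]; last by rewrite mul1n.
  exact: tail_geom.
have -> : (1 - 'X) ^+ 3 * \prod_i ('X^(1 * lowest v i) * geom 1) =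
   'X^(\sum_i lowest v i)%N * ((1 - 'X^1) * geom 1 * ((1 - 'X^1) * geom 1) * ((1 - 'X^1) * geom 1)).
  by rewrite prod3 sum3 !mul1n !exprD expr1; ring.
have e1 := @geomE m 1 (isT : (0 < 1)%N).
by have := eqmMl 'X^(\sum_i lowest v i)%N (eqmM (eqmM e1 e1) e1); rewrite !mulr1.
Qed.

Lemma exp_poly_sym :
  eqm ((1 - 'X) ^+ 11 * exp_poly) (\sum_(v : exps 'I_3) sym_term (v 0) (v 1) (v 2%:R)).
Proof.
rewrite exp_poly_sum mulr_sumr; apply: eqm_sum => v _.
set P := \prod_i _; set Q := \prod_ij _.
have -> : (1 - 'X) ^+ 11 * ('X^(\sum_i v i)%N * P * Q) =
  ((1 - 'X) ^+ 3 * P) * ('X^(\sum_i v i)%N * ((1 - 'X) ^+ 8 * Q)) by ring.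
apply: eqm_trans (eqmMr _ (low_prod v)) _.
pose a := maxn (v 0%R) (maxn (v 1%R) (v 2%:R%R)).
pose c := minn (v 0%R) (minn (v 1%R) (v 2%:R%R)).
pose b := (v 0%R + v 1%R + v 2%:R%R - a - c)%N.
have -> : sym_term (v 0) (v 1) (v 2%:R) = sorted_term a b c by [].
rewrite (@top_prod v a b c) // mulrA -exprD.
have -> : (\sum_i lowest v i + \sum_i v i = 3 * a + 2 * b + c)%N; last by rewrite /sorted_term !mulrA.
rewrite !sum3 /lowest !(add0r, ord3D).
by rewrite /b /a /c; move: (nat_of_ord (v 0)) (nat_of_ord (v 1)) (nat_of_ord (v 2%:R)) => x y z; lia.
Qed.

Lemma sorted_term_expand a b c : sorted_term a b c =
  \sum_(i < 3) \sum_(j < 4) \sum_(k < 4)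
    (coef2 i)%:P * (coef3 j)%:P * (coef3 k)%:P * 'X^(i + j + k) *
    'X^((3 + i) * a + (2 + j) * b + (1 + k) * c).
Proof.
have dist (A : 'I_3 -> {poly int}) (B C : 'I_4 -> {poly int}) :
    (\sum_i A i) * (\sum_j B j) * (\sum_k C k) = \sum_i \sum_j \sum_k A i * B j * C k.
  rewrite !mulr_suml; apply: eq_bigr => i _; rewrite [A i * _]mulr_sumr mulr_suml.
  by apply: eq_bigr => j _; rewrite mulr_sumr.
have -> : sorted_term a b c = 'X^(3 * a + 2 * b + c) *
    ((1 - 'X^(a.+1)) ^+ 2 * (1 - 'X^(b.+1)) ^+ 3 * (1 - 'X^(c.+1)) ^+ 3) by rewrite /sorted_term !mulrA.
rewrite expand2 !expand3 dist mulr_sumr.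
apply: eq_bigr => i _; rewrite mulr_sumr; apply: eq_bigr => j _.
rewrite mulr_sumr; apply: eq_bigr => k _.
rewrite -!exprM; set x := 'X.
rewrite (_ : (3 + i) * a + (2 + j) * b + (1 + k) * c =
  3 * a + 2 * b + c + (i * a + j * b + k * c))%N; last by lia.
have e (d n : nat) : (d.+1 * n = n * d + n)%N by rewrite mulSn addnC mulnC.
rewrite !e !(exprD x).
by move: (x ^+ _) (x ^+ _) (x ^+ _) (x ^+ _) (x ^+ _) (x ^+ _) (x ^+ _) (x ^+ _) => *; ring.
Qed.

Lemma sum_exchange33 (M : nat -> nat -> nat -> {poly int}) (K : nat -> nat -> nat -> {poly int})
    (X : nat -> nat -> nat -> nat -> nat -> nat -> {poly int}) :
  \sum_(c : I) \sum_(b : I) \sum_(a : I) M c b a *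
     (\sum_(i < 3) \sum_(j < 4) \sum_(k < 4) K i j k * X i j k a b c) =
  \sum_(i < 3) \sum_(j < 4) \sum_(k < 4) K i j k *
     (\sum_(c : I) \sum_(b : I) \sum_(a : I) M c b a * X i j k a b c).
Proof.
have exch (F : I -> 'I_3 -> 'I_4 -> 'I_4 -> {poly int}) :
    \sum_a \sum_i \sum_j \sum_k F a i j k = \sum_i \sum_j \sum_k \sum_a F a i j k.
  rewrite exchange_big; apply: eq_bigr => i _; rewrite exchange_big.
  by apply: eq_bigr => j _; rewrite exchange_big.
transitivity (\sum_(c : I) \sum_(i < 3) \sum_(j < 4) \sum_(k < 4)
   (\sum_(b : I) \sum_(a : I) M c b a * (K i j k * X i j k a b c))).
  apply: eq_bigr => c _.
  rewrite -(exch (fun b i j k => \sum_(a : I) M c b a * (K i j k * X i j k a b c))).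
  apply: eq_bigr => b _; rewrite -(exch (fun a i j k => M c b a * (K i j k * X i j k a b c))).
  apply: eq_bigr => a _; rewrite mulr_sumr; apply: eq_bigr => i _; rewrite mulr_sumr.
  by apply: eq_bigr => j _; rewrite mulr_sumr.
rewrite exch; apply: eq_bigr => i _; apply: eq_bigr => j _; apply: eq_bigr => k _.
rewrite mulr_sumr; apply: eq_bigr => c _; rewrite mulr_sumr; apply: eq_bigr => b _.
by rewrite mulr_sumr; apply: eq_bigr => a _; rewrite mulrCA.
Qed.

Definition cone_coef i j k : {poly int} :=
  (coef2 i)%:P * (coef3 j)%:P * (coef3 k)%:P * 'X^(i + j + k).
(** The four terms are the orderings with no, the first, the second and both inequalities
    strict, with their multiplicities 1, 2, 2, 1; see [sum_chambers]. *)
Definition cone_num i j k : {poly int} :=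
  cone_coef i j k * (1 + 'X^(5 + i + j) *+ 2 + 'X^(3 + i) *+ 2 + 'X^(8 + i + i + j)).

(** After expansion of the powers, each monomial of [sorted_term] is summed over the chambers
    by [cone_sum]. *)
Lemma exp_poly_geom :
  eqm ((1 - 'X) ^+ 11 * exp_poly)
   (\sum_(i < 3) \sum_(j < 4) \sum_(k < 4)
      cone_num i j k * (geom (3 + i) * geom (5 + i + j) * geom (6 + i + j + k))).
Proof.
apply: eqm_trans exp_poly_sym _.
rewrite (sum_ffun3 (fun x y z : I => sym_term x y z)) (@sum_chambers m sym_term sorted_term); last first.
  by move=> x y z xy yz; split; [| | |split]; rewrite /sym_term /=; congr sorted_term; lia.
pose W c b a : {poly int} := ((c <= b) && (b <= a))%N%:R + ((c < b) && (b <= a))%N%:R *+ 2 +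
     ((c <= b) && (b < a))%N%:R *+ 2 + ((c < b) && (b < a))%N%:R.
rewrite (eq_bigr (fun c : I => \sum_(b : I) \sum_(a : I) W c b a *
   (\sum_(i < 3) \sum_(j < 4) \sum_(k < 4) cone_coef i j k *
      'X^((3 + i) * a + (2 + j) * b + (1 + k) * c)))); last first.
  move=> c _; apply: eq_bigr => b _; apply: eq_bigr => a _.
  by rewrite sorted_term_expand.
rewrite (sum_exchange33 W cone_coef (fun i j k a b c => 'X^((3 + i) * a + (2 + j) * b + (1 + k) * c))).
apply: eqm_sum => i _; apply: eqm_sum => j _; apply: eqm_sum => k _.
rewrite /cone_num -[X in eqm _ X]mulrA; apply: eqmMl.
pose cone d e : {poly int} := \sum_(c : I) \sum_(b : I) \sum_(a : I)
     ((c + e <= b) && (b + d <= a))%N%:R * 'X^((3 + i) * a + (2 + j) * b + (1 + k) * c).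
have -> : \sum_(c : I) \sum_(b : I) \sum_(a : I) W c b a * 'X^((3 + i) * a + (2 + j) * b + (1 + k) * c)
   = cone 0%N 0%N + cone 0%N 1%N *+ 2 + cone 1%N 0%N *+ 2 + cone 1%N 1%N.
  rewrite /cone -!sumrMnl -!big_split; apply: eq_bigr => c _ /=.
  rewrite -!sumrMnl -!big_split; apply: eq_bigr => b _ /=.
  rewrite -!sumrMnl -!big_split; apply: eq_bigr => a _ /=.
  by rewrite /W !addn0 !addn1 !mulrDl !mulrnAl.
have cE d e : eqm (cone d e)
   ('X^((3 + i) * d + (5 + i + j) * e) * (geom (3 + i) * geom (5 + i + j) * geom (6 + i + j + k))).
  have /= := @cone_sum m (3 + i) (2 + j) (1 + k) d e isT isT.
  rewrite (_ : 3 + i + (2 + j) = 5 + i + j)%N; last by lia.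
  rewrite (_ : 5 + i + j + (1 + k) = 6 + i + j + k)%N; last by lia.
  by rewrite -!mulrA.
move: cE; set g := geom _ * _ * _ => cE.
have -> : (1 + 'X^(5 + i + j) *+ 2 + 'X^(3 + i) *+ 2 + 'X^(8 + i + i + j)) * g =
  'X^((3 + i) * 0 + (5 + i + j) * 0) * g + ('X^((3 + i) * 0 + (5 + i + j) * 1) * g) * 2%:R +
  'X^((3 + i) * 1 + (5 + i + j) * 0) * g * 2%:R + 'X^((3 + i) * 1 + (5 + i + j) * 1) * g.
  rewrite !muln0 !muln1 !addn0 !add0n expr0.
  rewrite (_ : 8 + i + i + j = 3 + i + (5 + i + j))%N; last by lia.
  rewrite (exprD _ (3 + i)%N); move: ('X^(3 + i)) ('X^(5 + i + j)) => y z; ring.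
rewrite -![cone _ _ *+ 2]mulr_natr.
by apply: eqmD (eqmD (eqmD _ _) _) _; rewrite ?mulr1; do ?apply: eqmMr; apply: cE.
Qed.

End GeneratingPolynomial.

(** * Verification of the closed form *)

Section Verification.
Local Notation Z := BinNums.Z.
Local Notation Z0 := BinNums.Z0.
Local Notation Zpos := BinNums.Zpos.
Local Notation Zneg := BinNums.Zneg.
Local Notation xH := BinNums.xH.
Local Notation xO := BinNums.xO.
Local Notation xI := BinNums.xI.

(** Polynomials as lists of binary integers, for computation. *)
Definition toP (s : seq Z) : {poly int} := Poly (map int_of_Z s).

Fixpoint ladd (s t : seq Z) : seq Z :=
  match s, t with
  | [::], _ => t
  | _, [::] => s
  | a :: s', b :: t' => BinInt.Z.add a b :: ladd s' t'
  end.
Definition lscale a (s : seq Z) := map (BinInt.Z.mul a) s.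
Fixpoint lmul (s t : seq Z) : seq Z :=
  if s is a :: s' then ladd (lscale a t) (Z0 :: lmul s' t) else [::].
Definition lXn k : seq Z := ncons k Z0 [:: Zpos xH].
(** The list of coefficients of [1 - X^k]. *)
Definition lone k : seq Z := ladd [:: Zpos xH] (ncons k Z0 [:: Zneg xH]).
Definition lsum (T : Type) (r : seq T) (f : T -> seq Z) := foldr (fun x s => ladd (f x) s) [::] r.
Definition lprod (T : Type) (r : seq T) (f : T -> seq Z) := foldr (fun x s => lmul (f x) s) [:: Zpos xH] r.

Lemma toP_cons c s : toP (c :: s) = toP s * 'X + (int_of_Z c)%:P.
Proof. by rewrite /toP /= cons_poly_def. Qed.
Lemma toP_nil : toP [::] = 0. Proof. by []. Qed.
Lemma toP_add s t : toP (ladd s t) = toP s + toP t.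
Proof.
elim: s t => [|a s IH] [|b t]; rewrite ?toP_nil ?add0r ?addr0 //= !toP_cons IH.
rewrite (_ : int_of_Z (a + b) = int_of_Z a + int_of_Z b); last by rewrite -rmorphD.
by rewrite polyCD mulrDl addrACA.
Qed.
Lemma toP_scale a t : toP (lscale a t) = (int_of_Z a)%:P * toP t.
Proof.
elim: t => [|b t IH]; first by rewrite toP_nil mulr0.
rewrite /= !toP_cons IH (_ : int_of_Z (BinInt.Z.mul a b) = int_of_Z a * int_of_Z b); last by rewrite -rmorphM.
by rewrite polyCM mulrDr mulrA.
Qed.
Lemma toP_mul s t : toP (lmul s t) = toP s * toP t.
Proof.
elim: s => [|a s IH]; first by rewrite toP_nil mul0r.
by rewrite /= toP_add toP_scale !toP_cons IH addr0 mulrDl addrC mulrAC.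
Qed.
Lemma toP_Xn k : toP (lXn k) = 'X^k.
Proof.
elim: k => [|k IH]; first by rewrite toP_cons toP_nil mul0r add0r expr0.
by rewrite [lXn _]/= toP_cons IH addr0 exprSr.
Qed.
Lemma toP_one k : toP (lone k) = 1 - 'X^k.
Proof.
rewrite toP_add toP_cons toP_nil mul0r add0r; congr (_ + _).
elim: k => [|k IH]; first by rewrite toP_cons toP_nil mul0r add0r expr0 (_ : int_of_Z _ = -1) // polyCN.
by rewrite [ncons _ _ _]/= toP_cons IH addr0 mulNr exprSr.
Qed.
Lemma toP_sum (T : Type) (r : seq T) f : toP (lsum r f) = \sum_(x <- r) toP (f x) :> {poly int}.
Proof. by elim: r => [|x r IH]; rewrite ?big_nil ?big_cons //= toP_add IH. Qed.
Lemma toP_prod (T : Type) (r : seq T) f : toP (lprod r f) = \prod_(x <- r) toP (f x) :> {poly int}.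
Proof.
elim: r => [|x r IH]; rewrite ?big_nil ?big_cons //= ?toP_mul ?IH //.
by rewrite toP_cons toP_nil mul0r add0r.
Qed.

(** The exponents [3 + i < 5 + i + j < 6 + i + j + k] of the denominators of [exp_poly_geom]
    all lie in [3 .. 14]. *)
Definition cone_cofactor i j k : {poly int} :=
  \prod_(t <- rem (3 + i)%N (rem (5 + i + j)%N (rem (6 + i + j + k)%N (iota 3 12)))) (1 - 'X^t).
Definition red_cone_num : {poly int} :=
  \sum_(i <- iota 0 3) \sum_(j <- iota 0 4) \sum_(k <- iota 0 4) cone_num i j k * cone_cofactor i j k.
Definition cone_den : {poly int} := (1 - 'X) ^+ 11 * \prod_(t <- iota 3 12) (1 - 'X^t).
Definition red_den : {poly int} :=
  (1 - 'X) ^+ 3 * (1 - 'X^3) * (1 - 'X^4) ^+ 2 * (1 - 'X^5) * \prod_(8 <= i < 15) (1 - 'X^i).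

Definition lcoef2 (i : nat) : Z := nth Z0 [:: Zpos xH; Zneg (xO xH); Zpos xH] i.
Definition lcoef3 (i : nat) : Z := nth Z0 [:: Zpos xH; Zneg (xI xH); Zpos (xI xH); Zneg xH] i.

Definition lcone i j k : seq Z :=
  lscale (BinInt.Z.mul (BinInt.Z.mul (lcoef2 i) (lcoef3 j)) (lcoef3 k)) (lmul (lXn (i + j + k))
   (lmul (ladd (ladd (ladd (lXn 0) (lscale (Zpos (xO xH)) (lXn (5 + i + j))))
      (lscale (Zpos (xO xH)) (lXn (3 + i)))) (lXn (8 + i + i + j)))
    (lprod (rem (3 + i)%N (rem (5 + i + j)%N (rem (6 + i + j + k)%N (iota 3 12)))) lone))).

Lemma toP_cone i j k : (i < 3)%N -> (j < 4)%N -> (k < 4)%N ->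
  toP (lcone i j k) = cone_num i j k * cone_cofactor i j k.
Proof.
move=> i3 j4 k4; rewrite /lcone toP_scale !toP_mul !toP_add !toP_scale !toP_Xn toP_prod /cone_num /cone_coef.
rewrite /cone_cofactor (eq_bigr _ (fun t _ => toP_one t)) expr0.
have c2 : int_of_Z (lcoef2 i) = coef2 i by case: i i3 => [|[|[|//]]].
have c3 t : (t < 4)%N -> int_of_Z (lcoef3 t) = coef3 t by case: t => [|[|[|[|//]]]].
rewrite (_ : int_of_Z (_ * _ * _) = coef2 i * coef3 j * coef3 k); last first.
  by rewrite -c2 -!c3 // -!rmorphM.
rewrite (_ : int_of_Z (Zpos (xO xH)) = 2%:R) // (_ : 2%:R%:P = 2%:R :> {poly int}) ?polyC_natr //.
by rewrite !polyCM; set P := \prod_(_ <- _) _; ring.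
Qed.

Definition lred_num : seq Z := lsum (iota 0 3) (fun i => lsum (iota 0 4) (fun j => lsum (iota 0 4) (fun k => lcone i j k))).
Definition lcone_den := lmul (lprod (nseq 11 1%N) lone) (lprod (iota 3 12) lone).
Definition lred_den := lprod [:: 1; 1; 1; 3; 4; 4; 5; 8; 9; 10; 11; 12; 13; 14]%N lone.
Definition lN_red : seq nat := [::
  1; 0; 0; 2; 4; 5; 16; 34; 53; 77; 98; 121; 182; 302; 483; 712; 953; 1187;
  1425; 1689; 2046; 2579; 3298; 4162; 5059; 5826; 6398; 6894; 7475; 8270; 9265;
  10260; 11041; 11529; 11745; 11798; 11811; 11811; 11798; 11745; 11529; 11041;
  10260; 9265; 8270; 7475; 6894; 6398; 5826; 5059; 4162; 3298; 2579; 2046; 1689;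
  1425; 1187; 953; 712; 483; 302; 182; 121; 98; 77; 53; 34; 16; 5; 4; 2; 0; 0; 1]%N.

Lemma int_of_Z_nat n : int_of_Z (BinInt.Z.of_nat n) = n%:R.
Proof. by rewrite -[BinInt.Z.of_nat n]/(Z_of_int (Posz n)) Z_of_intK natz. Qed.

Lemma toP_N_red : toP (map BinInt.Z.of_nat lN_red) = N_red.
Proof.
rewrite /toP -map_comp (eq_map (g := fun n => n%:R)) => [|n]; last exact: int_of_Z_nat.
by [].
Qed.

Lemma toP_zero s : all (BinInt.Z.eqb Z0) s -> toP s = 0.
Proof.
elim: s => [|c s IH] //= /andP[c0 /IH s0]; have -> : c = Z0 by case: c c0.
by rewrite toP_cons s0 mul0r add0r.
Qed.

(** The polynomial identity of [red_cone_identity], of degree 186, by evaluation on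
    lists. *)
Lemma red_check : all (BinInt.Z.eqb Z0)
  (ladd (lmul lred_num lred_den) (lscale (Zneg xH) (lmul lcone_den (map BinInt.Z.of_nat lN_red)))).
Proof. by vm_compute. Qed.

Lemma red_cone_identity : red_cone_num * red_den = cone_den * N_red.
Proof.
have gen A B c C D : toP (ladd (lmul A B) (lscale c (lmul C D))) =
    toP A * toP B + (int_of_Z c)%:P * (toP C * toP D) by rewrite toP_add toP_scale !toP_mul.
have := toP_zero red_check; rewrite {}gen toP_N_red.
have -> : toP lred_num = red_cone_num.
  rewrite /lred_num /red_cone_num toP_sum big_seq [RHS]big_seq; apply: eq_bigr => i.
  rewrite mem_iota add0n => /andP[_ i3]; rewrite toP_sum big_seq [RHS]big_seq; apply: eq_bigr => j.
  rewrite mem_iota add0n => /andP[_ j4]; rewrite toP_sum big_seq [RHS]big_seq; apply: eq_bigr => k.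
  by rewrite mem_iota add0n => /andP[_ k4]; apply: toP_cone.
have -> : toP lcone_den = cone_den.
  rewrite /lcone_den /cone_den toP_mul !toP_prod !(eq_bigr _ (fun t _ => toP_one t)); congr (_ * _).
  by rewrite big_nseq iter_mulr_1 expr1.
have -> : toP lred_den = red_den.
  rewrite /lred_den /red_den toP_prod !(eq_bigr _ (fun t _ => toP_one t)) /index_iota /=.
  by rewrite !big_cons !big_nil !mulr1 !expr1 !exprS !expr0 !mulr1 -!mulrA.
rewrite (_ : int_of_Z _ = -1) // polyCN mulN1r => /eqP; rewrite subr_eq0 => /eqP.
by [].
Qed.

Lemma cone_den_neq0 : cone_den != 0.
Proof.
have one_neq0 k : (0 < k)%N -> 1 - 'X^k != 0 :> {poly int}.
  move=> k0; apply/eqP => /(congr1 (fun P : {poly int} => P`_0)).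
  by rewrite coefB coef1 coefXn coef0; case: k k0.
rewrite mulf_neq0 // ?expf_neq0 //; first by rewrite -['X]expr1 one_neq0.
rewrite prodf_seq_neq0; apply/allP => t; rewrite mem_iota => /andP[t3 _] /=.
by rewrite one_neq0 // (leq_trans _ t3).
Qed.

(** Put the cones of [exp_poly_geom] on the common denominator [cone_den]. *)
Lemma exp_poly_red m : eqm m (cone_den * exp_poly m) red_cone_num.
Proof.
rewrite /cone_den mulrAC.
have h := eqmMr (\prod_(t <- iota 3 12) (1 - 'X^t)) (@exp_poly_geom m); apply: eqm_trans h _.
rewrite /red_cone_num -[iota 0 3]/(index_iota 0 3) big_mkord.
rewrite mulr_suml; apply: eqm_sum => i _; rewrite -[iota 0 4]/(index_iota 0 4) big_mkord.
rewrite mulr_suml; apply: eqm_sum => j _; rewrite big_mkord.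
rewrite mulr_suml; apply: eqm_sum => k _; rewrite -[X in eqm _ X]mulrA; apply: (@eqmMl m).
set r := iota 3 12; rewrite /cone_cofactor -/r.
have [x1 x2 x3] : [/\ (6 + i + j + k)%N \in r, (5 + i + j)%N \in rem (6 + i + j + k)%N r &
    (3 + i)%N \in rem (5 + i + j)%N (rem (6 + i + j + k)%N r)].
  have [i3 j4 k4] := And3 (ltn_ord i) (ltn_ord j) (ltn_ord k).
  rewrite !mem_rem_uniq ?rem_uniq ?iota_uniq // /r !(mem_iota, inE); split; lia.
rewrite (big_rem _ x1) (big_rem _ x2) (big_rem _ x3) /=.
set P := \prod_(_ <- _) _.
have [g1 g2 g3] := And3 (@geomE m (3 + i)%N isT) (@geomE m (5 + i + j)%N isT)
  (@geomE m (6 + i + j + k)%N isT).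
have := eqmMr P (eqmM (eqmM g1 g2) g3); rewrite !mulr1 mul1r; congr eqm.
by move: (geom m _) (geom m _) (geom m _) (1 - _) (1 - _) (1 - _) => *; ring.
Qed.

Lemma red_identity (D1 N1 : {poly int}) :
  (forall m, (0 < m)%N -> eqm m (D1 * exp_poly m) N1) -> N1 * red_den = D1 * N_red.
Proof.
move=> DN; apply: (mulfI cone_den_neq0).
rewrite [RHS]mulrCA -red_cone_identity mulrA [RHS]mulrA; congr (_ * _).
apply: eqm_eq => m n nm; have nm1 : (n <= m.+1)%N by apply: leqW.
rewrite -(eqmMl cone_den (DN m.+1 isT) nm1) -(eqmMl D1 (@exp_poly_red m.+1) nm1).
by rewrite mulrCA.
Qed.
End Verification.

(** * Specialization at X = 1 *)

(* From here on sets are classical ones; finite sets are written with finset. *)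
From mathcomp Require Import finmap complex.
From mathcomp Require Import all_classical all_reals all_analysis.
From mathcomp.analysis.showcase Require summability.
Local Open Scope classical_set_scope.
Local Open Scope ring_scope.

Section IntegralForm.

Definition int2 (P : {poly {poly int}}) : {poly {poly rat}} := map_poly (map_poly intr) P.
HB.instance Definition _ := GRing.RMorphism.copy int2 (map_poly (map_poly intr)).

Lemma int2_inj : injective int2.
Proof.
have i1 : injective (map_poly (intr : int -> rat)) by apply: map_inj_poly => //; exact: intr_inj.
by apply: map_inj_poly => //; rewrite rmorph0.
Qed.

Lemma clear_denominators (P : {poly {poly rat}}) :
  exists2 c : int, c != 0 & exists Q, int2 Q = (c%:~R)%:P *: P.
Proof.
elim/poly_ind: P => [|P r [c c0 [Q QE]]].
  by exists 1; rewrite ?oner_neq0 //; exists 0; rewrite scaler0 rmorph0.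
have [q [a a0 ra]] := rat_poly_scale r.
have qE : map_poly intr q = (a%:~R)%:P * r.
  by rewrite ra mul_polyC scalerA divff ?scale1r // intr_eq0.
exists (c * a); first by rewrite mulf_neq0.
exists (a%:P *: Q * 'X + (c%:P * q)%:P).
rewrite rmorphD rmorphM /= /int2 map_polyX map_polyC map_polyZ /= -/(int2 Q) QE.
rewrite rmorphM /= qE !map_polyC /= rmorphM /= polyCM scalerDr scalerA -!mul_polyC !polyCM.
by rewrite intrM !polyCM !mulrA (mulrC (a%:~R%:P)%:P).
Qed.

Lemma fraction_numden (R : idomainType) (x : {fraction R}) :
  exists n d, d != 0 /\ x = tofrac n / tofrac d.
Proof.
elim/quotW: x => r; exists (frac r).1, (frac r).2.
have d0 := denom_ratioP r; split=> //.
have d0' : tofrac (frac r).2 != 0 by rewrite tofrac_eq0.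
apply: (mulIf d0'); rewrite divfK //.
apply/eqP; rewrite -[_ * _]/(FracField.mul _ _) !piE /FracField.equivf /FracField.mulf.
by rewrite !numden_Ratio ?mulf_neq0 ?oner_neq0 //=; rewrite !mulr1 mulrC.
Qed.

Lemma int2_fraction (W : ratfun2) :
  exists N D, D != 0 /\ W = tofrac (int2 N) / tofrac (int2 D).
Proof.
have [n [d [d0 ->]]] := fraction_numden W.
have [a a0 [N NE]] := clear_denominators n; have [b b0 [D DE]] := clear_denominators d.
have c0 (c : int) : c != 0 -> tofrac (c%:~R)%:P%:P != 0 :> ratfun2.
  by move=> c0; rewrite tofrac_eq0 !polyC_eq0 intr_eq0.
have iC (c : int) : int2 c%:P%:P = (c%:~R)%:P%:P by rewrite /int2 !map_polyC /= map_polyC.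
exists (b%:P%:P * N), (a%:P%:P * D); split.
  rewrite mulf_neq0 ?polyC_eq0 //; apply: contraNneq d0 => D0.
  move: DE; rewrite D0 rmorph0 => /esym/eqP; rewrite -mul_polyC mulf_eq0 !polyC_eq0 intr_eq0 (negPf b0).
  by [].
have frac_cancel (F : fieldType) (x y u v : F) : x != 0 -> y != 0 -> v != 0 ->
    u / v = (x * (y * u)) / (y * (x * v)).
  by move=> x0 y0 v0; field; rewrite x0 y0 v0.
have iM P Q : int2 (P * Q) = int2 P * int2 Q by rewrite rmorphM.
rewrite !iM !iC NE DE -!mul_polyC !tofracM -frac_cancel ?c0 //.
by rewrite tofrac_eq0.
Qed.

Lemma eval2_int2 (F : fieldType) P (k : nat) (y : F) :
  eval2 (int2 P) k%:R y = (map_poly intr P.[k%:R]).[y].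
Proof.
have ratrE (Q : {poly int}) : map_poly ratr (map_poly intr Q) = map_poly intr Q :> {poly F}.
  apply/polyP => i; rewrite coef_map_id0 ?[ratr 0](ratr_int F 0) //.
  by rewrite !coef_map_id0 // ratr_int.
rewrite /eval2; have -> : map_poly (map_poly ratr) (int2 P) = map_poly (map_poly intr) P :> {poly {poly F}}.
  apply/polyP => i; rewrite coef_map_id0; last first.
    by rewrite -[0 in LHS](rmorph0 (map_poly (intr : int -> rat))) ratrE rmorph0.
  rewrite [in LHS]coef_map /= ratrE.
  by rewrite (coef_map_id0 _ (f := map_poly intr)) // rmorph0.
have -> : (k%:R : F)%:P = map_poly intr (k%:R : {poly int}) by rewrite !rmorph_nat.
by rewrite horner_map.
Qed.

End IntegralForm.

(** Divide by the common power of [X - 1]; then [D(1, Y) = 0] would force [N(1, Y) <> 0], which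
    is what [congruence_limit] excludes. *)
Lemma ratfun_at1 (N D : {poly {poly int}}) : D != 0 ->
  exists N1 D1, [/\ D1 != 0, N * D1 = N1 * D & (N1.[1] != 0) || (D1.[1] != 0)].
Proof.
move=> D0; have [N0|N0] := eqVneq N 0.
  exists 0, 1; split; rewrite ?oner_neq0 ?N0 ?mul0r //.
  by rewrite [1.[_]]hornerC oner_neq0 orbT.
have [k [N1 /implyP/(_ N0) n1 NE]] := multiplicity_XsubC N 1.
have [l [D1 /implyP/(_ D0) d1 DE]] := multiplicity_XsubC D 1.
have x0 : 'X - 1%:P != 0 :> {poly {poly int}} by rewrite polyXsubC_eq0.
have D10 : D1 != 0 by apply: contraNneq D0 => D10; rewrite DE D10 mul0r.
set x := 'X - 1%:P in NE DE x0.
have [kl|lk] := leqP l k.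
  exists (N1 * x ^+ (k - l)), D1; rewrite D10 (rootPf d1) orbT; split=> //.
  by rewrite NE DE -{1}(subnK kl) exprD; ring.
exists N1, (D1 * x ^+ (l - k)); rewrite mulf_neq0 ?expf_neq0 // (rootPf n1); split=> //.
by rewrite NE DE -{2}(subnK (ltnW lk)) exprD; ring.
Qed.

Lemma dvd_horner_diff (P : {poly {poly int}}) (p l n : nat) : (l %| p.-1)%N -> (0 < p)%N ->
  (l%:Z %| (P.[p%:R] - P.[1])`_n)%Z.
Proof.
move=> lp p0; have /factor_theorem[Q QE] : root (P - P.[1]%:P) 1.
  by rewrite rootE !hornerE subrr.
have -> : P.[p%:R] - P.[1] = Q.[p%:R] * (p.-1)%:R.
  have := congr1 (horner^~ p%:R) QE; rewrite !hornerE => ->.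
  by rewrite -[X in (X%:R - 1)](prednK p0) -natr1 addrK.
rewrite mulr_natr coefMn -[_ *+ p.-1]mulr_natr; by rewrite natz dvdz_mull.
Qed.

Lemma dvd_coefM (l : int) (P Q : {poly int}) n :
  (forall k, (k <= n)%N -> (l %| Q`_k)%Z) -> (l %| (P * Q)`_n)%Z.
Proof.
move=> h; rewrite coefM; apply: (big_ind (fun x => (l %| x)%Z)) => [|x y|i _].
- exact: dvdz0.
- by move=> hx hy; apply: rpredD.
- by rewrite dvdz_mull // h // leq_subr.
Qed.

(** A fixed coefficient [z] of [D(1, Y) F - N(1, Y)] is divisible by every large prime [l]:
    with [p] a prime divisor of [2^l - 1], both [P(p, Y) - P(1, Y)] and [A p m - F] vanish
    modulo [l], and [D(p, Y) A = N(p, Y)]. *)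
Lemma congruence_limit (N D : {poly {poly int}}) (A : forall p, prime p -> nat -> {poly int}) :
  (forall p (p_pr : prime p) m, (0 < m)%N -> eqm m (D.[p%:R] * A p p_pr m) N.[p%:R]) ->
  (forall p (p_pr : prime p) l m n, prime l -> (9 <= l)%N -> (p %| (2 ^ l).-1)%N -> (0 < m)%N ->
     (n <= m)%N -> (l%:Z %| (A p p_pr m - exp_poly m)`_n)%Z) ->
  forall m, (0 < m)%N -> eqm m (D.[1] * exp_poly m) N.[1].
Proof.
move=> DA Aexp m m0 n nm; set E := exp_poly m.
apply/eqP; rewrite -subr_eq0 -coefB; set z := (_)`_n.
have [l lz l_pr] := prime_above (`|z|%N + 9).
suff : (l%:Z %| z)%Z.
  rewrite dvdzE /= => lz'; have [/eqP|z0] := posnP `|z|%N; first by rewrite absz_eq0.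
  by have := dvdn_leq z0 lz'; lia.
have l9 : (9 <= l)%N by lia.
have l2 : (1 < (2 ^ l).-1)%N.
  have : (2 ^ 2 <= 2 ^ l)%N by rewrite leq_exp2l // (leq_trans _ l9).
  by move=> ?; lia.
set p := pdiv (2 ^ l).-1; have p_pr : prime p by rewrite pdiv_prime.
have pl : (p %| (2 ^ l).-1)%N by rewrite pdiv_dvd.
have lp := dvdn_pred_order2 p_pr l_pr pl; have p0 := prime_gt0 p_pr.
have zE : D.[1] * E - N.[1] = (N.[p%:R] - N.[1]) - E * (D.[p%:R] - D.[1]) -
   D.[p%:R] * (A p p_pr m - E) + (D.[p%:R] * A p p_pr m - N.[p%:R]) by ring.
have dA : (l%:Z %| (N.[p%:R] - N.[1])`_n)%Z by apply: dvd_horner_diff.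
have dB : (l%:Z %| (E * (D.[p%:R] - D.[1]))`_n)%Z.
  by apply: dvd_coefM => k _; apply: dvd_horner_diff.
have dC : (l%:Z %| (D.[p%:R] * (A p p_pr m - E))`_n)%Z.
  by apply: dvd_coefM => k kn; apply: Aexp => //; apply: leq_trans nm.
rewrite /z zE coefD [X in _ + X]coefB (DA p p_pr m m0 n nm) subrr addr0.
move: dA dB dC; move: (N.[p%:R] - N.[1]) (E * _) (D.[p%:R] * _) => A1 B1 C1 dA dB dC.
by rewrite !coefB; apply: rpredB => //; apply: rpredB.
Qed.

Lemma horner_fracX (P : {poly int}) :
  (map_poly intr P).[tofrac 'X] = tofrac (map_poly intr P) :> {fraction {poly rat}}.
Proof.
elim/poly_ind: P => [|P c IH]; first by rewrite !rmorph0 horner0.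
rewrite !rmorphD !rmorphM /= !map_polyX !map_polyC /= !hornerE IH.
congr (_ + _).
by rewrite !rmorph_int.
Qed.

(** [A p m] stands for the truncated generating function of the graded ideals for the prime
    [p]. *)
Lemma ratfun_value_at1 (W : ratfun2) (A : forall p, prime p -> nat -> {poly int}) :
  (forall N D, D != 0 -> W = tofrac (int2 N) / tofrac (int2 D) ->
     forall p (p_pr : prime p) m, (0 < m)%N -> eqm m (D.[p%:R] * A p p_pr m) N.[p%:R]) ->
  (forall p (p_pr : prime p) l m n, prime l -> (9 <= l)%N -> (p %| (2 ^ l).-1)%N -> (0 < m)%N ->
     (n <= m)%N -> (l%:Z %| (A p p_pr m - exp_poly m)`_n)%Z) ->
  let Y : {fraction {poly rat}} := tofrac 'X in
  ratfun_value W 1 Y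
    ((map_poly intr N_red).[Y] /
       ((1 - Y) ^+ 3 * (1 - Y ^+ 3) * (1 - Y ^+ 4) ^+ 2 * (1 - Y ^+ 5) *
          \prod_(8 <= i < 15) (1 - Y ^+ i))).
Proof.
move=> WA Aexp Y; have [N0 [D0 [D00 WE0]]] := int2_fraction W.
have [N [D [D_neq0 ND]]] := ratfun_at1 N0 D00.
have tf0 (P : {poly {poly int}}) : P != 0 -> tofrac (int2 P) != 0.
  by move=> P0; rewrite tofrac_eq0 -(rmorph0 int2) (inj_eq int2_inj).
have WE : W = tofrac (int2 N) / tofrac (int2 D).
  rewrite WE0; apply/eqP; rewrite eqr_div ?tf0 // -!tofracM tofrac_eq -!rmorphM.
  by rewrite (inj_eq int2_inj) ND mulrC.
have key := congruence_limit (WA N D D_neq0 WE) Aexp.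
move=> nz; have D1 : D.[1] != 0.
  apply: contraL nz => /eqP D1; rewrite D1 eqxx orbF negbK; apply/eqP/eqm_eq => m n nm.
  by rewrite -(key m.+1 _ _ (leqW nm)) // D1 mul0r.
have e1 P : eval2 (int2 P) 1 Y = tofrac (map_poly intr P.[1]).
  by have := eval2_int2 P 1 Y; rewrite !mulr1n horner_fracX.
have intr0 (P : {poly int}) : P != 0 -> tofrac (map_poly intr P : {poly rat}) != 0.
  move=> P0; rewrite tofrac_eq0 map_poly_eq0_id0 // intr_eq0.
  by rewrite lead_coef_eq0.
exists (int2 N), (int2 D); rewrite !e1 intr0 //; split=> //.
have E := red_identity key.
set i := fun P : {poly int} => tofrac (map_poly intr P : {poly rat}).
have iM P Q : i (P * Q) = i P * i Q by rewrite /i !rmorphM.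
have iB P Q : i (P - Q) = i P - i Q by rewrite /i !rmorphB.
have iX n P : i (P ^+ n) = i P ^+ n by rewrite /i !rmorphXn.
have i1 : i 1 = 1 by rewrite /i !rmorph1.
have iY : i 'X = Y by rewrite /i map_polyX.
have iden : (1 - Y) ^+ 3 * (1 - Y ^+ 3) * (1 - Y ^+ 4) ^+ 2 * (1 - Y ^+ 5) *
    \prod_(8 <= i < 15) (1 - Y ^+ i) = i red_den.
  have -> : \prod_(8 <= i < 15) (1 - Y ^+ i) = i (\prod_(8 <= i < 15) (1 - 'X^i)).
    rewrite (big_morph i iM i1); apply: eq_bigr => k _.
    by rewrite iB i1 iX iY.
  by rewrite !(iM, iX, iB) i1 iY.
have red0 : red_den != 0.
  apply: contraNneq cone_den_neq0 => r0; have := red_cone_identity.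
  rewrite r0 mulr0 => /esym/eqP; rewrite mulf_eq0 => /orP[//|/eqP Nr0].
  have := congr1 (fun P : {poly int} => P`_0) Nr0; rewrite coef0.
  by rewrite -toP_N_red coef_Poly.
rewrite iden horner_fracX -/(i N_red) -/(i N.[1]) -/(i D.[1]).
apply/eqP; rewrite eqr_div ?intr0 // -!iM; apply/eqP; rewrite /i; congr (tofrac (map_poly intr _)).
by rewrite E mulrC.
Qed.

(** * Graded ideals in coordinates *)

Section Coordinates.
Variables (R : comNzRingType) (L : lieAlgType R).
Local Notation vec := {ffun 'I_3 -> R}.
Local Notation mat := {ffun 'I_3 * 'I_3 -> R}.

Definition vscale (T : finType) (r : R) (x : {ffun T -> R}) : {ffun T -> R} :=
  [ffun i => r * x i].

(** Coordinates on the factors of the lower central series of a Lie algebra that behaves like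
    the free nilpotent one of class 3 on 3 generators.  The Jacobi identity is the relation
    [psi3 idmx = 0]. *)
Record graded_frame := GradedFrame {
  psi1 : vec -> lcs_factor L 1;
  psi2 : vec -> lcs_factor L 2;
  psi3 : mat -> lcs_factor L 3;
  psi1_lin : forall r x y, psi1 (vscale r x + y) = r *: psi1 x + psi1 y;
  psi2_lin : forall r x y, psi2 (vscale r x + y) = r *: psi2 x + psi2 y;
  psi3_lin : forall r x y, psi3 (vscale r x + y) = r *: psi3 x + psi3 y;
  psi1_surj : forall u, exists x, u = psi1 x;
  psi2_surj : forall u, exists x, u = psi2 x;
  psi3_surj : forall u, exists x, u = psi3 x;
  psi1_ker : forall x, psi1 x = 0 -> x = 0;
  psi2_ker : forall x, psi2 x = 0 -> x = 0;
  psi3_ker : forall x, psi3 x = 0 <-> exists r, x = vscale r idmx;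
  psi_cross : forall x y, factor_br 2 (psi1 x : lcs_factor L 0.+1) (psi1 y : lcs_factor L 0.+1) = psi2 (cross x y);
  psi_outer : forall w y, factor_br 3 (psi2 w : lcs_factor L 1.+1) (psi1 y : lcs_factor L 0.+1) = psi3 (outer w y)
}.

Variable F : graded_frame.

Local Notation gr3 := (gr L 3).
Definition coords := (vec * vec * mat)%type.

Definition to_gr (a : coords) : gr3 := fun j : 'I_3 =>
  match j with
  | Ordinal k _ => match k return lcs_factor L k.+1 with
    | 0 => psi1 F a.1.1 | 1 => psi2 F a.1.2 | 2 => psi3 F a.2 | _ => 0 end
  end.

Definition cscale r (a : coords) : coords := (vscale r a.1.1, vscale r a.1.2, vscale r a.2).

Lemma gr_ext (x y : gr3) : (forall i, x i = y i) -> x = y.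
Proof. exact: functional_extensionality_dep. Qed.

Lemma to_gr_lin r a b : to_gr (cscale r a + b) = r *: to_gr a + to_gr b.
Proof.
apply: gr_ext => -[[|[|[|//]]] lt3]; rewrite dsumDE dsumZE /to_gr /=.
- exact: psi1_lin.
- exact: psi2_lin.
- exact: psi3_lin.
Qed.
Lemma cscale0 a : cscale 0 a = 0.
Proof.
by case: a => [[a b] c]; rewrite /cscale /=; congr (_, _, _); apply/ffunP => i; rewrite !ffunE mul0r.
Qed.
Lemma cscale1 a : cscale 1 a = a.
Proof.
by case: a => [[x b] c]; rewrite /cscale /=; congr (_, _, _); apply/ffunP => i; rewrite !ffunE mul1r.
Qed.
Lemma to_grD a b : to_gr (a + b) = to_gr a + to_gr b.
Proof. by rewrite -{1}(cscale1 a) to_gr_lin scale1r. Qed.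
Lemma to_gr0 : to_gr 0 = 0.
Proof. by apply: (addrI (to_gr 0)); rewrite -to_grD !addr0. Qed.
Lemma to_grZ r a : to_gr (cscale r a) = r *: to_gr a.
Proof. by rewrite -[cscale r a]addr0 to_gr_lin to_gr0 addr0. Qed.
Lemma to_grN a : to_gr (- a) = - to_gr a.
Proof. by apply: (addrI (to_gr a)); rewrite -to_grD !subrr to_gr0. Qed.
Lemma to_grB a b : to_gr (a - b) = to_gr a - to_gr b.
Proof. by rewrite to_grD to_grN. Qed.

Lemma to_gr_surj x : exists a, x = to_gr a.
Proof.
have [a1 e1] := psi1_surj F (x (@Ordinal 3 0 isT)).
have [a2 e2] := psi2_surj F (x (@Ordinal 3 1 isT)).
have [a3 e3] := psi3_surj F (x (@Ordinal 3 2 isT)).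
exists (a1, a2, a3); apply: gr_ext => -[[|[|[|//]]] lt3]; rewrite /to_gr /=.
- by rewrite -e1 (bool_irrelevance lt3 isT).
- by rewrite -e2 (bool_irrelevance lt3 isT).
- by rewrite -e3 (bool_irrelevance lt3 isT).
Qed.

Lemma to_gr_ker a : to_gr a = 0 <-> a.1.1 = 0 /\ a.1.2 = 0 /\ exists r, a.2 = vscale r idmx.
Proof.
split=> [a0|[e1 [e2 [r e3]]]].
  have ai i : to_gr a i = 0 by rewrite a0.
  split; first by apply: psi1_ker; exact: (ai (@Ordinal 3 0 isT)).
  split; first by apply: psi2_ker; exact: (ai (@Ordinal 3 1 isT)).
  by apply/(psi3_ker F); exact: (ai (@Ordinal 3 2 isT)).
have z1 : psi1 F 0 = 0.
  by have := congr1 (fun x : gr3 => x (@Ordinal 3 0 isT)) to_gr0.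
have z2 : psi2 F 0 = 0.
  by have := congr1 (fun x : gr3 => x (@Ordinal 3 1 isT)) to_gr0.
apply: gr_ext => -[[|[|[|//]]] lt3]; rewrite /to_gr /= ?e1 ?e2 //.
by apply/(psi3_ker F); exists r.
Qed.

Lemma to_gr_br a b : lie_br (to_gr a) (to_gr b) =
  to_gr (0, cross a.1.1 b.1.1, outer a.1.2 b.1.1 - outer b.1.2 a.1.1).
Proof.
have z1 : psi1 F 0 = 0.
  by have := congr1 (fun x : gr3 => x (@Ordinal 3 0 isT)) to_gr0.
rewrite [LHS]/lie_br /=; apply: gr_ext => -[[|[|[|//]]] lt3]; rewrite /gr_br;
  rewrite !big_ord_recl big_ord0 !(big_mkcond (fun j => _ == _)) !big_ord_recl !big_ord0 /=.
- by rewrite !addr0.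
- by rewrite !addr0 -psi_cross.
have psi3B z w : psi3 F (z - w) = psi3 F z - psi3 F w.
  have := psi3_lin F (- 1) w z; rewrite scaleN1r addrC [RHS]addrC => <-.
  by congr (psi3 F _); congr (_ + _); apply/ffunP => i; rewrite !ffunE mulN1r.
by rewrite !addr0 !add0r (@factor_brC _ _ 2 0 1) // !psi_outer psi3B addrC.
Qed.

Lemma graded_sub (I : set gr3) : is_submodule I -> is_graded I -> forall a b c,
  I (to_gr (a, b, c)) <-> [/\ I (to_gr (a, 0, 0)), I (to_gr (0, b, 0)) & I (to_gr (0, 0, c))].
Proof.
move=> [I0 IZ] gI a b c.
have ID x y : I x -> I y -> I (x + y) by move=> Ix Iy; rewrite -[x]scale1r; apply: IZ.
split=> [|[h1 h2 h3]]; last first.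
  have -> : (a, b, c) = (a, 0, 0) + (0, b, 0) + (0, 0, c) :> coords.
    by congr (_, _, _); rewrite /= ?addr0 ?add0r.
  by rewrite !to_grD; apply: (ID) => //; apply: ID.
rewrite {1}gI => -[y yI yE].
have yi (i k : 'I_3) : i != k -> y i k = 0.
  by move=> ik; have [_ ->] := yI i; rewrite // eq_sym.
have comp k : to_gr (a, b, c) k = y k k.
  rewrite -yE; have -> : (\sum_i y i) k = \sum_i (y i k).
    by rewrite !big_ord_recl !big_ord0 !dsumDE dsum0E.
  by rewrite (bigD1 k) //= big1 ?addr0 // => i ik; apply: yi.
have Iy i : I (y i) by have [] := yI i.
have z : to_gr 0 = 0 := to_gr0.
have zi k : to_gr 0 k = 0 by rewrite z.
split.
- rewrite (_ : to_gr _ = y (@Ordinal 3 0 isT)) //; apply: gr_ext => k.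
  have [<-|ne] := eqVneq (@Ordinal 3 0 isT) k; first by rewrite -comp.
  by rewrite yi // -(zi k); case: k ne => -[|[|[|//]]] lt3.
- rewrite (_ : to_gr _ = y (@Ordinal 3 1 isT)) //; apply: gr_ext => k.
  have [<-|ne] := eqVneq (@Ordinal 3 1 isT) k; first by rewrite -comp.
  by rewrite yi // -(zi k); case: k ne => -[|[|[|//]]] lt3.
- rewrite (_ : to_gr _ = y (@Ordinal 3 2 isT)) //; apply: gr_ext => k.
  have [<-|ne] := eqVneq (@Ordinal 3 2 isT) k; first by rewrite -comp.
  by rewrite yi // -(zi k); case: k ne => -[|[|[|//]]] lt3.
Qed.

Lemma graded_intro (I : set gr3) : is_submodule I ->
  (forall a b c, I (to_gr (a, b, c)) ->
    [/\ I (to_gr (a, 0, 0)), I (to_gr (0, b, 0)) & I (to_gr (0, 0, c))]) -> is_graded I.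
Proof.
move=> [I0 IZ] split_I.
have ID x y : I x -> I y -> I (x + y) by move=> Ix Iy; rewrite -[x]scale1r; apply: IZ.
have zi k : to_gr 0 k = 0 by rewrite to_gr0.
apply/seteqP; split=> x.
  move=> Ix; have [[[a b] c] xE] := to_gr_surj x; rewrite xE in Ix.
  have [h1 h2 h3] := split_I a b c Ix.
  pose y (i : 'I_3) : gr3 := to_gr (if i == 0 :> nat then (a, 0, 0)
     else if i == 1%N :> nat then (0, b, 0) else (0, 0, c)).
  exists y => [i|].
    split; first by rewrite /y; case: i => -[|[|[|//]]] lt3.
    move=> j; rewrite /y -(zi j).
    by case: i => -[|[|[|//]]] lt3; case: j => -[|[|[|//]]] lt3'.
  rewrite xE !big_ord_recl big_ord0 addr0 /y /= -!to_grD; congr to_gr.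
  by congr (_, _, _); rewrite /= ?addr0 ?add0r.
move=> [y yI <-]; apply: (big_ind I) => // i _.
by have [] := yI i.
Qed.

Section Lattice.
Variables (p : nat) (p_pr : prime p).
Hypothesis nat_unit : forall n, ~~ (p %| n)%N -> exists y : R, y * n%:R = 1.
Hypothesis reduction : forall m, (0 < m)%N ->
  exists f : {rmorphism R -> 'Z_(p ^ m)}, forall x, f x = 0 -> exists y, x = (p ^ m)%:R * y.

(** Integers prime to [p] act invertibly, so only [p]-power torsion occurs. *)
Lemma torsion_pow (I : set gr3) d x : is_submodule I -> (0 < d)%N -> I (d%:R *: x) ->
  exists2 e, (p ^ e <= d)%N & I ((p ^ e)%:R *: x).
Proof.
move=> [I0 IZ] d0 Id; have [d' cop dE] := pfactor_coprime p_pr d0.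
exists (logn p d); first by rewrite dvdn_leq // pfactor_dvdnn.
have [|y yd] := nat_unit (n := d'); first by rewrite -prime_coprime.
have -> : (p ^ logn p d)%:R *: x = y *: (d%:R *: x) + 0.
  by rewrite addr0 scalerA dE natrM mulrA yd mul1r -dE.
exact: IZ.
Qed.

Lemma coset_eq (I : set gr3) x y : is_submodule I ->
  [set z | I (z - x)] = [set z | I (z - y)] <-> I (x - y).
Proof.
move=> [I0 IZ]; split=> [e|Ixy].
  have : [set z | I (z - x)] x by rewrite /= subrr.
  by rewrite e.
have Iyx : I (y - x) by rewrite -opprB -scaleN1r -[_ *: _]addr0; apply: IZ.
apply/seteqP; split=> z /= Iz.
  by rewrite -(subrK x z) -addrA -[z - x]scale1r; apply: IZ.
by rewrite -(subrK y z) -addrA -[z - y]scale1r; apply: IZ.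
Qed.

(** Among more than [|gr L : I|] multiples of [x], two lie in the same coset. *)
Lemma finite_index_pow (I : set gr3) x : is_submodule I -> finite_index I ->
  exists2 e, (p ^ e <= submod_index I)%N & I ((p ^ e)%:R *: x).
Proof.
move=> Is Ifin; rewrite /submod_index; set C := fset_set (cosets I).
pose h (j : 'I_(#|` C|).+1) : set gr3 := [set z | I (z - j%:R *: x)].
have hC j : h j \in C by rewrite in_fset_set // inE; exists (j%:R *: x).
pose g j : C := [` hC j]%fset.
have : ~~ injectiveb g.
  by apply/negP => /injectiveP/leq_card; rewrite card_ord -cardfE ltnn.
move=> /injectivePn[i [j ij]] /(congr1 val) /= /(coset_eq _ _ Is).
wlog lt_ji : i j ij / (j < i)%N => [H|] Iij.
  have [ji|ij'|/val_inj e] := ltngtP j i; last by rewrite e eqxx in ij.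
    exact: (H i j).
  apply: (H j i) => //; first by rewrite eq_sym.
  case: Is => I0 IZ; rewrite -opprB -scaleN1r -[_ *: _]addr0; exact: IZ.
have d0 : (0 < i - j)%N by rewrite subn_gt0.
have Id : I ((i - j)%:R *: x) by rewrite natrB ?scalerBl // ltnW.
have [e pe Ie] := torsion_pow Is d0 Id.
exists e => //; apply: leq_trans pe _; apply: leq_trans (leq_subr _ _) _.
by rewrite -ltnS.
Qed.

Section Reduction.
Variables (m : nat) (m_gt0 : (0 < m)%N) (f : {rmorphism R -> 'Z_(p ^ m)}).
Hypothesis f_ker : forall x, f x = 0 -> exists y, x = (p ^ m)%:R * y.
Local Notation q := (p ^ m)%N.
Local Notation Zq := 'Z_(p ^ m).
Local Notation fvec := {ffun 'I_3 -> Zq}.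
Local Notation fmat := {ffun 'I_3 * 'I_3 -> Zq}.
Local Notation U := (fvec * fvec * fmat)%type.

Definition vred (T : finType) (x : {ffun T -> R}) : {ffun T -> Zq} := [ffun i => f (x i)].
Definition vlift (T : finType) (x : {ffun T -> Zq}) : {ffun T -> R} := [ffun i => (x i : nat)%:R].
Lemma vliftK (T : finType) : cancel (@vlift T) (@vred T).
Proof. by move=> x; apply/ffunP => i; rewrite !ffunE rmorph_nat -Zp_nat_valK. Qed.
Lemma vredB (T : finType) (x y : {ffun T -> R}) : vred (x - y) = vred x - vred y.
Proof. by apply/ffunP => i; rewrite !ffunE rmorphB. Qed.
Lemma vred0 (T : finType) : vred (0 : {ffun T -> R}) = 0.
Proof. by rewrite -(subrr 0) vredB subrr. Qed.
Lemma vredN (T : finType) (x : {ffun T -> R}) : vred (- x) = - vred x.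
Proof. by rewrite -sub0r vredB vred0 sub0r. Qed.
Lemma vredZ (T : finType) r (x : {ffun T -> R}) : vred (vscale r x) = [ffun i => f r * vred x i].
Proof. by apply/ffunP => i; rewrite !ffunE rmorphM. Qed.
Lemma vred_ker (T : finType) (x : {ffun T -> R}) : vred x = 0 -> exists y, x = vscale q%:R y.
Proof.
move=> x0; have /fin_all_exists[y yE] i : exists y, x i = q%:R * y.
  by apply: f_ker; have := congr1 (fun z : {ffun T -> Zq} => z i) x0; rewrite !ffunE.
by exists [ffun i => y i]; apply/ffunP => i; rewrite !ffunE.
Qed.
Lemma vred_cross x y : vred (cross x y) = cross (vred x) (vred y).
Proof. by apply/ffunP => i; rewrite !ffunE rmorphB !rmorphM. Qed.
Lemma vred_outer x y : vred (outer x y) = outer (vred x) (vred y).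
Proof. by apply/ffunP => i; rewrite !ffunE rmorphM. Qed.
Lemma vred_idmx : vred idmx = idmx.
Proof. by apply/ffunP => i; rewrite !ffunE rmorph_nat. Qed.

Definition coord_red (a : coords) : U := (vred a.1.1, vred a.1.2, vred a.2).
Definition coord_lift (u : U) : coords := (vlift u.1.1, vlift u.1.2, vlift u.2).
Lemma coord_liftK : cancel coord_lift coord_red.
Proof. by move=> [[x y] z]; rewrite /coord_red /= !vliftK. Qed.
Lemma coord_redB a b : coord_red (a - b) = coord_red a - coord_red b.
Proof. by rewrite /coord_red !vredB. Qed.
Lemma coord_red_ker a : coord_red a = 0 -> exists b, a = cscale q%:R b.
Proof.
case: a => [[x y] z] [] /vred_ker[x' xE] /vred_ker[y' yE] /vred_ker[z' zE].
by exists (x', y', z'); rewrite /cscale /= -xE -yE -zE.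
Qed.

(** Submodules that contain [p^m gr L] are determined by their image modulo [p^m]. *)
Definition full (I : set gr3) := forall x, I (q%:R *: x).

Lemma coord_red_mem (I : set gr3) a b : is_submodule I -> full I -> coord_red a = coord_red b ->
  I (to_gr a) <-> I (to_gr b).
Proof.
move=> [I0 IZ] If ab; suff H a' b' : coord_red a' = coord_red b' -> I (to_gr a') -> I (to_gr b').
  by split; apply: H.
move=> e Ia; have [|c cE] := coord_red_ker (a := b' - a'); first by rewrite coord_redB e subrr.
rewrite -(subrK a' b') cE to_grD to_grZ -[_ *: _]scale1r; apply: IZ => //; exact: If.
Qed.

Definition code_set (I : set gr3) : {set U} := finset (fun u => `[< I (to_gr (coord_lift u)) >]).
(** The three homogeneous components of [I], reduced modulo [p^m]. *)
Definition code (I : set gr3) : {set fvec} * {set fvec} * {set fmat} :=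
  (finset (fun x => `[< I (to_gr (vlift x, 0, 0)) >]), finset (fun x => `[< I (to_gr (0, vlift x, 0)) >]),
   finset (fun x => `[< I (to_gr (0, 0, vlift x)) >])).

Section FullIdeal.
Variable I : set gr3.
Hypotheses (Is : is_submodule I) (If : full I).

Lemma in_code_set a : (coord_red a \in code_set I) = `[< I (to_gr a) >].
Proof.
by rewrite inE; apply: asbool_equiv_eq; apply: coord_red_mem => //; rewrite coord_liftK.
Qed.
Lemma in_code1 x : (vred x \in (code I).1.1) = `[< I (to_gr (x, 0, 0)) >].
Proof.
by rewrite inE; apply: asbool_equiv_eq; apply: coord_red_mem => //; rewrite /coord_red /= vliftK.
Qed.
Lemma in_code2 x : (vred x \in (code I).1.2) = `[< I (to_gr (0, x, 0)) >].
Proof.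
by rewrite inE; apply: asbool_equiv_eq; apply: coord_red_mem => //; rewrite /coord_red /= vliftK.
Qed.
Lemma in_code3 x : (vred x \in (code I).2) = `[< I (to_gr (0, 0, x)) >].
Proof.
by rewrite inE; apply: asbool_equiv_eq; apply: coord_red_mem => //; rewrite /coord_red /= vliftK.
Qed.

Lemma card_U : #|{: U}| = (q ^ 15)%N.
Proof.
have cZ : #|Zq| = q by rewrite card_ord Zp_cast // -(exp1n m) ltn_exp2r // prime_gt1.
by rewrite !card_prod !card_ffun !card_prod !card_ord -[(Zp_trunc _).+2]card_ord cZ -!expnD.
Qed.

Lemma full_finite_index : finite_index I.
Proof.
rewrite /finite_index; have -> : cosets I = (fun u => [set y | I (y - to_gr (coord_lift u))]) @` setT.
  apply/seteqP; split=> _ [x _ <-]; last by exists (to_gr (coord_lift x)).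
  have [a ->] := to_gr_surj x; exists (coord_red a) => //.
  apply/(coset_eq _ _ Is); rewrite -to_grB; apply/(coord_red_mem (b := 0) Is If).
    by rewrite coord_redB coord_liftK subrr /coord_red !vred0.
  by rewrite to_gr0; case: Is.
by apply: finite_image; apply: finite_finset.
Qed.

(** [code_set I] contains the image of the kernel of [to_gr], the scalar matrices, so its cosets
    in the coordinate module, of order [q^15], correspond to those of [I]. *)
Lemma index_code_set : (submod_index I * #|code_set I| = q ^ 15)%N.
Proof.
rewrite -card_U /submod_index; set C := fset_set (cosets I).
pose h (u : U) : set gr3 := [set y | I (y - to_gr (coord_lift u))].
have hC u : h u \in C.
  by rewrite in_fset_set ?inE; [exists (to_gr (coord_lift u))|exact: full_finite_index].
pose g u : C := [` hC u]%fset.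
have hE u v : (g u == g v) = (u - v \in code_set I).
  rewrite -val_eqE /=; have -> : u - v = coord_red (coord_lift u - coord_lift v) by rewrite coord_redB !coord_liftK.
  rewrite in_code_set; apply/eqP/asboolP; rewrite to_grB => /(coset_eq _ _ Is) //.
have -> : #|{: U}| = (\sum_(c : C) #|finset (fun u => g u == c)|)%N.
  rewrite -[LHS]sum1_card (partition_big g predT) //=.
  by apply: eq_bigr => c _; rewrite sum1dep_card.
rewrite (eq_bigr (fun _ => #|code_set I|)) ?sum_nat_const ?cardfE // => c _.
have : val c \in C := valP c.
rewrite /C (in_fset_set full_finite_index) => /set_mem[x _ xE].
have [a aE] := to_gr_surj x.
have gc : g (coord_red a) = c.
  apply/val_inj; rewrite /= -xE aE; apply/(coset_eq _ _ Is).
  rewrite -to_grB; apply/(coord_red_mem (b := 0) Is If); last by rewrite to_gr0; case: Is.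
  by rewrite coord_redB coord_liftK subrr /coord_red !vred0.
rewrite -[RHS](card_imset _ (addIr (coord_red a))); apply: eq_card => u.
rewrite inE; apply/eqP/imsetP => [uc|[v vI ->]].
  exists (u - coord_red a); last by rewrite subrK.
  by rewrite -hE uc gc.
by rewrite -gc; apply/eqP; rewrite hE addrK.
Qed.
End FullIdeal.

Lemma card_code_set (I : set gr3) : is_submodule I -> is_graded I -> full I ->
  #|code_set I| = (#|(code I).1.1| * #|(code I).1.2| * #|(code I).2|)%N.
Proof.
move=> Is gI If; rewrite -!cardsX; apply: eq_card => -[[x y] z]; rewrite !inE /=.
apply/asboolP/andP => [/(graded_sub Is gI)[h1 h2 h3]|[/andP[/asboolP h1 /asboolP h2] /asboolP h3]].
  by split; [apply/andP; split|]; apply/asboolP.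
exact/(graded_sub Is gI).
Qed.

Lemma code_index (I : set gr3) n : is_submodule I -> is_graded I -> full I ->
  triple_index n (code I) = (submod_index I == p ^ n)%N.
Proof.
move=> Is gI If; rewrite /triple_index -card_code_set // -(index_code_set Is If) mulnC.
rewrite eqn_pmul2r ?(eq_sym (submod_index I)) //.
have : (0 < q ^ 15)%N by rewrite !expn_gt0 prime_gt0.
by rewrite -(index_code_set Is If) muln_gt0 => /andP[].
Qed.

Lemma additive_code (T : finType) (j : {ffun T -> R} -> coords) (I : set gr3) :
  is_submodule I -> full I -> j 0 = 0 -> (forall x y, j (x - y) = j x - j y) ->
  (forall x, vred x = 0 -> coord_red (j x) = 0) ->
  additive_set (finset (fun x : {ffun T -> Zq} => `[< I (to_gr (j (vlift x))) >])).
Proof.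
move=> Is If j0 jB jred; have [I0 IZ] := Is.
have mem x : (vred x \in finset (fun x : {ffun T -> Zq} => `[< I (to_gr (j (vlift x))) >])) =
    `[< I (to_gr (j x)) >].
  rewrite inE; apply: asbool_equiv_eq; apply: coord_red_mem => //.
  apply/eqP; rewrite -subr_eq0 -coord_redB -jB; apply/eqP/jred.
  by rewrite vredB vliftK subrr.
apply/additive_setP; split; first by rewrite -(vred0 T) mem j0 to_gr0; apply/asboolP.
move=> x y; rewrite -(vliftK x) -(vliftK y) -vredB !mem jB to_grB => /asboolP hx /asboolP hy.
by apply/asboolP; rewrite addrC -scaleN1r; apply: IZ.
Qed.

Lemma code_triple (I : set gr3) : is_lie_ideal I -> is_graded I -> full I ->
  ideal_triple (code I).
Proof.
move=> [Is Ibr] gI If; have [I0 IZ] := Is.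
have Z0 : to_gr (0, 0, idmx) = 0.
  by apply/to_gr_ker; split=> //; split=> //; exists 1; apply/ffunP => i; rewrite !ffunE mul1r.
have cr0 x : cross x (0 : vec) = 0 by apply/ffunP => i; rewrite !ffunE !mulr0 subrr.
have c0r x : cross (0 : vec) x = 0 by apply/ffunP => i; rewrite !ffunE !mul0r subrr.
have or0 x : outer x (0 : vec) = 0 by apply/ffunP => i; rewrite !ffunE mulr0.
have o0r x : outer (0 : vec) x = 0 by apply/ffunP => i; rewrite !ffunE mul0r.
have IN x : I (- x) -> I x.
  by move=> h; rewrite -[x]opprK -scaleN1r -[_ *: _]addr0; apply: IZ.
apply/ideal_tripleP; split.
- split.
  + by apply: (additive_code (j := fun x => (x, 0, 0))) => // [x y|x x0];
      rewrite /coord_red /= ?vred0 ?x0 //; congr (_, _, _); rewrite subrr.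
  + by apply: (additive_code (j := fun x => (0, x, 0))) => // [x y|x x0];
      rewrite /coord_red /= ?vred0 ?x0 //; congr (_, _, _); rewrite subrr.
  + by apply: (additive_code (j := fun x => (0, 0, x))) => // [x y|x x0];
      rewrite /coord_red /= ?vred0 ?x0 //; congr (_, _, _); rewrite subrr.
- by rewrite -vred_idmx (in_code3 Is If) Z0; apply/asboolP.
- move=> x y; rewrite -(vliftK x) -(vliftK y) -vred_cross (in_code1 Is If) (in_code2 Is If).
  move=> /asboolP/(Ibr _ (to_gr (vlift y, 0, 0))); rewrite to_gr_br /= !o0r subrr.
  by move=> h; apply/asboolP.
- move=> x y; rewrite -(vliftK x) -(vliftK y) -vred_outer (in_code1 Is If) (in_code3 Is If).
  move=> /asboolP/(Ibr _ (to_gr (0, vlift y, 0))); rewrite to_gr_br /= cr0 o0r sub0r.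
  by move=> h; apply/asboolP/IN; rewrite -to_grN; move: h; congr (I (to_gr _)); congr (_, _, _); rewrite oppr0.
- move=> w y; rewrite -(vliftK w) -(vliftK y) -vred_outer (in_code2 Is If) (in_code3 Is If).
  move=> /asboolP/(Ibr _ (to_gr (vlift y, 0, 0))); rewrite to_gr_br /= c0r o0r subr0.
  by move=> h; apply/asboolP.
Qed.

Lemma code_inj (I J : set gr3) : is_submodule I -> is_graded I -> full I ->
  is_submodule J -> is_graded J -> full J -> code I = code J -> I = J.
Proof.
move=> Is gI If Js gJ Jf IJ.
have eqIJ a : I (to_gr a) <-> J (to_gr a).
  case: a => [[a b] c]; split.
    move=> /(graded_sub Is gI)[/asboolP h1 /asboolP h2 /asboolP h3]; apply/(graded_sub Js gJ).
    move: h1 h2 h3; rewrite -(in_code1 Is If) -(in_code2 Is If) -(in_code3 Is If) IJ.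
    by rewrite (in_code1 Js Jf) (in_code2 Js Jf) (in_code3 Js Jf) => /asboolP ? /asboolP ? /asboolP ?.
  move=> /(graded_sub Js gJ)[/asboolP h1 /asboolP h2 /asboolP h3]; apply/(graded_sub Is gI).
  move: h1 h2 h3; rewrite -(in_code1 Js Jf) -(in_code2 Js Jf) -(in_code3 Js Jf) -IJ.
  by rewrite (in_code1 Is If) (in_code2 Is If) (in_code3 Is If) => /asboolP ? /asboolP ? /asboolP ?.
by apply/seteqP; split=> x; have [a ->] := to_gr_surj x => /eqIJ.
Qed.

Section Decode.
Variables (A1 A2 : {set fvec}) (A3 : {set fmat}).
Hypothesis At : ideal_triple (A1, A2, A3).

(** The inverse of [code]: the graded ideal with the given components modulo [p^m]. *)
Definition decode : set gr3 := [set x | exists2 a : coords, x = to_gr a &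
  [&& vred a.1.1 \in A1, vred a.1.2 \in A2 & vred a.2 \in A3]].

Lemma scale_sub (T : finType) (A : {set {ffun T -> Zq}}) r x : additive_set A -> vred x \in A ->
  vred (vscale r x) \in A.
Proof.
move=> As xA; rewrite vredZ.
rewrite (_ : [ffun i => _] = vred x *+ (f r : nat)); first exact: additive_setMn.
by apply/ffunP => i; rewrite ffunMnE !ffunE -[RHS]mulr_natl -Zp_nat_valK.
Qed.

Lemma decodeP a : decode (to_gr a) <-> [&& vred a.1.1 \in A1, vred a.1.2 \in A2 & vred a.2 \in A3].
Proof.
have [[s1 s2 s3] i3 _ _ _] := ideal_tripleP _ _ _ At.
split=> [[b ab /and3P[b1 b2 b3]]|]; last by exists a.
have : to_gr (a - b) = 0 by rewrite to_grB ab subrr.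
move=> /to_gr_ker/= [/subr0_eq -> [/subr0_eq -> [r e]]]; rewrite b1 b2 /=.
rewrite -(subrK b.2 a.2) e -[b.2]opprK vredB; have [_ ->] := additive_setP _ s3; rewrite ?vredN //.
  by apply: scale_sub => //; rewrite vred_idmx.
exact: additive_setN.
Qed.

Lemma decode_submodule : is_submodule decode.
Proof.
have [[s1 s2 s3] i3 _ _ _] := ideal_tripleP _ _ _ At.
have zA (T : finType) (A : {set {ffun T -> Zq}}) : additive_set A -> vred 0 \in A.
  by move=> /additive_setP[A0 _]; rewrite vred0.
have lA (T : finType) (A : {set {ffun T -> Zq}}) r x y : additive_set A -> vred x \in A -> vred y \in A ->
    vred (vscale r x + y) \in A.
  move=> As xA yA; rewrite -[y]opprK vredB vredN.
  have [_ ->] := additive_setP _ As; rewrite ?additive_setN //; exact: scale_sub.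
split=> [|r x y]; first by rewrite -to_gr0; apply/decodeP; rewrite !zA.
have [a ->] := to_gr_surj x; have [b ->] := to_gr_surj y.
move=> /decodeP/and3P[a1 a2 a3] /decodeP/and3P[b1 b2 b3].
by rewrite -to_gr_lin; apply/decodeP; rewrite /= !lA.
Qed.

Lemma decode_full : full decode.
Proof.
have [[s1 s2 s3] i3 _ _ _] := ideal_tripleP _ _ _ At.
have kA (T : finType) (A : {set {ffun T -> Zq}}) x : additive_set A -> vred (vscale q%:R x) \in A.
  move=> /additive_setP[A0 _]; rewrite vredZ (_ : [ffun i => _] = 0) //.
  by apply/ffunP => i; rewrite !ffunE rmorph_nat pchar_Zp ?mul0r // -(exp1n m) ltn_exp2r // prime_gt1.
by move=> x; have [a ->] := to_gr_surj x; rewrite -to_grZ; apply/decodeP; rewrite /= !kA.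
Qed.

Lemma decode_graded : is_graded decode.
Proof.
have [[s1 s2 s3] i3 _ _ _] := ideal_tripleP _ _ _ At.
have zA (T : finType) (A : {set {ffun T -> Zq}}) : additive_set A -> vred 0 \in A.
  by move=> /additive_setP[A0 _]; rewrite vred0.
apply: graded_intro; first exact: decode_submodule.
by move=> a b c /decodeP/and3P[/= h1 h2 h3]; split; apply/decodeP; rewrite /= ?h1 ?h2 ?h3 !zA.
Qed.

Lemma decode_ideal : is_lie_ideal decode.
Proof.
have [[s1 s2 s3] i3 c12 c13 c23] := ideal_tripleP _ _ _ At.
split; first exact: decode_submodule.
move=> x y; have [a ->] := to_gr_surj x; have [b ->] := to_gr_surj y.
move=> /decodeP/and3P[a1 a2 a3]; rewrite to_gr_br; apply/decodeP => /=.
apply/and3P; split.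
- by rewrite vred0; case/additive_setP: s1.
- by rewrite vred_cross c12.
- rewrite vredB !vred_outer; have [_ B3] := additive_setP _ s3.
  by apply: B3; [apply: c23|apply: c13].
Qed.

Lemma code_decode : code decode = (A1, A2, A3).
Proof.
have [[s1 s2 s3] i3 _ _ _] := ideal_tripleP _ _ _ At.
have zA (T : finType) (A : {set {ffun T -> Zq}}) : additive_set A -> vred 0 \in A.
  by move=> /additive_setP[A0 _]; rewrite vred0.
congr (_, _, _); apply/setP => x; rewrite inE; apply/asboolP/idP.
- by move=> /decodeP/and3P[/=]; rewrite vliftK.
- by move=> xA; apply/decodeP; rewrite /= vliftK xA !zA.
- by move=> /decodeP/and3P[/= _]; rewrite vliftK.
- by move=> xA; apply/decodeP; rewrite /= vliftK xA !zA.
- by move=> /decodeP/and3P[/= _ _]; rewrite vliftK.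
- by move=> xA; apply/decodeP; rewrite /= vliftK xA !zA.
Qed.
End Decode.
End Reduction.

Local Notation T := (graded_ideal L 3).

Lemma graded_idealP (I : T) : [/\ is_lie_ideal (val I), is_graded (val I) & finite_index (val I)].
Proof. exact: (asboolW (valP I)). Qed.

Lemma index_gt0 (I : set gr3) : finite_index I -> (0 < submod_index I)%N.
Proof.
move=> If; rewrite /submod_index cardfs_gt0; apply/fset0Pn.
by exists [set y | I (y - 0)]; rewrite in_fset_set // inE; exists 0.
Qed.

(** A submodule of index [N] contains [p^N gr L], so [N] divides the order of a module over
    [Z/p^N]. *)
Lemma index_is_pow (I : T) : exists k, submod_index (val I) = (p ^ k)%N.
Proof.
have [[Is _] gI If] := graded_idealP I; set N := submod_index (val I).
have N0 : (0 < N)%N by apply: index_gt0.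
have fN : full N (val I).
  move=> x; have [e pe Ie] := finite_index_pow x Is If; have [I0 IZ] := Is.
  have eN : (e <= N)%N by apply: leq_trans pe; apply: ltnW; apply: ltn_expl; apply: prime_gt1.
  rewrite -(subnK eN) expnD natrM -scalerA -[_ *: _]addr0; exact: IZ.
have [f f_ker] := reduction N0.
have := index_code_set N0 f_ker Is fN; rewrite -/N => e.
have : (N %| p ^ (N * 15))%N by rewrite expnM -e dvdn_mulr.
by case/(dvdn_pfactor _ _ p_pr) => k _ ->; exists k.
Qed.

Definition level (I : T) : nat := logn p (submod_index (val I)).
Lemma levelP (I : T) : submod_index (val I) = (p ^ level I)%N.
Proof. by have [k e] := index_is_pow I; rewrite /level e pfactorK. Qed.

Lemma level_full (I : T) m : (level I <= m)%N -> full m (val I).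
Proof.
have [[Is _] gI If] := graded_idealP I => lm x; have [I0 IZ] := Is.
have [e pe Ie] := finite_index_pow x Is If.
have em : (e <= m)%N.
  by apply: leq_trans lm; move: pe; rewrite levelP leq_exp2l ?prime_gt1.
by rewrite -(subnK em) expnD natrM -scalerA -[_ *: _]addr0; apply: IZ.
Qed.

Definition level_set n : {fset T} := fset_set [set I : T | level I = n].

(** An ideal of index [p^n] contains [p^n gr L], so for [n <= m] it is determined by its
    components modulo [p^m], and these are the ideal triples of the same index. *)
Lemma count_graded_ideals m n : (0 < m)%N -> (n <= m)%N ->
  (forall I, (I \in level_set n) = (level I == n)) /\
  #|` level_set n| = #|finset (fun A : {set {ffun 'I_3 -> 'Z_(p ^ m)}} * _ * _ =>
     ideal_triple A && triple_index n A)|.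
Proof.
move=> m0 nm; have [f f_ker] := reduction m0.
pose X := finset (fun A : {set {ffun 'I_3 -> 'Z_(p ^ m)}} * _ * _ => ideal_triple A && triple_index n A).
pose cd (I : T) := code m (val I).
have cdX I : level I = n -> cd I \in X.
  move=> In; have [Ii gI If] := graded_idealP I; have fI := level_full (I := I) (m := m).
  have [Is _] := Ii; have {}fI : full m (val I) by apply: fI; rewrite In.
  rewrite inE; apply/andP; split; first exact: (code_triple f_ker).
  by rewrite (code_index m0 f_ker) // levelP In.
have cd_inj I J : level I = n -> level J = n -> cd I = cd J -> I = J.
  move=> In Jn IJ; apply: val_inj.
  have [[Is _] gI _] := graded_idealP I; have [[Js _] gJ _] := graded_idealP J.
  by apply: (code_inj f_ker) IJ => //; apply: level_full; rewrite ?In ?Jn.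
have fin : finite_set [set I : T | level I = n].
  have inj : {in [set I : T | level I = n] &, injective cd}.
    by move=> I J; rewrite !inE; apply: cd_inj.
  by rewrite -(eq_finite_set (inj_card_eq inj)); apply: finite_finset.
have memS I : (I \in level_set n) = (level I == n).
  by rewrite in_fset_set //; apply/idP/eqP => [/set_mem|h]; rewrite ?inE.
split=> //; rewrite -/X.
have uS : uniq (map cd (level_set n)).
  rewrite map_inj_in_uniq ?fset_uniq // => I J; rewrite !memS => /eqP In /eqP Jn; exact: cd_inj.
rewrite -(size_map cd) -(card_uniqP uS); apply: eq_card => A.
apply/mapP/idP => [[I]|]; first by rewrite memS => /eqP In ->; apply: cdX.
case: A => -[A1 A2] A3 AX; have := AX; rewrite inE => /andP[At Ai].
have dP : [/\ is_lie_ideal (decode f A1 A2 A3), is_graded (decode f A1 A2 A3) &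
    finite_index (decode f A1 A2 A3)].
  split; [exact: decode_ideal|exact: decode_graded|].
  by apply: (full_finite_index f_ker); [exact: decode_submodule|exact: decode_full].
have := code_index m0 f_ker n (decode_submodule f At) (decode_graded f At) (decode_full m0 f At).
rewrite (code_decode f At) Ai => /esym/eqP idx.
pose J : T := exist (fun I => is_true `[< [/\ is_lie_ideal I, is_graded I & finite_index I] >]) _ (asboolT dP).
exists J; last by rewrite /cd /= (code_decode f At).
by rewrite memS /level /= idx pfactorK.
Qed.
End Lattice.
End Coordinates.

(** * Coordinates of the free nilpotent Lie ring *)

Section Model.
Variable R : comNzRingType.
Local Notation vec := {ffun 'I_3 -> R}.
Local Notation mat := {ffun 'I_3 * 'I_3 -> R}.
Local Notation coords := (coords R).

(** The projection of the matrices onto those with a zero at [(0, 0)], along the scalar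
    ones: it gives a model of the matrices modulo the scalar ones that needs no quotient. *)
Definition mod_scalar (z : mat) : mat := [ffun ij => z ij - (ij.1 == ij.2)%:R * z (0, 0)].

(** A concrete Lie algebra of class 3; evaluating Lie terms in it shows that the relations
    among the generators are no stronger than expected. *)
Definition model_br (a b : coords) : coords :=
  (0, cross a.1.1 b.1.1, mod_scalar (outer a.1.2 b.1.1 - outer b.1.2 a.1.1)).

Lemma coords_eq (a b : coords) : a.1.1 = b.1.1 -> a.1.2 = b.1.2 -> a.2 = b.2 -> a = b.
Proof. by case: a => [[a1 a2] a3]; case: b => [[b1 b2] b3] /= -> -> ->. Qed.

Lemma model_brDl : left_distributive model_br +%R.
Proof.
move=> a b c; apply: coords_eq; rewrite /model_br /= ?addr0 //; apply/ffunP => i; rewrite !ffunE; ring.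
Qed.
Lemma model_brDr : right_distributive model_br +%R.
Proof.
move=> a b c; apply: coords_eq; rewrite /model_br /= ?addr0 //; apply/ffunP => i; rewrite !ffunE; ring.
Qed.
Lemma model_brZl r a b : model_br (cscale r a) b = cscale r (model_br a b).
Proof.
apply: coords_eq; rewrite /model_br /=; apply/ffunP => i; rewrite !ffunE ?mulr0 //; ring.
Qed.
Lemma model_brZr r a b : model_br a (cscale r b) = cscale r (model_br a b).
Proof.
apply: coords_eq; rewrite /model_br /=; apply/ffunP => i; rewrite !ffunE ?mulr0 //; ring.
Qed.
Lemma model_brxx a : model_br a a = 0.
Proof.
apply: coords_eq; rewrite /model_br //=; apply/ffunP => i; rewrite !ffunE; ring.
Qed.
Lemma model_jacobi a b c :
  model_br a (model_br b c) + model_br b (model_br c a) + model_br c (model_br a b) = 0.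
Proof.
have c0 x : cross x (0 : vec) = 0 by apply/ffunP => i; rewrite !ffunE !mulr0 subrr.
have o0 x : outer (0 : vec) x = 0 by apply/ffunP => i; rewrite !ffunE mul0r.
have o0r x : outer x (0 : vec) = 0 by apply/ffunP => i; rewrite !ffunE mulr0.
apply: coords_eq; rewrite /model_br /= ?addr0 // ?c0 ?addr0 // !o0r.
apply/ffunP => -[i j]; rewrite !ffunE /=.
by elim/ord3P: i; elim/ord3P: j; rewrite ?(add0r, ord3D) /=; ring.
Qed.

Lemma cscaleA r s (a : coords) : cscale r (cscale s a) = cscale (r * s) a.
Proof. by apply: coords_eq; apply/ffunP => i; rewrite !ffunE mulrA. Qed.
Lemma cscaleDr r (a b : coords) : cscale r (a + b) = cscale r a + cscale r b.
Proof. by apply: coords_eq; apply/ffunP => i; rewrite !ffunE mulrDr. Qed.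
Lemma cscaleDl r s (a : coords) : cscale (r + s) a = cscale r a + cscale s a.
Proof. by apply: coords_eq; apply/ffunP => i; rewrite !ffunE mulrDl. Qed.

(** A morphism to the model maps the terms of the lower central series to elements of degree
    at least 2, 3, 4. *)
Lemma model_lcs (R' : comNzRingType) (L : lieAlgType R') (h : L -> coords) (th : R' -> R) :
  (forall r u v, h (r *: u + v) = cscale (th r) (h u) + h v) -> h 0 = 0 ->
  (forall u v, h (lie_br u v) = model_br (h u) (h v)) ->
  [/\ forall u, lcs L 2 u -> (h u).1.1 = 0,
      forall u, lcs L 3 u -> (h u).1.1 = 0 /\ (h u).1.2 = 0 &
      forall u, lcs L 4 u -> h u = 0].
Proof.
move=> hL h0 hB.
have vs0 (T : finType) r : vscale r (0 : {ffun T -> R}) = 0.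
  by apply/ffunP => i; rewrite !ffunE mulr0.
have c0 x : cross (0 : vec) x = 0 by apply/ffunP => i; rewrite !ffunE !mul0r subrr.
have o0 x : outer (0 : vec) x = 0 by apply/ffunP => i; rewrite !ffunE mul0r.
have o0r x : outer x (0 : vec) = 0 by apply/ffunP => i; rewrite !ffunE mulr0.
have m0 : mod_scalar 0 = 0 by apply/ffunP => i; rewrite !ffunE mulr0 subrr.
have H2 u : lcs L 2 u -> (h u).1.1 = 0.
  move=> /(_ [set u | (h u).1.1 = 0]); apply; split=> [|_ [x _ [y _ <-]] /=]; last by rewrite hB.
  split=> [|r x y /= hx hy]; first by rewrite /= h0.
  by rewrite hL /= hx hy vs0 addr0.
have H3 u : lcs L 3 u -> (h u).1.1 = 0 /\ (h u).1.2 = 0.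
  move=> /(_ [set u | (h u).1.1 = 0 /\ (h u).1.2 = 0]); apply; split=> [|_ [x x2 [y _ <-]] /=]; last first.
    by rewrite hB /= (H2 x x2) c0.
  split=> [|r x y /= [hx hx'] [hy hy']]; first by rewrite /= h0.
  by rewrite hL /= hx hy hx' hy' !vs0 !addr0.
split=> // u; move=> /(_ [set u | h u = 0]); apply; split=> [|_ [x x2 [y _ <-]] /=]; last first.
  have [e1 e2] := H3 x x2; rewrite hB /model_br e1 e2 c0 o0 o0r subr0 m0 //.
split=> [|r x y /= hx hy]; first by rewrite /= h0.
by rewrite hL hx hy addr0; apply: coords_eq; rewrite /= vs0.
Qed.
End Model.

Section Evaluation.
Variable R : comNzRingType.
Local Notation coords := (coords R).
Local Notation term := (lie_term int 'I_3).

Definition basis1 (i : 'I_3) : {ffun 'I_3 -> R} := [ffun k => (k == i)%:R].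

Fixpoint model_eval (s : term) : coords :=
  match s with
  | LGen i => (basis1 i, 0, 0)
  | LZero => 0
  | LAdd s t => model_eval s + model_eval t
  | LScale z s => cscale z%:~R (model_eval s)
  | LBr s t => model_br (model_eval s) (model_eval t)
  end.

Lemma model_eval_eq (s t : term) : lie_eq s t -> model_eval s = model_eval t.
Proof.
elim=> //=; do ?by [move=> *; congruence].
- by move=> *; rewrite addrA.
- by move=> *; rewrite addrC.
- by move=> *; rewrite add0r.
- by move=> u; rewrite -[X in _ + X]cscale1 -cscaleDl rmorphN1 addNr cscale0.
- by move=> *; rewrite cscaleA rmorphM.
- by move=> *; rewrite cscale1.
- by move=> *; rewrite cscaleDr.
- by move=> *; rewrite rmorphD cscaleDl.
- by move=> *; rewrite model_brDl.
- by move=> *; rewrite model_brDr.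
- by move=> *; rewrite model_brZl.
- by move=> *; rewrite model_brZr.
- by move=> *; rewrite model_brxx.
- by move=> *; rewrite model_jacobi.
Qed.

Local Notation free := (free_lie int 'I_3).
(** The universal property of the free Lie ring, for the model. *)
Definition free_model (u : free) : coords := model_eval (generic_quotient.repr u).
Lemma free_modelE s : free_model (\pi_(free) s)%qT = model_eval s.
Proof. by apply: model_eval_eq; apply/free_lieP; rewrite reprK. Qed.

Lemma free_model_lin r u v : free_model (r *: u + v) = cscale r%:~R (free_model u) + free_model v.
Proof.
by rewrite -(reprK u) -(reprK v) [_ *: _]free_scaleE [_ + _]free_addE !free_modelE.
Qed.
Lemma free_model0 : free_model 0 = 0.
Proof. exact: free_modelE. Qed.
Lemma free_model_br u v : free_model (lie_br u v) = model_br (free_model u) (free_model v).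
Proof. by rewrite -(reprK u) -(reprK v) [lie_br _ _]free_brE !free_modelE. Qed.

Local Notation nil := (free_nilpotent_lie_ring 3 3).
Local Notation proj := (quot_proj (lcs_ideal free 4).1).

(** The model has class 3, so evaluation factors through the free nilpotent ring. *)
Definition nil_model (m : nil) : coords := free_model (quot_repr m).
Lemma nil_modelE u : nil_model (proj u) = free_model u.
Proof.
have [_ _ H4] := model_lcs free_model_lin free_model0 free_model_br.
rewrite /nil_model; set v := quot_repr _.
have : lcs free 4 (v - u) by apply/(quot_projP (lcs_ideal free 4).1); rewrite quot_reprK.
move/H4; rewrite -[v - u]addrC -scaleN1r free_model_lin => e.
apply/eqP; rewrite -subr_eq0 addrC; apply/eqP; rewrite -e; congr (_ + _).
by apply: coords_eq; apply/ffunP => i; rewrite !ffunE rmorphN1 mulN1r.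
Qed.
Lemma nil_model_lin (r : int) (u v : nil) : nil_model (r *: u + v) = cscale r%:~R (nil_model u) + nil_model v.
Proof.
rewrite -(quot_reprK u) -(quot_reprK v).
rewrite -[r *: _]quot_projZ -quot_projD !nil_modelE; exact: free_model_lin.
Qed.
Lemma nil_model_br (u v : nil) : nil_model (lie_br u v) = model_br (nil_model u) (nil_model v).
Proof.
by rewrite -(quot_reprK u) -(quot_reprK v) -[lie_br _ _]quot_projBr !nil_modelE free_model_br.
Qed.

Local Notation L := (base_change nil R).
Definition nil_incl (m : nil) : L := pure_tensor m 1.

Definition tensor_model (u : L) : coords := tens_lift (fun m r => cscale r (nil_model m)) u.
Let nil_modelD u v : nil_model (u + v) = nil_model u + nil_model v.
Proof. by rewrite -{1}[u]scale1r nil_model_lin cscale1. Qed.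

Lemma tensor_model_pure m r : tensor_model (pure_tensor m r) = cscale r (nil_model m).
Proof.
apply: tens_lift_pure => [m1 m2 r1|m1 r1 r2]; first by rewrite nil_modelD cscaleDr.
exact: cscaleDl.
Qed.
Lemma tensor_modelD u v : tensor_model (u + v) = tensor_model u + tensor_model v.
Proof.
apply: tens_liftD => [m1 m2 r1|m1 r1 r2]; first by rewrite nil_modelD cscaleDr.
exact: cscaleDl.
Qed.
Lemma tensor_model0 : tensor_model 0 = 0.
Proof. by apply: (addrI (tensor_model 0)); rewrite -tensor_modelD !addr0. Qed.
Lemma tensor_modelZ r u : tensor_model (r *: u) = cscale r (tensor_model u).
Proof.
elim/tensor_ind: u => [m s|u v hu hv].
  by rewrite [_ *: _]scale_pure !tensor_model_pure cscaleA.
by rewrite scalerDr !tensor_modelD hu hv cscaleDr.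
Qed.
Lemma tensor_model_lin r u v : tensor_model (r *: u + v) = cscale r (tensor_model u) + tensor_model v.
Proof. by rewrite tensor_modelD tensor_modelZ. Qed.
Lemma tensor_model_br u v : tensor_model (lie_br u v) = model_br (tensor_model u) (tensor_model v).
Proof.
elim/tensor_ind: u => [m r|u u' hu hu']; last first.
  by rewrite lie_brDl !tensor_modelD hu hu' model_brDl.
elim/tensor_ind: v => [m' r'|v v' hv hv']; last first.
  by rewrite lie_brDr !tensor_modelD hv hv' model_brDr.
rewrite [lie_br _ _]tens_br_pure !tensor_model_pure nil_model_br.
by rewrite model_brZl model_brZr cscaleA.
Qed.

Lemma nil_incl_br m m' : lie_br (nil_incl m) (nil_incl m') = nil_incl (lie_br m m').
Proof. by rewrite [lie_br _ _]tens_br_pure mulr1. Qed.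

(** Normal forms in degrees 1, 2 and 3. *)
Definition gen (i : 'I_3) : L := nil_incl (proj (free_gen int i)).
Definition elt1 (x : {ffun 'I_3 -> R}) : L := \sum_i x i *: gen i.
Definition elt2 (w : {ffun 'I_3 -> R}) : L :=
  \sum_(i : 'I_3) w i *: lie_br (gen (i + 1)) (gen (i + 2%:R)).
Definition elt3 (z : {ffun 'I_3 * 'I_3 -> R}) : L :=
  \sum_(ij : 'I_3 * 'I_3) z ij *: lie_br (lie_br (gen (ij.1 + 1)) (gen (ij.1 + 2%:R))) (gen ij.2).

Lemma tensor_model_gen i : tensor_model (gen i) = (basis1 i, 0, 0).
Proof. by rewrite /gen /nil_incl tensor_model_pure cscale1 nil_modelE free_modelE. Qed.

Lemma sum33 (V : nmodType) (f : 'I_3 * 'I_3 -> V) : \sum_ij f ij = \sum_i \sum_j f (i, j).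
Proof. by rewrite pair_bigA; apply: eq_bigr => -[]. Qed.

Lemma elt1_br x y : lie_br (elt1 x) (elt1 y) = elt2 (cross x y).
Proof.
rewrite /elt1 /elt2 !sum3 !ffunE !(add0r, ord3D).
move: (gen 0) (gen 1) (gen 2%:R) => g0 g1 g2.
rewrite !(lie_brDl, lie_brDr, lie_brZl, lie_brZr, lie_brxx) !scaler0 !add0r !addr0.
rewrite (lie_brC g1 g0) (lie_brC g0 g2) (lie_brC g2 g1) !scalerN !scalerBl !scalerA.
set a := lie_br g1 g2; set b := lie_br g2 g0; set c := lie_br g0 g1.
by rewrite [LHS](AC (2*2*2) ((4*6)*(5*2)*(1*3))).
Qed.

Lemma elt2_br w y : lie_br (elt2 w) (elt1 y) = elt3 (outer w y).
Proof.
rewrite /elt1 /elt2 /elt3 sum33 lie_br_suml; apply: eq_bigr => i _.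
rewrite lie_br_sumr; apply: eq_bigr => j _ /=.
by rewrite ffunE lie_brZl lie_brZr scalerA.
Qed.

(** The Jacobi identity for the three generators. *)
Lemma elt3_scalar r : elt3 (vscale r idmx) = 0.
Proof.
rewrite /elt3 sum33 (eq_bigr (fun i => r *: lie_br (lie_br (gen (i + 1)) (gen (i + 2%:R))) (gen i))); last first.
  move=> i _; rewrite (bigD1 i) //= big1 ?addr0 => [|j ij]; first by rewrite !ffunE eqxx mulr1.
  by rewrite !ffunE /= eq_sym (negPf ij) mulr0 scale0r.
rewrite -scaler_sumr sum3.
rewrite !(add0r, ord3D).
move: (gen 0) (gen 1) (gen 2%:R) => g0 g1 g2.
rewrite (lie_brC (lie_br g1 g2)) (lie_brC (lie_br g2 g0)) (lie_brC (lie_br g0 g1)).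
by rewrite -!opprD lie_jacobi oppr0 scaler0.
Qed.

Lemma elt1_lin r x y : elt1 (vscale r x + y) = r *: elt1 x + elt1 y.
Proof.
rewrite /elt1 scaler_sumr -big_split; apply: eq_bigr => i _ /=.
by rewrite !ffunE scalerDl scalerA.
Qed.
Lemma elt2_lin r x y : elt2 (vscale r x + y) = r *: elt2 x + elt2 y.
Proof.
rewrite /elt2 scaler_sumr -big_split; apply: eq_bigr => i _ /=.
by rewrite !ffunE scalerDl scalerA.
Qed.
Lemma elt3_lin r x y : elt3 (vscale r x + y) = r *: elt3 x + elt3 y.
Proof.
rewrite /elt3 scaler_sumr -big_split; apply: eq_bigr => i _ /=.
by rewrite !ffunE scalerDl scalerA.
Qed.

Lemma elt2_lcs w : lcs L 2 (elt2 w).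
Proof.
have [N0 NZ] := lcs_submodule L 2.
apply: (big_ind (lcs L 2)) => // [x y xL yL|i _]; first by rewrite -[x]scale1r; apply: NZ.
rewrite -[_ *: _]addr0; apply: NZ => //; exact: lcs_br1.
Qed.
Lemma elt3_lcs z : lcs L 3 (elt3 z).
Proof.
have [N0 NZ] := lcs_submodule L 3.
apply: (big_ind (lcs L 3)) => // [x y xL yL|i _]; first by rewrite -[x]scale1r; apply: NZ.
rewrite -[_ *: _]addr0; apply: NZ => //; apply: lcs_br1; exact: lcs_br1.
Qed.

(** The generators span modulo commutators, by induction on tensors and on Lie terms; the
    spanning in degrees 2 and 3 follows by taking brackets of normal forms. *)
Lemma span1 (u : L) : exists x, lcs L 2 (u - elt1 x).
Proof.
have [N0 NZ] := lcs_submodule L 2.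
pose P (u : L) := exists x, lcs L 2 (u - elt1 x).
have PZ r u1 u2 : P u1 -> P u2 -> P (r *: u1 + u2).
  move=> [x hx] [y hy]; exists (vscale r x + y); rewrite elt1_lin.
  by rewrite opprD addrACA -scalerBr; apply: NZ.
have z1 : elt1 0 = 0 by apply: big1 => i _; rewrite ffunE scale0r.
have P0 : P 0 by exists 0; rewrite z1 subrr.
have inclD m m' : nil_incl (m + m') = nil_incl m + nil_incl m' by exact: pureDl.
have inclZ (z : int) m : nil_incl (z *: m) = z%:~R *: nil_incl m.
  have inclN m' : nil_incl (- m') = - nil_incl m' by exact: pureNl.
  have inclMn m' n : nil_incl (m' *+ n) = nil_incl m' *+ n.
    by elim: n => [|n IH]; rewrite ?mulr0n ?mulrS ?inclD ?IH //; exact: pure0l.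
  rewrite scaler_int -{1}(intz z) scaler_int; case: z => n; first by rewrite -!pmulrn inclMn.
  by rewrite NegzE !mulrNz -!pmulrn inclN inclMn.
have Pm (m : nil) : P (nil_incl m).
  rewrite -(quot_reprK m) -(reprK (quot_repr m)); elim: (generic_quotient.repr _) => {m} [i||s Ps t Pt|z s Ps|s Ps t Pt].
  - exists (basis1 i); rewrite /elt1 (bigD1 i) //= ffunE eqxx scale1r big1 ?addr0 ?subrr // => j ji.
    by rewrite ffunE (negPf ji) scale0r.
  - have proj0 : proj (\pi_(free) (@LZero int 'I_3))%qT = 0.
      by apply/(quot_proj0 (lcs_ideal free 4).1); have [] := lcs_submodule free 4.
    by rewrite /nil_incl proj0 [pure_tensor _ _]pure0l.
  - rewrite -free_addE.
    rewrite (_ : nil_incl _ = 1 *: nil_incl (proj (\pi s)%qT) + nil_incl (proj (\pi t)%qT)); last first.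
      by rewrite scale1r -inclD; congr nil_incl; rewrite -quot_projD.
    exact: PZ.
  - rewrite -free_scaleE (_ : nil_incl _ = z%:~R *: nil_incl (proj (\pi s)%qT) + 0); last first.
      by rewrite addr0 -inclZ; congr nil_incl; rewrite -[z *: _]quot_projZ.
    exact: PZ.
  - rewrite -free_brE (_ : nil_incl _ = lie_br (nil_incl (proj (\pi s)%qT)) (nil_incl (proj (\pi t)%qT))); last first.
      by rewrite nil_incl_br; congr nil_incl; rewrite -[lie_br _ _]quot_projBr.
    by exists 0; rewrite z1 subr0; apply: lcs_br1.
change (P u); elim/tensor_ind: u => [m r|u v Pu Pv]; last by rewrite -[u]scale1r; apply: PZ.
rewrite (_ : pure_tensor m r = r *: nil_incl m + 0); first exact: PZ.
by rewrite addr0 [RHS]scale_pure mulr1.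
Qed.

Lemma span2 (u : L) : lcs L 2 u -> exists w, lcs L 3 (u - elt2 w).
Proof.
have [N0 NZ] := lcs_submodule L 3.
have z2 : elt2 0 = 0 by apply: big1 => i _; rewrite ffunE scale0r.
move=> /(_ [set u | exists w, lcs L 3 (u - elt2 w)]); apply; split=> [|_ [x _ [y _ <-]] /=].
  split=> [|r a b [x hx] [y hy]]; first by exists 0; rewrite z2 subrr.
  by exists (vscale r x + y); rewrite elt2_lin opprD addrACA -scalerBr; apply: NZ.
have [a ha] := span1 x; have [b hb] := span1 y; exists (cross a b); rewrite -elt1_br.
rewrite -{1}(subrK (elt1 a) x) lie_brDl -{2}(subrK (elt1 b) y) lie_brDr addrA addrK.
rewrite -[lie_br (_ - _) _]scale1r; apply: (NZ); first exact: lcs_br1.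
rewrite lie_brC -scaleN1r -[_ *: _]addr0; apply: (NZ) => //; exact: lcs_br1.
Qed.

Lemma span3 (u : L) : lcs L 3 u -> exists z, lcs L 4 (u - elt3 z).
Proof.
have [N0 NZ] := lcs_submodule L 4.
have z3 : elt3 0 = 0 by apply: big1 => i _; rewrite ffunE scale0r.
move=> /(_ [set u | exists w, lcs L 4 (u - elt3 w)]); apply; split=> [|_ [x x2 [y _ <-]] /=].
  split=> [|r a b [x hx] [y hy]]; first by exists 0; rewrite z3 subrr.
  by exists (vscale r x + y); rewrite elt3_lin opprD addrACA -scalerBr; apply: NZ.
have [a ha] := span2 x2; have [b hb] := span1 y; exists (outer a b); rewrite -elt2_br.
rewrite -{1}(subrK (elt2 a) x) lie_brDl -{2}(subrK (elt1 b) y) lie_brDr addrA addrK.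
rewrite -[lie_br (_ - _) _]scale1r; apply: (NZ); first exact: lcs_br1.
apply: (@lcs_br _ _ 1 1) => //; exact: elt2_lcs.
Qed.

Lemma tensor_model_elt1 x : (tensor_model (elt1 x)).1.1 = x.
Proof.
rewrite /elt1 sum3 !tensor_modelD !tensor_modelZ !tensor_model_gen /=.
by apply/ffunP; elim/ord3P; rewrite !ffunE /= ?(mulr0, mulr1, addr0, add0r).
Qed.
Lemma tensor_model_br_gen i : tensor_model (lie_br (gen (i + 1)) (gen (i + 2%:R))) = (0, basis1 i, 0).
Proof.
rewrite tensor_model_br !tensor_model_gen; apply: coords_eq; rewrite /model_br //=.
  apply/ffunP => k; rewrite !ffunE.
  by elim/ord3P: i; elim/ord3P: k; rewrite !(add0r, ord3D) /= ?(mulr0, mulr1, subr0, sub0r, subrr, oppr0).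
by apply/ffunP => ij; rewrite !ffunE; ring.
Qed.
Lemma tensor_model_elt2 w : (tensor_model (elt2 w)).1.2 = w.
Proof.
rewrite /elt2 sum3 !tensor_modelD !tensor_modelZ !tensor_model_br_gen /=.
by apply/ffunP; elim/ord3P; rewrite !ffunE /= ?(mulr0, mulr1, addr0, add0r).
Qed.
Lemma mod_scalarD z z' : mod_scalar (z + z') = mod_scalar z + mod_scalar z' :> {ffun _ -> R}.
Proof. by apply/ffunP => ij; rewrite !ffunE; ring. Qed.
Lemma mod_scalarZ r z : mod_scalar (vscale r z) = vscale r (mod_scalar z) :> {ffun _ -> R}.
Proof. by apply/ffunP => ij; rewrite !ffunE; ring. Qed.
Lemma tensor_model_elt3 z : (tensor_model (elt3 z)).2 = mod_scalar z.
Proof.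
pose f ij : L := z ij *: lie_br (lie_br (gen (ij.1 + 1)) (gen (ij.1 + 2%:R))) (gen ij.2).
have m0 : mod_scalar 0 = 0 :> {ffun 'I_3 * 'I_3 -> R}.
  by apply/ffunP => i; rewrite !ffunE mulr0 subrr.
have -> : (tensor_model (elt3 z)).2 = \sum_ij (tensor_model (f ij)).2.
  by apply: (big_morph (fun u => (tensor_model u).2)) => [u v|]; rewrite ?tensor_modelD ?tensor_model0.
have -> : mod_scalar z = \sum_ij mod_scalar (vscale (z ij) (outer (basis1 ij.1) (basis1 ij.2))).
  rewrite -(big_morph _ mod_scalarD m0); congr mod_scalar.
  apply/ffunP => -[k h]; rewrite sum_ffunE (bigD1 (k, h)) //= !ffunE /= !eqxx !mulr1 big1 ?addr0 // => -[i j].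
  rewrite xpair_eqE negb_and !ffunE /= => /orP[ne|ne]; rewrite eq_sym in ne; rewrite (negPf ne) ?(mul0r, mulr0) //.
  apply: eq_bigr => ij _; rewrite /f tensor_modelZ tensor_model_br tensor_model_br_gen tensor_model_gen /=.
rewrite -mod_scalarZ; congr mod_scalar; congr vscale.
by apply/ffunP => kh; rewrite !ffunE mul0r subr0.
Qed.

Local Notation H := (model_lcs tensor_model_lin tensor_model0 tensor_model_br).

Let class_lin n r u v : lcs L n u -> lcs L n v ->
  factor_class n (r *: u + v) = r *: factor_class n u + factor_class n v.
Proof.
have [N0 NZ] := lcs_submodule L n => un vn.
rewrite factor_classD ?factor_classZ //.
by rewrite -[_ *: _]addr0; apply: NZ.
Qed.
Let class0 n u : lcs L n u -> factor_class n u = 0 <-> lcs L n.+1 u.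
Proof.
have [N0 NZ] := lcs_submodule L n => un.
by rewrite -(factor_class0 L n) factor_classP // subr0.
Qed.

Let lcs1 (u : L) : lcs L 1 u. Proof. exact: Logic.I. Qed.

(** The normal forms span each factor; they are independent up to scalar matrices because
    the model recovers the coordinates. *)
Definition free_nilpotent_frame : graded_frame L.
Proof.
have [H2 H3 H4] := H.
refine (@GradedFrame _ L (fun x => factor_class 1 (elt1 x)) (fun w => factor_class 2 (elt2 w))
   (fun z => factor_class 3 (elt3 z)) _ _ _ _ _ _ _ _ _ _ _).
- by move=> r x y; rewrite elt1_lin class_lin.
- by move=> r x y; rewrite elt2_lin class_lin //; apply: elt2_lcs.
- by move=> r x y; rewrite elt3_lin class_lin //; apply: elt3_lcs.
- move=> u; have [x hx] := span1 (factor_repr u); exists x; rewrite -{1}(factor_reprK u).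
  by apply/factor_classP; first exact: lcs1; first exact: lcs1.
- move=> u; have [x hx] := span2 (factor_repr_in u); exists x; rewrite -{1}(factor_reprK u).
  by apply/factor_classP => //; [exact: factor_repr_in|exact: elt2_lcs].
- move=> u; have [x hx] := span3 (factor_repr_in u); exists x; rewrite -{1}(factor_reprK u).
  by apply/factor_classP => //; [exact: factor_repr_in|exact: elt3_lcs].
- by move=> x /(class0 (lcs1 (elt1 x)))/H2; rewrite tensor_model_elt1.
- by move=> w /(class0 (elt2_lcs w))/H3[_]; rewrite tensor_model_elt2.
- move=> z; rewrite class0; last exact: elt3_lcs.
  split=> [/H4 z0|[r ->]]; last by rewrite elt3_scalar; have [] := lcs_submodule L 4.
  have := tensor_model_elt3 z; rewrite z0 /= => m0; exists (z (0, 0)); apply/ffunP => ij.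
  have := congr1 (fun f : {ffun _ -> R} => f ij) m0; rewrite !ffunE => /esym/eqP.
  by rewrite subr_eq0 mulrC => /eqP.
- by move=> x y; rewrite (@factor_brE _ L 0 0) ?elt1_br.
- by move=> w y; rewrite (@factor_brE _ L 1 0) ?elt2_br //; apply: elt2_lcs.
Defined.
End Evaluation.

(** * The p-adic integers and the field of p-adic numbers *)

Section PadicIntegers.
Variables (p : nat) (p_pr : prime p).
Local Notation Zp := (padic_int p_pr).
Local Notation pZ n := ((p ^ n)%N%:Z).

Let p_gt1 := prime_gt1 p_pr.
Let pn_gt0 n : 0 < pZ n.
Proof. by rewrite ltz_nat expn_gt0 prime_gt0. Qed.
Let pn_neq0 n : pZ n != 0.
Proof. by rewrite gt_eqF. Qed.

Lemma padic_coh (x : Zp) n : val x n = (val x n.+1 %% pZ n)%Z.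
Proof. exact: (asboolW (valP x)). Qed.
Lemma padic_bound (x : Zp) n : 0 <= val x n < pZ n.
Proof. by rewrite padic_coh modz_ge0 // ltz_pmod. Qed.
Lemma padic_modz (x : Zp) n : (val x n %% pZ n)%Z = val x n.
Proof. by rewrite [in LHS]padic_coh modz_mod -padic_coh. Qed.
Lemma padic_eq (x y : Zp) : (forall n, val x n = val y n) -> x = y.
Proof. by move=> xy; apply: val_inj; apply/funext. Qed.
Lemma padic_val0 (x : Zp) : val x 0%N = 0.
Proof. by have := padic_bound x 0; rewrite expn0; lia. Qed.
Lemma padic_val_nat k n : val (k%:R : Zp) n = (k%:Z %% pZ n)%Z.
Proof.
elim: k => [|k IH]; first by [].
rewrite mulrS; transitivity (((1 %% pZ n)%Z + val (k%:R : Zp) n) %% pZ n)%Z; first by [].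
by rewrite IH modzDml modzDmr -add1n PoszD.
Qed.

Lemma padic_modD (x : Zp) n k : (val x (n + k)%N %% pZ n)%Z = val x n.
Proof.
elim: k => [|k IH]; first by rewrite addn0 padic_modz.
by rewrite -[RHS]IH [val x (n + k)%N]padic_coh modz_dvdm ?addnS // expnD PoszM dvdz_mulr.
Qed.

(** The quotient has the residues [x_(n+m) / p^m]. *)
Lemma padic_val_dvd (x : Zp) m : val x m = 0 -> exists y, x = (p ^ m)%:R * y.
Proof.
move=> xm.
have dv n : (pZ m %| val x (n + m)%N)%Z.
  elim: n => [|n IH]; first by rewrite xm dvdz0.
  have := padic_coh x (n + m); rewrite addSn => e.
  rewrite (divz_eq (val x (n + m).+1) (pZ (n + m))) -e rpredD //.
  by rewrite expnD PoszM mulrA dvdz_mull.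
have aP n : ((val x (n + m)%N %/ pZ m)%Z = (val x (n.+1 + m)%N %/ pZ m)%Z %[mod pZ n])%Z.
  have e := divz_eq (val x (n.+1 + m)%N) (pZ (n + m)); rewrite addSn -padic_coh in e.
  rewrite [in RHS]e addrC expnD PoszM mulrA divzDr; last exact: dvdz_mull.
  by rewrite mulzK // addrC modzMDl.
exists (padic_mk p_pr aP); apply: padic_eq => n.
transitivity ((val ((p ^ m)%:R : Zp) n * ((val x (n + m)%N %/ pZ m)%Z %% pZ n)%Z) %% pZ n)%Z; last by [].
rewrite padic_val_nat modzMml modzMmr mulrC divzK //.
by rewrite padic_modD.
Qed.

(** Inverses modulo all the [p^n] are coherent because they are unique. *)
Lemma padic_unitP (x : Zp) : val x 1%N != 0 -> exists y, y * x = 1.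
Proof.
move=> x1.
have co n : exists u, (u * val x n = 1 %[mod pZ n])%Z.
  have [u [v uv]] := Bezoutz (val x n) (pZ n); exists u.
  suff -> : u * val x n = 1 + (- v) * pZ n by rewrite addrC modzMDl.
  have -> : 1 = gcdz (val x n) (pZ n); last by rewrite -uv; ring.
  case: n {u v uv} => [|n]; first by rewrite expn0 gcdz1.
  apply/esym/eqP; rewrite -[_ == 1]/(coprimez _ _) coprimezE /= coprimeXr //.
  rewrite coprime_sym prime_coprime //; apply: contra x1 => dv.
  rewrite -(padic_modD x 1 n) expn1 add1n; apply/eqP/dvdz_mod0P.
  by rewrite dvdzE.
have [b bP] := choice co.
have aP n : (b n = b n.+1 %[mod pZ n])%Z.
  have e : (b n.+1 * val x n = 1 %[mod pZ n])%Z.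
    have /(congr1 (fun z => z %% pZ n)%Z) := bP n.+1.
    have dn : (pZ n %| pZ n.+1)%Z by rewrite expnS PoszM dvdz_mull.
    by rewrite !modz_dvdm // (padic_coh x n) modzMmr.
  have -> : (b n = b n * (b n.+1 * val x n) %[mod pZ n])%Z by rewrite -modzMmr e modzMmr mulr1.
  by rewrite mulrCA -modzMmr bP modzMmr mulr1.
exists (padic_mk p_pr aP); apply: padic_eq => n.
transitivity (((b n %% pZ n)%Z * val x n) %% pZ n)%Z; first by [].
by rewrite modzMml bP.
Qed.

(** If [k + 1] is the least index of a nonzero residue of [x], then [p^k] divides [x], and the
    quotient has a nonzero residue modulo [p]. *)
Lemma padic_factor (x : Zp) : x != 0 -> exists k u v, v * u = 1 /\ x = (p ^ k)%:R * u.
Proof.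
move=> x0.
have ex : exists n, val x n != 0.
  apply: contrapT => h; case/eqP: x0; apply: padic_eq => n.
  rewrite [RHS](padic_val_nat 0) mod0z.
  by apply/eqP/negPn/negP => xn; apply: h; exists n.
case: (ex_minnP ex) => -[|k] xk kmin; first by rewrite padic_val0 eqxx in xk.
have [|u xE] := @padic_val_dvd x k.
  by apply/eqP/negPn/negP => /kmin; rewrite ltnn.
have [|v vu] := @padic_unitP u; last by exists k, u, v.
apply: contra xk => /eqP/(@padic_val_dvd u 1)[w uE].
rewrite xE uE mulrA -natrM -expnD addn1.
have -> : val ((p ^ k.+1)%:R * w : Zp) k.+1 = ((val ((p ^ k.+1)%:R : Zp) k.+1 * val w k.+1) %% pZ k.+1)%Z.
  by [].
by rewrite padic_val_nat modzz mul0r mod0z.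
Qed.

(** [Z_p] is a valuation ring. *)
Lemma padic_dvd_total (x y : Zp) : (exists z, x = y * z) \/ (exists z, y = x * z).
Proof.
have [->|x0] := eqVneq x 0; first by left; exists 0; rewrite mulr0.
have [->|y0] := eqVneq y 0; first by right; exists 0; rewrite mulr0.
have [i [u [u' [uu ->]]]] := padic_factor x0; have [j [v [v' [vv ->]]]] := padic_factor y0.
have H a b (s t t' : Zp) : t' * t = 1 -> (b <= a)%N -> exists z, (p ^ a)%:R * s = (p ^ b)%:R * t * z.
  move=> tt ba; exists ((p ^ (a - b))%:R * (s * t')); rewrite -(subnK ba) expnD natrM addnK.
  by rewrite -[LHS]mulr1 -tt; ring.
by have [ij|/ltnW ij] := leqP j i; [left|right]; apply: H ij; eassumption.
Qed.
End PadicIntegers.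

Section Residues.
Variables (p : nat) (p_pr : prime p) (m : nat) (m_gt0 : (0 < m)%N).
Local Notation Zp := (padic_int p_pr).

Let pm_gt1 : (1 < p ^ m)%N.
Proof. by rewrite -(exp1n m) ltn_exp2r // prime_gt1. Qed.

Definition residue (x : Zp) : 'Z_(p ^ m) := let _ := m_gt0 in (val x m)%:~R.

Let intr_modz (a : int) : (a %% (p ^ m)%N%:Z)%Z%:~R = a%:~R :> 'Z_(p ^ m).
Proof. by rewrite [in RHS](divz_eq a (p ^ m)%N) [in RHS]intrD intrM -pmulrn pchar_Zp // mulr0 add0r. Qed.

Fact residue_zmod_morphism : zmod_morphism residue.
Proof.
move=> x y; rewrite /residue.
have -> : val (x - y) m = ((val x m + (- val y m %% (p ^ m)%N%:Z)%Z) %% (p ^ m)%N%:Z)%Z by [].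
by rewrite intr_modz intrD intr_modz mulrNz.
Qed.
Fact residue_monoid_morphism : monoid_morphism residue.
Proof.
split; rewrite /residue.
  have -> : val (1 : Zp) m = (1 %% (p ^ m)%N%:Z)%Z by [].
  by rewrite intr_modz.
move=> x y; have -> : val (x * y) m = ((val x m * val y m) %% (p ^ m)%N%:Z)%Z by [].
by rewrite intr_modz intrM.
Qed.
HB.instance Definition _ := GRing.isZmodMorphism.Build Zp 'Z_(p ^ m) residue residue_zmod_morphism.
HB.instance Definition _ := GRing.isMonoidMorphism.Build Zp 'Z_(p ^ m) residue residue_monoid_morphism.

Lemma residue_ker (x : Zp) : residue x = 0 -> exists y, x = (p ^ m)%:R * y.
Proof.
rewrite /residue => x0; apply: padic_val_dvd.
have := padic_bound x m; case: (val x m) x0 => // a; rewrite -pmulrn => a0 /andP[_].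
rewrite ltz_nat => am; congr Posz.
by have := congr1 val a0; rewrite /= val_Zp_nat // modn_small.
Qed.
End Residues.

(** A valuation ring is integrally closed: if [x] is not in [A] then [c = x^-1] is, and
    multiplying the integral equation of [x] by [c^k], where [k + 1] is its degree, expresses
    [x] as a polynomial in [c]. *)
Lemma valuation_integrally_closed (A : idomainType) (x : {fraction A}) :
  (forall a b : A, (exists c, a = b * c) \/ (exists c, b = a * c)) ->
  integralOver (@tofrac A) x -> exists a : A, x = tofrac a.
Proof.
move=> dvd_total; have [n [d [d0 xE]]] := fraction_numden x.
have d0' : tofrac d != 0 by rewrite tofrac_eq0.
case: (dvd_total n d) => [[c nE] _|[c dE]].
  by exists c; rewrite xE nE rmorphM /= mulrAC divff ?mul1r.
have : n * c != 0 by rewrite -dE.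
rewrite mulf_eq0 negb_or => /andP[n0 c0].
have {}xE : x * tofrac c = 1.
  rewrite xE dE rmorphM /=; move: (tofrac n) (tofrac c) (tofrac_eq0 n) (tofrac_eq0 c) => N C.
  by rewrite (negPf n0) (negPf c0) => /negbT N0 /negbT C0; rewrite invfM mulrA divff // mul1r mulVf.
case=> P P_monic Px.
have szP : size P = (size P).-1.+1 by rewrite prednK // size_poly_gt0 monic_neq0.
case k_eq : (size P).-1 => [|k].
  move: Px; have -> : P = 1.
    rewrite [LHS]size1_polyC; last by rewrite szP k_eq.
    congr (_%:P).
    by rewrite -(monicP P_monic) /lead_coef k_eq.
  by rewrite rmorph1 /root hornerC oner_eq0.
exists (- \sum_(i < k.+1) P`_i * c ^+ (k - i)).
have: (map_poly (@tofrac _) P).[x] * tofrac c ^+ k = 0 by rewrite (eqP Px) mul0r.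
rewrite (@horner_coef_wide _ k.+2); last first.
  by rewrite (leq_trans (size_poly _ _)) // szP k_eq.
rewrite big_ord_recr /= mulrDl coef_map /=.
have -> : P`_k.+1 = 1 by rewrite -k_eq -[P`_(size P).-1]/(lead_coef P) (monicP P_monic).
rewrite rmorph1 mul1r exprS -mulrA -exprMn xE expr1n mulr1.
move/eqP; rewrite addrC addr_eq0 => /eqP ->; rewrite rmorphN rmorph_sum mulr_suml; congr (- _).
apply: eq_bigr => i _; rewrite coef_map rmorphM rmorphXn -mulrA; congr (_ * _) => /=.
have -> : tofrac c ^+ k = tofrac c ^+ (k - i) * tofrac c ^+ i by rewrite -exprD subnK // -ltnS.
rewrite mulrCA -exprMn xE.
by rewrite expr1n mulr1.
Qed.

Lemma eq_integralOver (A B : nzRingType) (f g : A -> B) (x : B) :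
  f =1 g -> integralOver f x -> integralOver g x.
Proof. by move=> fg [P P_monic Px]; exists P; rewrite -?(eq_map_poly fg). Qed.
Lemma integralOver_regular (A : nzRingType) (F : fieldType) (f : A -> F) (x : F) :
  @integralOver A F^o f x <-> @integralOver A F f x.
Proof. by []. Qed.

(** A ring with a reduction to [Z/p] of kernel [p A], in which all elements outside [p A] are
    units, is local with residue field [Z/p]. *)
Lemma residue_card_prime (A : comNzRingType) (p : nat) (f : {rmorphism A -> 'Z_p}) : (1 < p)%N ->
  (forall x, f x = 0 -> exists y, x = p%:R * y) ->
  (forall x, f x <> 0 -> exists y, y * x = 1) -> residue_card A p.
Proof.
move=> p_gt1 f_ker f_unit; pose I : set A := [set x | exists y, x = p%:R * y].
have Is : is_submodule (I : set A^o).
  split=> [|a x y [x' ->] [y' ->]]; first by exists 0; rewrite mulr0.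
  by exists (a * x' + y'); rewrite /= mulrDr mulrCA.
have If x : I x <-> f x = 0.
  by split=> [[y ->]|/f_ker //]; rewrite rmorphM rmorph_nat pchar_Zp // mul0r.
pose h (u : 'Z_p) : set A := [set y | f y = u].
have h_inj : injective h.
  move=> u v huv; have : h u (val u)%:R by rewrite /h /= rmorph_nat natr_Zp.
  by rewrite huv /h /= rmorph_nat natr_Zp.
have cE : cosets (I : set A^o) = h @` setT.
  have E x : [set y | I (y - x)] = h (f x).
    apply/seteqP; split=> y; rewrite /h /= -/(I (y - x)) If rmorphB.
      by move/eqP; rewrite subr_eq0 => /eqP.
    by move=> ->; rewrite subrr.
  apply/seteqP; split=> [_ [x _ <-]|_ [u _ <-]]; first by exists (f x).
  by exists (val u)%:R => //; rewrite E rmorph_nat natr_Zp.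
have fin : finite_set [set: 'Z_p] by apply: finite_finset.
exists I; split; last 2 first.
- by rewrite /finite_index cE; apply: finite_image.
- rewrite /submod_index cE fset_set_image //.
  rewrite card_imfset //= (_ : fset_set setT = [fset u in enum 'Z_p]%fset).
    by rewrite card_fseq undup_id ?enum_uniq // -cardE card_ord Zp_cast.
  by apply/fsetP => u; rewrite in_fset_set // !inE mem_enum in_setT.
split=> //.
  apply/eqP => IT; have : I 1 by rewrite IT.
  by move/If; rewrite rmorph1 => /eqP; rewrite oner_eq0.
move=> J [J0 JZ] IJ; have [JI|] := pselect (J `<=` I); first by left; apply/seteqP.
move=> /existsNP[x /not_implyP[Jx nIx]]; have [|y yx] := f_unit x; first by move/If.
right; apply/seteqP; split=> // z _.
rewrite -[z]mulr1 -yx mulrA -[_ * x]addr0; exact: JZ.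
Qed.

(** The trivial extension [K = Q_p] of [Q_p], with ring of integers [Z_p]. *)
Section RationalCase.
Variables (p : nat) (p_pr : prime p).
Local Notation Zp := (padic_int p_pr).
Local Notation K := ((padic p_pr)^o : fieldExtType (padic p_pr)).
Local Notation O := (integer_ring K).

Lemma padic_int_embE (a : Zp) : padic_int_emb K a = tofrac a :> padic p_pr.
Proof. exact: mulr1. Qed.

(** [Z_p] is integrally closed in its field of fractions. *)
Lemma integral_closureP (x : padic p_pr) :
  (x : K) \in integral_closure (K := K) <-> exists a : Zp, x = tofrac a.
Proof.
have fE : (padic_int_emb K : Zp -> padic p_pr) =1 @tofrac Zp by exact: padic_int_embE.
split=> [/asboolP/integralOver_regular/(eq_integralOver fE)|[a ->]].
  exact: (valuation_integrally_closed (@padic_dvd_total p p_pr)).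
apply/asboolP/integralOver_regular/(eq_integralOver (fsym fE)).
exact: (@integral_id Zp (padic p_pr) (@tofrac Zp)).
Qed.

Fact integer_inj_proof (a : Zp) : (tofrac a : K) \in integral_closure (K := K).
Proof. by apply/integral_closureP; exists a. Qed.
Definition integer_inj (a : Zp) : O := exist (fun x : K => is_true (x \in integral_closure (K := K))) (tofrac a) (integer_inj_proof a).

Lemma integer_inj_surj (x : O) : exists a, x = integer_inj a.
Proof.
by case: x => x xi; have [a xE] := (integral_closureP x).1 xi; exists a; apply: val_inj.
Qed.

Fact integer_inj_zmod_morphism : zmod_morphism integer_inj.
Proof. by move=> a b; apply: val_inj; exact: (rmorphB (@tofrac Zp)). Qed.
Fact integer_inj_monoid_morphism : monoid_morphism integer_inj.
Proof.
split; first by apply: val_inj; exact: (rmorph1 (@tofrac Zp)).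
by move=> a b; apply: val_inj; exact: (rmorphM (@tofrac Zp)).
Qed.
HB.instance Definition _ := GRing.isZmodMorphism.Build Zp O integer_inj integer_inj_zmod_morphism.
HB.instance Definition _ := GRing.isMonoidMorphism.Build Zp O integer_inj integer_inj_monoid_morphism.

Lemma integer_inj_inj : injective integer_inj.
Proof. move=> a b /(congr1 val) ab; apply/eqP; rewrite -tofrac_eq; exact/eqP. Qed.

Definition integer_res (x : O) : Zp := projT1 (cid (integer_inj_surj x)).
Lemma integer_resK : cancel integer_res integer_inj.
Proof. by move=> x; rewrite /integer_res; case: cid. Qed.
Lemma integer_injK : cancel integer_inj integer_res.
Proof. by move=> a; apply: integer_inj_inj; rewrite integer_resK. Qed.
Fact integer_res_zmod_morphism : zmod_morphism integer_res.
Proof. exact: (can2_zmod_morphism integer_injK integer_resK). Qed.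
Fact integer_res_monoid_morphism : monoid_morphism integer_res.
Proof. exact: (can2_monoid_morphism integer_injK integer_resK). Qed.
HB.instance Definition _ := GRing.isZmodMorphism.Build O Zp integer_res integer_res_zmod_morphism.
HB.instance Definition _ := GRing.isMonoidMorphism.Build O Zp integer_res integer_res_monoid_morphism.

Lemma integer_reduction m : (0 < m)%N ->
  exists f : {rmorphism O -> 'Z_(p ^ m)}, forall x, f x = 0 -> exists y, x = (p ^ m)%:R * y.
Proof.
move=> m_gt0; pose f : {rmorphism O -> 'Z_(p ^ m)} := @residue p p_pr m m_gt0 \o integer_res.
exists f => x /(@residue_ker p p_pr m m_gt0)[y xE]; exists (integer_inj y).
by rewrite -[LHS]integer_resK xE rmorphM rmorph_nat.
Qed.

Lemma integer_unit (x : O) : ~ (exists y, x = p%:R * y) -> exists y, y * x = 1.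
Proof.
move=> ndv; case: (@padic_unitP p p_pr (integer_res x)) => [|y yx].
  apply/eqP => x1; apply: ndv; have [y xE] := padic_val_dvd x1.
  by exists (integer_inj y); rewrite -[LHS]integer_resK xE expn1 rmorphM rmorph_nat.
by exists (integer_inj y); rewrite -{1}[x]integer_resK -rmorphM yx rmorph1.
Qed.

Lemma integer_dvd_nat n : (exists y : O, n%:R = p%:R * y) <-> (p %| n)%N.
Proof.
split=> [[y nE]|/dvdnP[k ->]]; last by exists k%:R; rewrite -natrM mulnC.
have [f _] := integer_reduction (ltn0Sn 0).
have := congr1 f nE; rewrite rmorphM !rmorph_nat -{2}(expn1 p) pchar_Zp ?expn1 ?prime_gt1 // mul0r.
by move/(congr1 val) => /=; rewrite val_Zp_nat ?prime_gt1 // => /eqP.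
Qed.

Lemma integer_nat_unit n : ~~ (p %| n)%N -> exists y : O, y * n%:R = 1.
Proof. by move=> pn; apply: integer_unit; rewrite integer_dvd_nat; apply/negP. Qed.

Lemma residue_card_rational : residue_card O p.
Proof.
have [f f_ker] := integer_reduction (ltn0Sn 0); move: f f_ker; rewrite expn1 => f f_ker.
apply: (residue_card_prime (prime_gt1 p_pr) f_ker) => x fx; apply: integer_unit => -[y xE].
by apply: fx; rewrite xE rmorphM rmorph_nat pchar_Zp ?prime_gt1 // mul0r.
Qed.
End RationalCase.

(** * Zeta functions as power series *)

Import numFieldNormedType.Exports.

Section PolyBound.
Variable R : realFieldType.

Definition coef_norm (P : {poly R}) : R := \sum_(i < size P) `|P`_i|.

Lemma horner_bound (P : {poly R}) t : 0 <= t <= 1 -> `|P.[t]| <= coef_norm P.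
Proof.
move=> /andP[t0 t1]; rewrite horner_coef; apply: le_trans (ler_norm_sum _ _ _) _.
apply: ler_sum => i _; rewrite normrM ler_piMr // ger0_norm ?exprn_ge0 //.
exact: exprn_ile1.
Qed.

(** The constant coefficient differs from a value at a small [t] by [O(t)]. *)
Lemma small_poly_const (P : {poly R}) (M t1 : R) : 0 < t1 -> t1 <= 1 ->
  (forall t, 0 < t -> t <= t1 -> `|P.[t]| <= M * t ^+ 1) -> P`_0 = 0.
Proof.
move=> t10 t11 PM; have [Q PE] : exists Q, P - (P`_0)%:P = Q * 'X.
  have /factor_theorem[Q] : root (P - (P`_0)%:P) 0; last by rewrite subr0; exists Q.
  by rewrite rootE !hornerE horner_coef0 subrr.
have small t : 0 < t -> t <= t1 -> `|P`_0| <= t * (M + coef_norm Q).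
  move=> tp tle; have -> : P`_0 = P.[t] - t * Q.[t].
    by have := congr1 (horner^~ t) PE; rewrite !hornerE => e; rewrite mulrC -e; ring.
  apply: le_trans (ler_normB _ _) _; rewrite mulrDr lerD //.
    by rewrite mulrC -[X in _ * X]expr1 PM.
  rewrite normrM gtr0_norm // ler_pM2l // horner_bound // (ltW tp) /=.
  exact: le_trans tle t11.
apply/eqP; rewrite -normr_le0; apply/ler_addgt0Pr => e e0; rewrite add0r.
set C := M + coef_norm Q in small.
have C0 : 0 <= C by have := le_trans (normr_ge0 _) (small t1 t10 (lexx _)); rewrite pmulr_rge0.
pose t := Num.min t1 (e / (C + 1)).
have C1 : 0 < C + 1 by lra.
have tp : 0 < t by rewrite lt_min t10 divr_gt0.
apply: le_trans (small t tp _) _; first by rewrite ge_min lexx.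
have : t <= e / (C + 1) by rewrite ge_min lexx orbT.
rewrite ler_pdivlMr // => h; apply: le_trans h.
by rewrite ler_pM2l //; lra.
Qed.

(** A polynomial that is [O(t^(m+1))] at 0 is divisible by [X^(m+1)]. *)
Lemma small_poly_coef (P : {poly R}) (M t1 : R) m : 0 < t1 -> t1 <= 1 ->
  (forall t, 0 < t -> t <= t1 -> `|P.[t]| <= M * t ^+ m.+1) -> forall n, (n <= m)%N -> P`_n = 0.
Proof.
move=> t10 t11; elim: m M P => [|m IH] M P PM.
  move=> n; rewrite leqn0 => /eqP->; exact: small_poly_const t10 t11 PM.
have P0 : P`_0 = 0.
  apply: (small_poly_const (M := M) t10 t11) => t tp tle; apply: le_trans (PM t tp tle) _.
  have M0 : 0 <= M.
    have := le_trans (normr_ge0 _) (PM t tp tle); rewrite pmulr_lge0 //.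
    exact: exprn_gt0.
  apply: ler_wpM2l => //; rewrite exprS expr1 ler_piMr ?(ltW tp) //.
  by apply: exprn_ile1; [exact: ltW|exact: le_trans tle t11].
have [Q PE] : exists Q, P = Q * 'X.
  by have /factor_theorem[Q] : root P 0; [rewrite rootE horner_coef0 P0|rewrite subr0; exists Q].
case=> [|n] nm //; rewrite PE coefMX /=; apply: (IH M) => // t tp tle.
have := PM t tp tle; rewrite PE hornerM hornerX normrM (gtr0_norm tp).
by rewrite [t ^+ m.+2]exprSr mulrA ler_pM2r.
Qed.
End PolyBound.

Section SeriesCoefficients.
Variables (R : realType) (T : choiceType) (k : T -> nat) (S : nat -> {fset T}).
Hypothesis SP : forall n I, (I \in S n) = (k I == n).

Lemma sum_level (J : {fset T}) (m : nat) (t : R) : (forall i, (i <= m)%N -> (S i `<=` J)%fset) ->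
  \sum_(I <- J | (k I <= m)%N) t ^+ k I = \sum_(i < m.+1) (#|` S i|)%:R * t ^+ i.
Proof.
move=> SJ; rewrite (partition_big (fun I => inord (k I) : 'I_m.+1) predT) //=.
apply: eq_bigr => i _.
transitivity (\sum_(I <- S i) t ^+ i).
  rewrite -big_filter [RHS]big_seq [LHS]big_seq_cond.
  rewrite [LHS](eq_bigl (fun I => I \in [seq x <- J | (k x <= m)%N && (inord (k x) == i)])); last by move=> I; rewrite andbT.
  have pS : perm_eq [seq x <- J | (k x <= m)%N && (inord (k x) == i)] (S i).
    apply: uniq_perm; rewrite ?filter_uniq ?fset_uniq // => I; rewrite mem_filter SP.
    apply/idP/eqP => [/andP[/andP[km /eqP ki] _]|ki].
      by rewrite -ki inordK.
    have im : (i <= m)%N by rewrite -ltnS.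
    rewrite ki im /=; apply/andP; split; first by apply/eqP/val_inj; rewrite /= inordK.
    by apply: (fsubsetP (SJ i im)); rewrite SP ki.
  rewrite (perm_big _ pS) /=; apply: eq_big => [I|I].
    by rewrite (perm_mem pS).
  by rewrite (perm_mem pS) SP => /eqP->.
by rewrite big_const_seq count_predT iter_addr_0 mulr_natl.
Qed.

(** Let [g = \sum_I t^(k I)], for small [t].  The terms of exponent more than [m] sum to at
    most [M (t / t1)^(m+1)] if [M] bounds the partial sums at [t1], so [D A - N = D (A - g)] is
    [O(t^(m+1))], where [A] is the truncation of the series. *)
Lemma series_coef (N D : {poly R}) (t0 : R) : 0 < t0 ->
  (forall t, 0 < t < t0 -> exists g, D.[t] * g = N.[t] /\
     forall e, 0 < e -> exists J0 : {fset T}, forall J : {fset T}, (J0 `<=` J)%fset ->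
       `|\sum_(I <- J) t ^+ k I - g| < e) ->
  forall m n, (n <= m)%N -> (D * (\sum_(i < m.+1) (#|` S i|)%:R *: 'X^i) - N)`_n = 0.
Proof.
move=> t00 cvg m n nm; set A := \sum_(i < m.+1) _.
pose t1 := Num.min (t0 / 2) 1.
have t1_gt0 : 0 < t1 by rewrite lt_min ltr01 divr_gt0.
have t1_lt : t1 < t0 by rewrite gt_min; apply/orP; left; lra.
have t1_le1 : t1 <= 1 by rewrite ge_min lexx orbT.
have [|g1 [_ c1]] := cvg t1; first by rewrite t1_gt0.
have [J1 J1P] := c1 1 ltr01.
pose M := g1 + 1.
have boundM (J : {fset T}) : \sum_(I <- J) t1 ^+ k I <= M.
  have := J1P (J1 `|` J)%fset (fsubsetUl _ _); rewrite ltr_norml => /andP[_ h].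
  have : \sum_(I <- J) t1 ^+ k I <= \sum_(I <- (J1 `|` J)%fset) t1 ^+ k I.
    rewrite [X in _ <= X](big_fsetID _ (fun I => I \in J)) /=.
    rewrite (_ : [fset x | x in (J1 `|` J)%fset & x \in J]%fset = J); last first.
      by apply/fsetP => I; rewrite !inE /= andb_idl // => ->; rewrite orbT.
    by rewrite lerDl sumr_ge0 // => I _; rewrite exprn_ge0 // ltW.
  by rewrite /M; lra.
have M0 : 0 <= M by have := boundM fset0; rewrite big_seq_fset0.
pose Jm : {fset T} := (\bigcup_(i <- iota 0 m.+1) S i)%fset.
have SJm i : (i <= m)%N -> (S i `<=` Jm)%fset.
  by move=> im; apply: bigfcup_sup => //; rewrite mem_iota.
apply: (@small_poly_coef _ _ (coef_norm D * M / t1 ^+ m.+1) t1 m) => // t tp tle.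
have [|g [Dg cg]] := cvg t; first by rewrite tp (le_lt_trans tle).
have AE : A.[t] = \sum_(i < m.+1) (#|` S i|)%:R * t ^+ i.
  by rewrite /A horner_sum; apply: eq_bigr => i _; rewrite !hornerE.
have tail : `|A.[t] - g| <= M / t1 ^+ m.+1 * t ^+ m.+1.
  apply/ler_addgt0Pr => e e0; have [J0 J0P] := cg e e0.
  have := J0P (J0 `|` Jm)%fset (fsubsetUl _ _); set J := (J0 `|` Jm)%fset.
  rewrite (bigID (fun I => (k I <= m)%N)) /= sum_level -?AE => [|i im]; last first.
    by apply: fsubset_trans (SJm i im) (fsubsetUr _ _).
  set r := \sum_(I <- J | _) _ => h.
  have r0 : 0 <= r by apply: sumr_ge0 => I _; rewrite exprn_ge0 // ltW.
  have rM : r <= M / t1 ^+ m.+1 * t ^+ m.+1.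
    apply: le_trans (_ : (t / t1) ^+ m.+1 * \sum_(I <- J) t1 ^+ k I <= _); last first.
      have -> : M / t1 ^+ m.+1 * t ^+ m.+1 = (t / t1) ^+ m.+1 * M by rewrite expr_div_n; ring.
      by rewrite ler_wpM2l // exprn_ge0 // divr_ge0 // ltW.
    rewrite mulr_sumr [X in _ <= X](bigID (fun I => (k I <= m)%N)) /= ler_wpDl //.
      apply: sumr_ge0 => I _; rewrite mulr_ge0 // exprn_ge0 //; first by rewrite divr_ge0 // ltW.
      exact: ltW.
    apply: ler_sum => I; rewrite -ltnNge => mk.
    rewrite -(subnKC mk) !exprD mulrA -exprMn divfK ?gt_eqF //.
    by rewrite ler_wpM2l ?exprn_ge0 ?(ltW tp) // lerXn2r // nnegrE ltW.
  move: h rM; rewrite !(ltr_norml, ler_norml) => /andP[h1 h2] h3.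
  by apply/andP; split; lra.
rewrite hornerD hornerN hornerM -Dg -mulrBr normrM -!mulrA.
apply: ler_pM => //; last by rewrite mulrA.
by apply: horner_bound; rewrite (ltW tp) (le_trans tle).
Qed.
End SeriesCoefficients.

Lemma cpow_real (R : realType) (n : nat) (x : R) :
  cpow n (- (x%:C)%C) = (expR (- x * ln n%:R))%:C%C.
Proof.
rewrite /cpow /cexp; set z := - _ * _.
have -> : z = (- x * ln n%:R)%:C%C by rewrite /z rmorphM rmorphN.
by rewrite /= cos0 sin0 mulr1.
Qed.

Lemma gr_zeta_cvg (R : realType) (A : comNzRingType) (L : lieAlgType A) (c : nat) (s : R[i]) :
  gr_zeta_converges L c s -> forall eps : R[i], 0 < eps ->
  summability.totally (fun J => `|gr_zeta L c s - summability.partial_sum (@gr_zeta_term R A L c s) J| < eps).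
Proof.
rewrite /gr_zeta_converges; set u := summability.partial_sum _; set G := lim _ => h.
have E : G = gr_zeta L c s by [].
rewrite E in h.
have h3 := proj1 (@cvgrPdist_lt _ (R[i]^o : normedModType R[i]) _ summability.totally _ u (gr_zeta L c s)) h.
move=> eps e0; apply: h3 => //; by case: (@summability.totally_filter (graded_ideal L c)).
Qed.

Section ZetaSeries.
Variables (R : realType) (A : comNzRingType) (L : lieAlgType A) (c p : nat).
Variables (k : graded_ideal L c -> nat) (S : nat -> {fset graded_ideal L c}).
Hypotheses (p_gt1 : (1 < p)%N).
Hypothesis index_pow : forall I : graded_ideal L c, submod_index (val I) = (p ^ k I)%N.
Hypothesis SP : forall n I, (I \in S n) = (k I == n).

Let lnp_gt0 : 0 < ln p%:R :> R.
Proof. by rewrite ln_gt0 // ltr1n. Qed.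

Lemma gr_zeta_term_real (t : R) (I : graded_ideal L c) : 0 < t ->
  gr_zeta_term (- (ln t / ln p%:R))%:C%C I = ((t ^+ k I)%:C)%C.
Proof.
move=> t0; rewrite /gr_zeta_term index_pow cpow_real opprK natrX lnXn ?ltr0n ?(ltnW p_gt1) //.
by rewrite mulrnAr divfK ?gt_eqF // -lnXn // lnK // posrE exprn_gt0.
Qed.

(** For real [t] near 0, [p^(-s) = t] at [s = - log_p t], whose real part is large. *)
Lemma gr_zeta_coef (N D : {poly int}) (sigma : R) :
  (forall s : R[i], sigma < complex.Re s -> gr_zeta_converges L c s /\
     (map_poly intr D).[cpow p (- s)] * gr_zeta L c s = (map_poly intr N).[cpow p (- s)]) ->
  forall m, eqm m (D * \sum_(i < m.+1) (#|` S i|)%:R *: 'X^i) N.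
Proof.
move=> zD m n nm.
pose f (P : {poly int}) : {poly R} := map_poly intr P.
apply: (@intr_inj R); rewrite -!coef_map -/(f N) rmorphM /= -/(f D).
apply/eqP; rewrite -subr_eq0 -coefB; apply/eqP.
have -> : map_poly intr (\sum_(i < m.+1) (#|` S i|)%:R *: 'X^i) =
   \sum_(i < m.+1) (#|` S i|)%:R *: 'X^i :> {poly R}.
  by rewrite rmorph_sum; apply: eq_bigr => i _ /=; rewrite map_polyZ map_polyXn /= rmorph_nat.
apply: (series_coef SP (t0 := expR (- sigma * ln p%:R))) => //; first exact: expR_gt0.
move=> t /andP[tp tlt]; pose s : R[i] := ((- (ln t / ln p%:R))%:C)%C.
have [|cs Ds] := zD s.
  rewrite /s /= ltrNr ltr_pdivrMr // -ltr_expR lnK //.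
have cpE : cpow p (- s) = (t%:C)%C.
  by rewrite cpow_real opprK divfK ?gt_eqF // lnK.
have fE P : (map_poly intr P).[cpow p (- s)] = ((f P).[t]%:C)%C.
  rewrite cpE -horner_map -map_poly_comp; congr (_.[_]).
  by apply: eq_map_poly => z; rewrite /= rmorph_int.
exists (complex.Re (gr_zeta L c s)); split.
  move: Ds; rewrite !fE => /(congr1 (@complex.Re R)); case: (gr_zeta L c s) => a b /=.
  by rewrite mul0r subr0.
move=> e e0; have := gr_zeta_cvg cs (eps := (e%:C)%C).
rewrite ltcR => /(_ e0) [J0 _ J0P]; exists J0 => J /J0P.
have -> : summability.partial_sum (@gr_zeta_term R A L c s) J = ((\sum_(I <- J) t ^+ k I)%:C)%C.
  rewrite /summability.partial_sum rmorph_sum big_seq_fsetE /=.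
  by apply: eq_bigr => I _; rewrite gr_zeta_term_real.
move=> h; rewrite -ltcR; apply: le_lt_trans h.
rewrite distrC; apply: le_trans (normc_ge_Re _).
by rewrite lecR; case: (gr_zeta L c s) => a b /=.
Qed.
End ZetaSeries.

(** * The reduced zeta function *)

Lemma cross_multiply (K : fieldType) (a b c d : K) : b != 0 -> d != 0 -> a / b = c / d -> b * c = a * d.
Proof. by move=> b0 d0 /eqP; rewrite eqr_div // => /eqP ->; rewrite mulrC. Qed.
Section RationalFunctionValue.
Variables (F : numFieldType).

Lemma eval2M (P Q : {poly {poly rat}}) (x y : F) : eval2 (P * Q) x y = eval2 P x y * eval2 Q x y.
Proof. by rewrite /eval2 rmorphM /= !hornerM. Qed.

(** The value of [W] may be computed from any fraction [N / D], provided that division by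
    [D(k, y)], which may be zero, is avoided. *)
Lemma ratfun_value_int (N D : {poly {poly int}}) (W : ratfun2) (k : nat) (y v : F) :
  D != 0 -> W = tofrac (int2 N) / tofrac (int2 D) -> ratfun_value W k%:R y v ->
  (map_poly intr D.[k%:R]).[y] * v = (map_poly intr N.[k%:R]).[y].
Proof.
move=> D0 WE [N' [D' [WE' D'0 ->]]]; rewrite -!eval2_int2 mulrA; apply: (canLR (mulfK D'0)).
have tD0 : tofrac (int2 D) != 0 by rewrite tofrac_eq0 -(rmorph0 int2) (inj_eq int2_inj).
have tD'0 : tofrac D' != 0.
  rewrite tofrac_eq0; apply: contraNneq D'0 => ->.
  by rewrite /eval2 !rmorph0 !horner0.
rewrite -!eval2M; congr (eval2 _ _ _); apply/eqP; rewrite -tofrac_eq !tofracM.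
by rewrite (cross_multiply tD0 tD'0 (etrans (esym WE) WE')).
Qed.
End RationalFunctionValue.

Section GeneratingFunction.
Variables (A : comNzRingType) (L : lieAlgType A) (frame : graded_frame L).
Variables (p : nat) (p_pr : prime p).
Hypothesis nat_unit : forall n, ~~ (p %| n)%N -> exists y : A, y * n%:R = 1.
Hypothesis reduction : forall m, (0 < m)%N ->
  exists f : {rmorphism A -> 'Z_(p ^ m)}, forall x, f x = 0 -> exists y, x = (p ^ m)%:R * y.

Definition ideal_poly m : {poly int} := \sum_(i < m.+1) (#|` level_set L p i|)%:R *: 'X^i.

Lemma ideal_poly_zeta (R : realType) (N D : {poly int}) (sigma : R) :
  (forall s : R[i], sigma < complex.Re s -> gr_zeta_converges L 3 s /\
     (map_poly intr D).[cpow p (- s)] * gr_zeta L 3 s = (map_poly intr N).[cpow p (- s)]) ->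
  forall m, eqm m (D * ideal_poly m) N.
Proof.
move=> zD m; apply: (gr_zeta_coef (prime_gt1 p_pr) _ _ zD).
  exact: (levelP frame p_pr nat_unit reduction).
move=> n; have [in_level _] := count_graded_ideals frame p_pr nat_unit reduction (ltn0Sn n) (leqnSn n).
exact: in_level.
Qed.

Lemma ideal_poly_mod (l m n : nat) : prime l -> (9 <= l)%N -> (p %| (2 ^ l).-1)%N -> (0 < m)%N ->
  (n <= m)%N -> (l%:Z %| (ideal_poly m - exp_poly m)`_n)%Z.
Proof.
move=> l_pr l9 pl m0 nm; have [u [ul u_gen]] := torus_generator p_pr m0 l_pr pl.
have cnt := count_ideal_triples p_pr m0 l_pr ul l9 u_gen n.
have [_ lev] := count_graded_ideals frame p_pr nat_unit reduction m0 nm.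
rewrite coefB; have -> : (ideal_poly m)`_n = #|` level_set L p n|%:R.
  rewrite coef_sum (bigD1 (Ordinal (nm : (n < m.+1)%N))) //= coefZ coefXn eqxx mulr1 big1 ?addr0 // => i ni.
  by rewrite coefZ coefXn -val_eqE /= eq_sym in ni *; rewrite (negPf ni) mulr0.
rewrite coef_exp_poly lev.
rewrite !natz -eqz_mod_dvd !modz_nat; apply/eqP; congr Posz; exact: cnt.
Qed.
End GeneratingFunction.

Theorem corollary1p3 (R : realType) (W : ratfun2) :
  (forall (p : nat) (p_pr : prime p) (K : fieldExtType (padic p_pr)) (q : nat),
     residue_card (integer_ring K) q ->
     let L := base_change (free_nilpotent_lie_ring 3 3) (integer_ring K) in
     exists sigma : R, forall s : R[i], sigma < complex.Re s ->
       gr_zeta_converges L 3 s /\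
       ratfun_value W q%:R (cpow q (- s)) (gr_zeta L 3 s)) ->
  let Y : {fraction {poly rat}} := tofrac 'X in
  ratfun_value W 1 Y
    ((map_poly intr N_red).[Y] /
       ((1 - Y) ^+ 3 * (1 - Y ^+ 3) * (1 - Y ^+ 4) ^+ 2 * (1 - Y ^+ 5) *
          \prod_(8 <= i < 15) (1 - Y ^+ i))).
Proof.
pose O p (p_pr : prime p) := integer_ring ((padic p_pr)^o : fieldExtType (padic p_pr)).
pose L p p_pr : lieAlgType (O p p_pr) := base_change (free_nilpotent_lie_ring 3 3) (O p p_pr).
pose A p p_pr := @ideal_poly _ (L p p_pr) p.
move=> zetaW; apply: (@ratfun_value_at1 W A); last first.
  move=> p p_pr l m n l_pr.
  exact: (ideal_poly_mod (free_nilpotent_frame (O p p_pr)) p_pr (@integer_nat_unit p p_pr)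
    (@integer_reduction p p_pr)).
move=> N D D0 WE p p_pr m _.
have [sigma zW] := zetaW p p_pr _ p (residue_card_rational p_pr).
apply: (@ideal_poly_zeta _ _ (free_nilpotent_frame (O p p_pr)) p p_pr (@integer_nat_unit p p_pr)
  (@integer_reduction p p_pr) R N.[p%:R] D.[p%:R] sigma) => s /zW[cs Ws].
by split=> //; exact: (ratfun_value_int D0 WE Ws).
Qed.
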